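(* Let $\xi,\varrho<\omega_1$. The following are equivalent. (1) $\varrho\in R(\xi)$. (2) There is a normalized block sequence $(x_i)_{i=1}^\infty\subset X_\xi$ equivalent to a subsequence of the canonical basis of $X_\varrho$. (3) There is a normalized block sequence $(x_i^* )_{i=1}^\infty\subset X_\xi^*$ equivalent to a subsequence of the canonical basis of $X_\varrho^*$. (4) There is a $\varrho$-Schreier pair $((x_i)_{i=1}^\infty,(x_i^* )_{i=1}^\infty)\subset X_\xi\times X_\xi^*$. If any of the conditions (1), (2), (3), (4) is satisfied, the sequences $(x_i)_{i=1}^\infty$ and $(x_i^* )_{i=1}^\infty$ in (4) can be chosen so that each $x_i$, $i\in\mathbb N$, is a convex combination of elements of the canonical basis of $X_\xi$, and each $x_i^*$, $i\in\mathbb N$, is a finite sum of elements of the canonical basis of $X_\xi^*$.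
   Context: Notation. $\mathbb N=\{1,2,\dots\}$; $[\mathbb N]^{<\omega}$ and $[\mathbb N]$ are the sets of finite, resp. infinite, subsets of $\mathbb N$. $\max\varnothing=0$, $\min\varnothing=\infty$; $E<F$ means $\max E<\min F$, and $n\leqslant E$ means $n\leqslant\min E$. $\omega_1$ is the first uncountable ordinal. For ordinals $\iota\leqslant\xi$, $\xi-\iota$ is the unique ordinal $\varrho$ with $\iota+\varrho=\xi$, and $R(\xi)=\{\xi-\iota:\iota\leqslant\xi\}$ (a finite set). Schreier families. $\mathcal S_0=\{\varnothing\}\cup\{\{n\}:n\in\mathbb N\}$; $\mathcal S_{\xi+1}=\{\varnothing\}\cup\{\bigcup_{i=1}^kE_i: k\leqslant E_1<\dots<E_k,\ \varnothing\ne E_i\in\mathcal S_\xi\}$; for a countable limit ordinal $\xi$ one fixes once and for all a sequence $\xi_n\uparrow\xi$ with $\mathcal S_{\xi_n+1}\subset\mathcal S_{\xi_{n+1}}$ for all $n$, and $\mathcal S_\xi=\{\varnothing\}\cup\{E\ne\varnothing:\exists n\leqslant E,\ E\in\mathcal S_{\xi_n+1}\}$. Schreier spaces. The scalar field $\mathbb K$ is $\mathbb R$ or $\mathbb C$. $c_{00}$ is the space of finitely nonzero scalar sequences, $(e_i)$ its canonical basis. $X_\xi$ is the completion of $c_{00}$ under $\|x\|_\xi=\sup_{E\in\mathcal S_\xi}\|Ex\|_{\ell_1}$, where $Ex$ is the coordinate restriction of $x$ to $E$. $(e_i^\xi)$ denotes the canonical basis of $X_\xi$ and $(f_i^\xi)\subset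 X_\xi^*$ its coordinate functionals, which form a basis of $X_\xi^*$ (the canonical basis of $X^*_\xi$). A block sequence in $X_\xi$ (resp. $X_\xi^*$) is a sequence of nonzero finitely supported vectors with successive supports with respect to $(e_i^\xi)$ (resp. $(f_i^\xi)$). $|x|$, $|x^*|$ denote coordinatewise moduli with respect to these bases. $\approx$ denotes equivalence of basic sequences. $(x\otimes x^* )(y)=x^*(y)x$. A pair of normalized block sequences $(x_i)\subset X_\xi$, $(x_i^* )\subset X_\xi^*$ is a $\varrho$-Schreier pair ($\varrho<\omega_1$) if for some $J\in[\mathbb N]$: (i) $x_i^*(x_j)=0$ for $i\neq j$; (ii) $\mathrm{Re}\,x_i^*(x_i)=|x_i^*|(|x_i|)$ for all $i$; (iii) $\inf_i\mathrm{Re}\,x_i^*(x_i)>0$; (iv) $(x_i)_{i=1}^\infty\approx(e_i^\varrho)_{i\in J}$; (v) $(x_i^* )_{i=1}^\infty\approx(f_i^\varrho)_{i\in J}$; (vi) $\sup_n\|\sum_{i=1}^nx_i\otimes x_i^*\|<\infty$. *)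

(* Defs.v *)
From HB Require Import structures.
From mathcomp Require Import all_boot all_order all_algebra finmap complex.
From mathcomp Require Import all_classical all_reals all_analysis.
From mathcomp Require wochoice.
Set Implicit Arguments.
Unset Strict Implicit.
Unset Printing Implicit Defensive.
Import Order.TTheory GRing.Theory Num.Theory.
Import numFieldNormedType.Exports.
Local Open Scope classical_set_scope.
Local Open Scope ring_scope.

(* Countable ordinals are the elements of a well-ordered set Omega of order
   type omega_1; [is_omega1] characterizes such sets up to order isomorphism. *)
Definition is_omega1 (d : Order.disp_t) (Omega : orderType d) : Prop :=
  [/\ well_founded (fun eta xi : Omega => (eta < xi)%O),
      (forall xi : Omega, countable [set eta : Omega | (eta < xi)%O]) &
      ~ countable [set: Omega]].

Lemma omega1_exists :
  exists (d : Order.disp_t) (Omega : orderType d), is_omega1 Omega.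
Proof.
have [le wo] := wochoice.well_ordering_principle (set nat).
have wo' : wochoice.wo_chain le predT by move=> A _; exact: wo.
have tot : total le by move=> x y; exact: (wochoice.wo_chainW wo').
have anti : antisymmetric le.
  by move=> x y; exact: (wochoice.wo_chain_antisymmetric wo').
have refl : reflexive le by move=> x; exact: (wochoice.wo_chain_reflexive wo').
have min A : A !=set0 -> exists2 z : set nat, A z & forall x, A x -> le z x.
  move=> [a Aa]; have [|z [[Az lb] _]] := wo (mem A).
    by exists a; rewrite inE.
  exists z => [|x Ax]; first by rewrite inE in Az.
  by apply: lb; rewrite inE.
have trans : transitive le.
  move=> y x z xy yz.
  have [w] := min [set x; y; z] (ex_intro _ x (or_introl (or_introl erefl))).
  move=> [[|]|] -> lb; first by apply: lb; right.
    have yx : le y x by apply: lb; left; left.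
    by have -> : x = y by apply: anti; rewrite xy yx.
  have zy : le z y by apply: lb; left; right.
  by have <- : y = z by apply: anti; rewrite yz zy.
pose W := {x : set nat | countable [set y | le y x && (y != x)]}.
pose leW (x y : W) := le (sval x) (sval y).
have antiW : antisymmetric leW by move=> x y /anti; exact: eq_sig_hprop.
pose Wc : choiceType :=
  HB.pack W (gen_eqMixin W) (gen_choiceMixin W).
pose ltW (x y : Wc) := (y != x) && leW x y.
pose mx := @Order.isOrder.Build Order.default_display Wc leW ltW
   (fun x y => if ltW x y then x else y)
   (fun x y => if ltW x y then y else x)
   (fun _ _ => erefl) (fun _ _ => erefl) (fun _ _ => erefl)
   antiW (fun y x z => trans _ _ _) (fun x y => tot _ _).
pose Om : orderType Order.default_display := HB.pack Wc mx.
have valI (x y : Om) : sval x = sval y -> x = y by exact: eq_sig_hprop.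
have ltE (x y : Om) : (x < y)%O =
    le (sval x) (sval y) && (sval x != sval y).
  rewrite lt_neqAle andbC.
  have -> : (x == y) = (sval x == sval y).
    by apply/eqP/eqP => [->//|]; exact: valI.
  by [].
have cW (x : Om) : countable [set y : Om | (y < x)%O].
  have /countable_injP[f f_inj] := svalP x.
  apply/countable_injP; exists (fun y : Om => f (sval y)) => y z.
  move=> /set_mem /= + /set_mem /=; rewrite !ltE => yx zx fyz.
  by apply: valI; apply: f_inj fyz; exact/mem_set.
exists Order.default_display, Om; split; [|exact: cW|].
  move=> x; apply: contrapT => nAcc.
  pose B := [set sval y | y in [set y : Om | ~ Acc (fun a b => (a < b)%O) y]].
  have [_ [y nAy <-] lb] : exists2 z, B z & forall u, B u -> le z u.
    by apply: min; exists (sval x); exists x.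
  apply: nAy; constructor => z; rewrite ltE => /andP[zy zNy].
  apply: contrapT => nAz; case/negP: zNy; apply/eqP/anti; rewrite zy /=.
  by apply: lb; exists z.
move=> cT.
pose S := [set x : set nat | countable [set y | le y x && (y != x)]].
have cS : countable S.
  apply: sub_countable cT.
  have -> : S = range (fun y : Om => sval y).
    by apply/seteqP; split => [x Sx|_ [y _ <-]]; [exists (exist _ x Sx)|exact: svalP y].
  exact: card_image_le.
have [ST|/existsNP NS] := pselect (forall x, S x).
  have : countable [set: set nat] by apply: sub_countable cS; apply: subset_card_le => A _; exact: ST.
  move=> /countable_injP[f /(_ _ _ (mem_set I) (mem_set I)) f_inj].
  pose D := [set n | exists2 A : set nat, f A = n & ~ A n].
  have [DfD|nD] := pselect (D (f D)).
    by case: (DfD) => A /f_inj ->.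
  by apply: (nD); exists D.
have [z nSz lb] := min (~` S) NS.
apply: nSz; apply: sub_countable cS; apply: subset_card_le => y /= /andP[yz yNz].
apply: contrapT => nSy; case/negP: yNz; apply/eqP/anti; rewrite yz /=.
exact: lb.
Qed.

Section ordinals.
Variables (d : Order.disp_t) (Omega : orderType d).
Implicit Types xi zeta eta iota rho sigma : Omega.

Definition is_zero xi : Prop := forall eta, (xi <= eta)%O.

(* zeta = xi + 1 *)
Definition is_succ xi zeta : Prop :=
  (xi < zeta)%O /\ forall eta, (xi < eta)%O -> (zeta <= eta)%O.

Definition is_limit xi : Prop :=
  ~ is_zero xi /\ forall eta, ~ is_succ eta xi.

(* [ord_sum iota rho xi] : iota + rho = xi, by recursion on rho *)
Inductive ord_sum iota : Omega -> Omega -> Prop :=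
| ord_sum_zero rho : is_zero rho -> ord_sum iota rho iota
| ord_sum_succ rho rho' xi xi' : is_succ rho rho' -> is_succ xi xi' ->
    ord_sum iota rho xi -> ord_sum iota rho' xi'
| ord_sum_limit rho xi (g : Omega -> Omega) : is_limit rho ->
    (forall sigma, (sigma < rho)%O -> ord_sum iota sigma (g sigma)) ->
    supremums [set g sigma | sigma in [set sigma | (sigma < rho)%O]] xi ->
    ord_sum iota rho xi.

(* The set R(xi) of the differences xi - iota, for iota <= xi *)
Definition remainders xi : set Omega :=
  [set rho | exists2 iota, (iota <= xi)%O & ord_sum iota rho xi].

(* The index i : nat stands for the positive integer i.+1, both for elements of
   finite subsets of {1, 2, ...} and for coordinates; so [fset_geq k E] is
   k <= min E. *)
Definition fset_geq (k : nat) (E : {fset nat}) : Prop :=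
  forall i : nat, i \in E -> (k <= i.+1)%N.

Definition fset_before (E F : {fset nat}) : Prop :=
  forall i j : nat, i \in E -> j \in F -> (i < j)%N.

(* [fs xi n] is the term of index n.+1 of the sequence fixed for the limit
   ordinal xi; the values of [fs] at other ordinals are irrelevant. *)
Variable fs : Omega -> nat -> Omega.

Inductive schreier : Omega -> {fset nat} -> Prop :=
| schreier_empty xi : schreier xi fset0
| schreier_zero xi (n : nat) : is_zero xi -> schreier xi [fset n]%fset
| schreier_succ xi zeta (k : nat) (E : nat -> {fset nat}) :
    is_succ xi zeta -> (0 < k)%N ->
    (forall i, (i < k)%N -> E i != fset0 /\ schreier xi (E i)) ->
    (forall i j, (i < j < k)%N -> fset_before (E i) (E j)) ->
    fset_geq k (E 0%N) ->
    schreier zeta (\big[fsetU/fset0]_(i < k) E i)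
| schreier_limit xi (n : nat) zeta (E : {fset nat}) :
    is_limit xi -> E != fset0 -> fset_geq n.+1 E ->
    is_succ (fs xi n) zeta -> schreier zeta E -> schreier xi E.

Definition schreier_sequences : Prop := forall xi, is_limit xi ->
  [/\ forall m n : nat, (m < n)%N -> (fs xi m < fs xi n)%O,
      supremums (range (fs xi)) xi &
      forall n zeta, is_succ (fs xi n) zeta ->
        schreier zeta `<=` schreier (fs xi n.+1)].

End ordinals.

Variant scalars := real_scalars | complex_scalars.

Definition scalar_field (R : realType) (s : scalars) : numFieldType :=
  match s with real_scalars => R | complex_scalars => R[i] end.

Definition scalar_re (R : realType) (s : scalars) : scalar_field R s -> R :=
  match s with real_scalars => id | complex_scalars => @complex.Re R end.

Definition scalar_of_real (R : realType) (s : scalars) : R -> scalar_field R s :=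
  match s with real_scalars => id | complex_scalars => real_complex R end.

Definition c00 (K : numFieldType) : set (nat -> K) :=
  [set a | finite_set [set i | a i != 0]].

Section norms.
Variables (R : realType) (s : scalars).
Local Notation K := (scalar_field R s).

(* The norm of a normed space over K is K-valued in the library. *)
Definition rnorm (V : normedModType K) (v : V) : R := scalar_re `|v|.

Definition op_norm (V W : normedModType K) (T : V -> W) : R :=
  sup [set rnorm (T v) | v in [set v | rnorm v <= 1]].

Definition schreier_norm (F : set {fset nat}) (a : nat -> K) : R :=
  sup [set \sum_(i <- E) scalar_re `|a i| | E in F].

End norms.

(* Finite linear combination: used for a in c00 only. *)
Definition lincomb (K : numFieldType) (V : lmodType K) (b : nat -> V)
    (a : nat -> K) : V :=
  \sum_(i \in [set: nat]) a i *: b i.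

(* A completion of c00 under the norm given by the family F: a Banach space
   containing an isometric copy of (c00, schreier_norm F) as a dense subspace,
   given by the images of the unit vectors, with the coordinate functionals. *)
Record schreier_space (R : realType) (s : scalars) (F : set {fset nat}) :=
  SchreierSpace {
    space :> completeNormedModType (scalar_field R s) ;
    basis : nat -> space ;
    coord : nat -> space -> (scalar_field R s)^o ;
    norm_lincomb : forall a, c00 a ->
      rnorm (lincomb basis a) = schreier_norm F a ;
    dense_lincomb : dense [set lincomb basis a | a in @c00 (scalar_field R s)] ;
    coord_linear : forall k, linear (coord k) ;
    coord_continuous : forall k, continuous (coord k) ;
    coord_basis : forall k i, coord k (basis i) = (k == i)%:R
  }.

Section sequences.
Variables (K : numFieldType) (V : lmodType K).
(* A basis b and its coordinate functionals c *)
Variables (b : nat -> V) (c : nat -> V -> K).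

Definition block_sequence (v : nat -> V) : Prop :=
  [/\ forall i, v i <> 0,
      forall i, exists2 a, c00 a & v i = lincomb b a &
      forall i k l, c k (v i) != 0 -> c l (v i.+1) != 0 -> (k < l)%N].

(* The coordinatewise modulus of a finitely supported v *)
Definition modulus (v : V) : V := lincomb b (fun k => `|c k v|).

End sequences.

(* Equivalence of basic sequences v and w, in spaces normed by NV and NW *)
Definition equivalent (R : realType) (K : numFieldType) (V W : lmodType K)
    (NV : V -> R) (v : nat -> V) (NW : W -> R) (w : nat -> W) : Prop :=
  exists2 C : R, 0 < C & forall a, c00 a ->
    NV (lincomb v a) <= C * NW (lincomb w a) /\
    NW (lincomb w a) <= C * NV (lincomb v a).

(* Increasing enumerations of the infinite subsets of nat *)
Definition increasing (j : nat -> nat) : Prop :=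
  forall m n, (m < n)%N -> (j m < j n)%N.

Section schreier_pairs.
Variables (R : realType) (s : scalars) (F G : set {fset nat}).
Variables (X : schreier_space R s F) (Y : schreier_space R s G).
Local Notation K := (scalar_field R s).

(* The dual of X is seen inside the space of functions X -> K, with the norm
   [op_norm]; a linear combination of the coordinate functionals is linear and
   continuous. The coordinate of f along [coord X k] is f (basis X k). *)
Definition dual_coord (k : nat) (f : X -> K^o) : K := f (basis X k).

Definition normalized_block (x : nat -> X) : Prop :=
  block_sequence (basis X) (@coord _ _ _ X) x /\ forall i, rnorm (x i) = 1.

Definition dual_normalized_block (xs : nat -> X -> K^o) : Prop :=
  block_sequence (@coord _ _ _ X) dual_coord xs /\
  forall i, op_norm (xs i) = 1.

Definition equiv_subbasis (x : nat -> X) (j : nat -> nat) : Prop :=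
  equivalent (@rnorm R s X) x (@rnorm R s Y) (fun i => basis Y (j i)).

Definition equiv_dual_subbasis (xs : nat -> X -> K^o) (j : nat -> nat) : Prop :=
  equivalent (@op_norm R s X K^o) xs
    (@op_norm R s Y K^o) (fun i => @coord _ _ _ Y (j i)).

Definition tensor (x : X) (f : X -> K^o) : X -> X := fun y => f y *: x.

Definition schreier_pair (x : nat -> X) (xs : nat -> X -> K^o) : Prop :=
  [/\ normalized_block x, dual_normalized_block xs &
  exists2 j : nat -> nat, increasing j &
  [/\ forall i k, i != k -> xs i (x k) = 0,
      forall i, scalar_of_real s (scalar_re (xs i (x i))) =
        modulus (@coord _ _ _ X) dual_coord (xs i)
          (modulus (basis X) (@coord _ _ _ X) (x i)),
      0 < inf (range (fun i => scalar_re (xs i (x i)))),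
      equiv_subbasis x j /\ equiv_dual_subbasis xs j &
      has_ubound (range (fun n : nat =>
        op_norm (\sum_(i < n) tensor (x i) (xs i))))]].

Definition convex_comb_basis (x : X) : Prop :=
  exists (E : {fset nat}) (t : nat -> K),
    [/\ forall k, k \in E -> 0 <= t k, \sum_(k <- E) t k = 1 &
        x = \sum_(k <- E) t k *: basis X k].

Definition sum_dual_basis (f : X -> K^o) : Prop :=
  exists E : {fset nat}, f = \sum_(k <- E) (@coord _ _ _ X k : X -> K^o).

End schreier_pairs.

(* Main.v *)
Require Import Defs.
From HB Require Import structures.
From mathcomp Require Import all_boot all_order all_algebra finmap complex.
From mathcomp Require Import all_classical all_reals all_analysis.
From mathcomp Require Import zify ring lra.
Set Implicit Arguments.
Unset Strict Implicit.
Unset Printing Implicit Defensive.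
Import Order.TTheory GRing.Theory Num.Theory.
Import numFieldNormedType.Exports.
Local Open Scope classical_set_scope.
Local Open Scope ring_scope.

(* For (1) => (4), write xi = iota + rho. Up to a shift of the indices, a set is in
   S_xi exactly when it is a union along S_rho of sets of S_iota. Averages on
   successive sets B_r of S_iota whose S_eta-norms tend to 0 for every eta < iota
   then behave like the basis of X_rho, and the sums over the B_r like the basis
   of its dual.

   For (2) => (1), let iota be minimal such that the S_iota-norms of the blocks do
   not tend to 0. A subsequence then behaves like the basis of X_zeta with
   xi = iota + zeta, and repeated averages separate X_zeta from X_rho if
   zeta <> rho.

   For (3) => (1), suppose that rho is not in R(xi), and let iota be minimal with
   xi - iota < rho. Vectors y_i with x*_i(y_i) = 1 dominate the basis of X_rho, so
   their S_eta-norms cannot all be small for eta < iota. By duality x*_i is, up to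
   any eps, in a multiple of the unit ball of the dual of some X_eta, eta < iota,
   where xi - eta >= rho + 1. Passing to a fast subsequence, the sums of the x*_i
   along S_(rho+1) are bounded, contrary to the case of the dual of X_rho. *)

(** * Differences of ordinals *)

(** The sequences fixed at limit ordinals are arbitrary, so those of xi, iota and rho are unrelated,
    and S_xi can be compared with the unions of sets of S_iota along S_rho only beyond thresholds,
    the functions [l] and [u] below. All subsequences are chosen to outrun these thresholds. Often
    the threshold of a block must be known before the block is chosen; estimates then hold along
    indices shifted by one step, and undoing the shift costs a factor 2 ([shift_mass]).

    In (3) => (1), the ordinal eta < iota and the constant K obtained for eps are out of control as
    eps decreases, so no single X_eta serves for all blocks. Level m works with a precision of order
    4^-m, and what is charged to it carries the weight 2^-m, so that the levels can be summed. The
    sets charged to one level are unions of boundedly many sets of S_eta that may interleave. Hence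
    the study of interleaved unions; since rho + 1 is not 0, unions along S_(rho+1) absorb this
    bounded number. *)

Section ordinal_arithmetic.
Variables (d : Order.disp_t) (Omega : orderType d).
Hypothesis wf : well_founded (fun eta xi : Omega => (eta < xi)%O).
Implicit Types xi zeta eta iota rho sigma tau x y : Omega.

Lemma ord_min (A : set Omega) :
  A !=set0 -> exists2 x, A x & forall y, A y -> (x <= y)%O.
Proof.
move=> [a Aa]; apply: contrapT => nmin.
suff nA x : ~ A x by exact: nA Aa.
elim/(well_founded_ind wf): x => x IH Ax.
apply: nmin; exists x => // y Ay; rewrite leNgt; apply/negP => /IH; exact.
Qed.

Lemma ord_ind (P : Omega -> Prop) :
  (forall x, (forall y, (y < x)%O -> P y) -> P x) -> forall x, P x.
Proof. exact: well_founded_ind wf P. Qed.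

Lemma zero_exists xi : exists2 z : Omega, is_zero z & (z <= xi)%O.
Proof.
have [z _ zmin] := @ord_min setT (ex_intro _ xi I).
by exists z => [y|]; exact: zmin.
Qed.

Lemma succ_exists sigma tau : (sigma < tau)%O ->
  exists2 sigma', is_succ sigma sigma' & (sigma' <= tau)%O.
Proof.
move=> st; have [x sx xmin] := @ord_min [set y | (sigma < y)%O] (ex_intro _ tau st).
by exists x; [split | exact: xmin].
Qed.

Lemma succ_le sigma sigma' tau :
  is_succ sigma sigma' -> (tau < sigma')%O -> (tau <= sigma)%O.
Proof.
move=> [_ h] lt; rewrite leNgt; apply/negP => /h; rewrite leNgt lt//.
Qed.

Lemma succ_inj sigma tau x : is_succ sigma x -> is_succ tau x -> sigma = tau.
Proof.
move=> sx tx; apply: le_anti; apply/andP; split.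
  exact: succ_le tx sx.1.
exact: succ_le sx tx.1.
Qed.

Lemma succ_fun sigma x y : is_succ sigma x -> is_succ sigma y -> x = y.
Proof.
move=> [sx hx] [sy hy]; apply: le_anti; rewrite hx //= hy//.
Qed.

Lemma zeroNsucc sigma x : is_succ sigma x -> ~ is_zero x.
Proof. by move=> [lt _] /(_ sigma); rewrite leNgt lt. Qed.

Lemma ord_kind x : [\/ is_zero x, exists y, is_succ y x | is_limit x].
Proof.
have [z|nz] := pselect (is_zero x); first by constructor 1.
have [s|ns] := pselect (exists y, is_succ y x); first by constructor 2.
by constructor 3; split=> // y yx; apply: ns; exists y.
Qed.

Lemma limit_succ sigma sigma' x : is_limit x -> (sigma < x)%O ->
  is_succ sigma sigma' -> (sigma' < x)%O.
Proof.
move=> [_ ns] lt ss; rewrite lt_neqAle ss.2 // andbT.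
by apply/eqP => e; apply: (ns sigma); rewrite -e.
Qed.

Lemma limit_lt sigma x : is_limit x -> (sigma < x)%O ->
  exists sigma', is_succ sigma sigma' /\ (sigma' < x)%O.
Proof.
move=> lx lt; have [s' ss _] := succ_exists lt.
by exists s'; split=> //; exact: limit_succ lx lt ss.
Qed.

Lemma zero_min x y : is_zero x -> ~ is_zero y -> (x < y)%O.
Proof.
move=> zx ny; rewrite ltNge; apply/negP => yx; apply: ny => w.
exact: le_trans yx (zx w).
Qed.

Lemma supremums_uniq (A : set Omega) x y :
  supremums A x -> supremums A y -> x = y.
Proof.
by move=> [ux lx] [uy ly]; apply: le_anti; rewrite lx //= ly.
Qed.

Lemma ord_sum_ge iota rho xi : ord_sum iota rho xi -> (iota <= xi)%O.
Proof.
elim=> {rho xi} [rho _//|rho rho' xi xi' _ sxi _ le|rho xi g lrho _ IH [ub _]].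
  exact: le_trans le (ltW sxi.1).
have [z zz _] := zero_exists rho.
have zr : (z < rho)%O by apply: zero_min => //; case: lrho.
by apply: le_trans (IH _ zr) (ub _ _); exists z.
Qed.

Lemma ord_sum_ger iota rho xi : ord_sum iota rho xi -> (rho <= xi)%O.
Proof.
elim=> {rho xi} [rho //|rho rho' xi xi' srho sxi _ le|rho xi g lrho _ IH [ub _]].
  by apply: srho.2; exact: le_lt_trans le sxi.1.
rewrite leNgt; apply/negP => lt.
have [s [ss sr]] := limit_lt lrho lt.
have : (g s <= xi)%O by apply: ub; exists s.
by rewrite leNgt (lt_le_trans ss.1 (IH _ sr)).
Qed.

Lemma ord_sum_inv iota rho xi : ord_sum iota rho xi ->
  [\/ is_zero rho /\ xi = iota,
      exists rho' xi', [/\ is_succ rho' rho, is_succ xi' xi &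
        ord_sum iota rho' xi'] |
      is_limit rho /\ exists g, (forall sigma, (sigma < rho)%O ->
        ord_sum iota sigma (g sigma)) /\
        supremums [set g sigma | sigma in [set sigma | (sigma < rho)%O]] xi].
Proof.
case=> {rho xi} [rho z|rho rho' xi xi' sr sx h|rho xi g lr h sx].
- by constructor 1.
- by constructor 2; exists rho, xi.
- by constructor 3; split=> //; exists g.
Qed.

Lemma ord_sum_fun iota rho xi xi' :
  ord_sum iota rho xi -> ord_sum iota rho xi' -> xi = xi'.
Proof.
move=> h; elim: h xi' => {rho xi} [rho z|rho rho' xi xi0 sr sx _ IH|rho xi g lr _ IH sx] xi' /ord_sum_inv.
- case=> [[//]|[r [x [sr _ _]]]|[[nz]]//].
  by case: (zeroNsucc sr).
- case=> [[/(zeroNsucc sr)]//|[r [x [sr' sx' h]]]|[[_ /(_ _ sr)]]//].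
  rewrite -(succ_inj sr sr') in h; rewrite -(IH _ h) in sx'.
  exact: succ_fun sx sx'.
- case=> [[z _]|[r [x [sr' _ _]]]|[_ [g' [hg sx']]]].
  + by case: lr.
  + by case: lr => _ /(_ _ sr').
  + apply: supremums_uniq sx _.
    suff -> : [set g s | s in [set s | (s < rho)%O]] =
              [set g' s | s in [set s | (s < rho)%O]] by [].
    by apply: eq_imagel => s /= lt; exact: IH lt _ (hg _ lt).
Qed.

Lemma ord_sum_lt_ex iota rho xi : ord_sum iota rho xi ->
  forall sigma, (sigma < rho)%O ->
  exists2 tau, (tau < xi)%O & ord_sum iota sigma tau.
Proof.
elim=> {rho xi} [rho z|rho rho' xi xi' sr sx h IH|rho xi g lr _ IH [ub _]] s lt.
- by move: (z s); rewrite leNgt lt.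
- have := succ_le sr lt; rewrite le_eqVlt => /predU1P[->|/IH [t tx ht]].
    by exists xi => //; exact: sx.1.
  by exists t => //; exact: lt_trans tx sx.1.
- have [s' [ss s'r]] := limit_lt lr lt.
  have [t ts ht] := IH _ s'r _ ss.1; exists t => //.
  by apply: lt_le_trans ts (ub _ _); exists s'.
Qed.

Lemma ord_sum_lt iota sigma rho tau xi : (sigma < rho)%O ->
  ord_sum iota sigma tau -> ord_sum iota rho xi -> (tau < xi)%O.
Proof.
move=> lt hs /ord_sum_lt_ex/(_ _ lt) [t tx ht].
by rewrite (ord_sum_fun hs ht).
Qed.

Lemma ord_sum_onto iota rho xi : ord_sum iota rho xi ->
  forall tau, (iota <= tau)%O -> (tau < xi)%O ->
  exists2 sigma, (sigma < rho)%O & ord_sum iota sigma tau.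
Proof.
elim=> {rho xi} [rho z|rho rho' xi xi' sr sx h IH|rho xi g lr _ IH [_ lb]] t it tx.
- by move: (lt_le_trans tx it); rewrite ltxx.
- have := succ_le sx tx; rewrite le_eqVlt => /predU1P[->|/(IH _ it) [s lt hs]].
    by exists rho => //; exact: sr.1.
  by exists s => //; exact: lt_trans lt sr.1.
- have [[s sr ts]|ns] := pselect (exists2 s, (s < rho)%O & (t < g s)%O).
    by have [s' ls hs'] := IH _ sr _ it ts; exists s' => //; exact: lt_trans ls sr.
  suff : (xi <= t)%O by rewrite leNgt tx.
  apply: lb => _ [s sr <-]; rewrite leNgt; apply/negP => h.
  by apply: ns; exists s.
Qed.

Lemma ord_sum_limit_succ iota rho tau tau' xi :
  is_limit rho -> is_succ tau tau' -> (tau < xi)%O -> (iota <= tau)%O ->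
  ord_sum iota rho xi -> (tau' < xi)%O.
Proof.
move=> lr st tx it h.
have [s sr hs] := ord_sum_onto h it tx.
have [s' [ss s'r]] := limit_lt lr sr.
exact: ord_sum_lt s'r (ord_sum_succ ss st hs) h.
Qed.

(** In the limit case, rho is the least ordinal above all differences tau - iota with iota <= tau <
    xi. Minimality makes every sigma < rho such a difference, so that the sums iota + sigma have
    supremum xi. *)
Lemma ord_sum_exists iota xi :
  (iota <= xi)%O -> exists rho, ord_sum iota rho xi.
Proof.
elim/ord_ind: xi => xi IH; rewrite le_eqVlt => /predU1P[<-|ix].
  by have [z zz _] := zero_exists iota; exists z; apply: ord_sum_zero.
have [z|[x sx]|lx] := ord_kind xi.
- by move: (z iota); rewrite leNgt ix.
- have [r hr] := IH _ sx.1 (succ_le sx ix).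
  have [r' sr _] := succ_exists (le_lt_trans (ord_sum_ger hr) sx.1).
  by exists r'; exact: ord_sum_succ sr sx hr.
pose P := [set rho | forall tau r, (iota <= tau)%O -> (tau < xi)%O ->
  ord_sum iota r tau -> (r < rho)%O].
have [|rho Prho rhomin] := @ord_min P.
  exists xi => tau r it tx h; exact: le_lt_trans (ord_sum_ger h) tx.
have sumlt s : (s < rho)%O ->
    exists tau, [/\ (iota <= tau)%O, (tau < xi)%O & ord_sum iota s tau].
  move=> sr; apply: contrapT => nex.
  have : (rho <= s)%O; last by rewrite leNgt sr.
  apply: rhomin => t r it tx h; rewrite ltNge; apply/negP; rewrite le_eqVlt.
  move=> /predU1P[e|lt]; first by apply: nex; exists t; split => //; rewrite e.
  have [t' lt' h'] := ord_sum_lt_ex h lt.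
  by apply: nex; exists t'; split=> //; [exact: ord_sum_ge h'|exact: lt_trans lt' tx].
have lrho : is_limit rho.
  split=> [z|s sr].
    have [r h] := IH _ ix (lexx _).
    by move: (z r); rewrite leNgt (Prho _ _ _ _ h).
  have [t [it tx h]] := sumlt _ sr.1.
  have [t' [st t'x]] := limit_lt lx tx.
  have := Prho _ _ (le_trans it (ltW st.1)) t'x (ord_sum_succ sr st h).
  by rewrite ltxx.
have /choice[g hg] : forall s, exists t, (s < rho)%O ->
    [/\ (iota <= t)%O, (t < xi)%O & ord_sum iota s t].
  move=> s; have [/sumlt [t ht]|ns] := pselect (s < rho)%O; first by exists t.
  by exists s.
exists rho; apply: (@ord_sum_limit _ _ _ _ _ g) => //.
  by move=> s /hg [].
split=> [_ [s /hg [_ /ltW tx _] <-]//|w ubw].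
rewrite leNgt; apply/negP => wx.
have iw : (iota <= w)%O.
  have [z zz _] := zero_exists rho.
  have zr : (z < rho)%O by apply: zero_min => //; case: lrho.
  have [ig _ _] := hg _ zr.
  by apply: le_trans ig (ubw _ _); exists z.
have [w' [sw w'x]] := limit_lt lx wx.
have iw' := le_trans iw (ltW sw.1).
have [r h] := IH _ w'x iw'.
have rr := Prho _ _ iw' w'x h.
have [_ _ h'] := hg _ rr.
have : (g r <= w)%O by apply: ubw; exists r.
by rewrite (ord_sum_fun h' h) leNgt sw.1.
Qed.

Lemma ord_sum_succr iota rho rho' xi' : is_succ rho rho' ->
  ord_sum iota rho' xi' -> exists2 xi, is_succ xi xi' & ord_sum iota rho xi.
Proof.
move=> sr /ord_sum_inv[[/(zeroNsucc sr)]//|[r [x [sr' sx' h]]]|[[_ /(_ _ sr)]]//].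
by exists x => //; rewrite (succ_inj sr sr').
Qed.

Lemma ord_sum_zeror iota rho xi :
  is_zero rho -> ord_sum iota rho xi -> xi = iota.
Proof.
move=> z /ord_sum_inv[[]//|[r [x [sr' _ _]]]|[[]]//].
by case: (zeroNsucc sr').
Qed.

Lemma ord_sum_limitr iota rho xi :
  is_limit rho -> ord_sum iota rho xi -> is_limit xi.
Proof.
move=> lr h; split=> [z|x sx].
  have [s [_ lts]] : exists s, is_zero s /\ (s < rho)%O.
    have [s zs _] := zero_exists rho; exists s; split => //.
    by apply: zero_min => //; case: lr.
  have [t ltt _] := ord_sum_lt_ex h lts.
  by move: (z t); rewrite leNgt ltt.
have ix : (iota <= x)%O.
  apply: (succ_le sx); rewrite lt_neqAle (ord_sum_ge h) andbT.
  apply/eqP => e; have [z zz _] := zero_exists rho.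
  have zr : (z < rho)%O by apply: zero_min => //; case: lr.
  have := ord_sum_lt zr (ord_sum_zero iota zz) h.
  by rewrite e ltxx.
by have := ord_sum_limit_succ lr sx sx.1 ix h; rewrite ltxx.
Qed.

End ordinal_arithmetic.

Section chains.
Local Open Scope nat_scope.
Implicit Types (E F H : {fset nat}) (P Q : {fset nat} -> Prop) (x y s : nat).

(** * Schreier families *)

Definition img (f : nat -> nat) (E : {fset nat}) : {fset nat} :=
  [fset f x | x in E]%fset.

Lemma imgP f E y : reflect (exists2 x, x \in E & y = f x) (y \in img f E).
Proof. exact: imfsetP. Qed.

Lemma mem_img f (E : {fset nat}) x : x \in E -> f x \in img f E.
Proof. by move=> xE; apply/imgP; exists x. Qed.

Definition mono_on (c : nat -> nat) (E : {fset nat}) : Prop :=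
  {in E &, {homo c : x y / (x <= y)%N}}.

Definition smono_on (c : nat -> nat) (E : {fset nat}) : Prop :=
  {in E &, {homo c : x y / (x < y)%N}}.

Lemma smonoW c E : smono_on c E -> mono_on c E.
Proof.
move=> h x y xE yE; rewrite leq_eqVlt => /predU1P[->//|lt].
exact: ltnW (h _ _ xE yE lt).
Qed.

Lemma smono_inj c E : smono_on c E -> {in E &, injective c}.
Proof.
move=> h x y xE yE e.
by have [/(h _ _ xE yE)|/(h _ _ yE xE)|//] := ltngtP x y; rewrite e ltnn.
Qed.

Lemma img_inv f E : exists g, {in img f E, forall y, g y \in E /\ f (g y) = y}.
Proof.
have /choice[g hg] : forall y, exists x, y \in img f E -> x \in E /\ f x = y.
  move=> y; have [/imgP[x xE ->]|ny] := boolP (y \in img f E); first by exists x.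
  by exists 0%N.
by exists g => y /hg.
Qed.

Definition fiber (c : nat -> nat) (E : {fset nat}) (s : nat) : {fset nat} :=
  [fset x in E | c x == s]%fset.

Lemma in_fiber c E s x : (x \in fiber c E s) = (x \in E) && (c x == s).
Proof. by rewrite !inE. Qed.

(* E is a union of at most k successive members of P; the colouring c tells to
   which of them a point of E belongs, and some colours may be unused. *)
Definition chain (P : {fset nat} -> Prop) (k : nat) (E : {fset nat}) : Prop :=
  exists c : nat -> nat, [/\ mono_on c E, forall x, x \in E -> (c x < k)%N &
    forall s, P (fiber c E s)].

Definition hereditary (P : {fset nat} -> Prop) : Prop :=
  forall E F : {fset nat}, (F `<=` E)%fset -> P E -> P F.

Lemma chain_mon (P Q : {fset nat} -> Prop) k l E :
  (forall F, P F -> Q F) -> (k <= l)%N -> chain P k E -> chain Q l E.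
Proof.
move=> PQ kl [c [cm ck cP]]; exists c; split=> // [x xE|s]; last exact: PQ.
exact: leq_trans (ck _ xE) kl.
Qed.

(** The pairs of colours are ordered lexicographically, with [c x * b + c' (c x) x] as code;
    [chain_group] decodes by quotient and remainder. *)
Lemma chain_comp P a b E c : mono_on c E ->
  (forall x, x \in E -> (c x < a)%N) ->
  (forall s, chain P b (fiber c E s)) -> chain P (a * b) E.
Proof.
move=> cm ca /choice[c' hc'].
exists (fun x => c x * b + c' (c x) x)%N; split.
- move=> x y xE yE xy; have := cm _ _ xE yE xy; rewrite leq_eqVlt.
  move=> /predU1P[e|lt].
    rewrite e leq_add2l; have [h _ _] := hc' (c y).
    by apply: h; rewrite // in_fiber ?xE ?yE ?e eqxx.
  have [_ h _] := hc' (c x).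
  have : (c' (c x) x < b)%N by apply: h; rewrite in_fiber xE eqxx.
  nia.
- move=> x xE; have [_ h _] := hc' (c x).
  have : (c' (c x) x < b)%N by apply: h; rewrite in_fiber xE eqxx.
  have := ca _ xE; nia.
- move=> s; have [_ _ /(_ (s %% b)%N)] := hc' (s %/ b)%N.
  congr P; apply/fsetP => x; rewrite !in_fiber.
  have [xE|] //= := boolP (x \in E).
  have [_ h _] := hc' (c x).
  have lt : (c' (c x) x < b)%N by apply: h; rewrite in_fiber xE eqxx.
  apply/idP/idP => [/andP[/eqP -> /eqP ->]|/eqP <-].
    by rewrite -divn_eq.
  have b0 : (0 < b)%N by exact: leq_ltn_trans lt.
  by rewrite divnMDl // divn_small // addn0 eqxx modnMDl modn_small //=.
Qed.

Lemma chain_group P a b E : chain P (a * b) E ->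
  exists c : nat -> nat, [/\ mono_on c E,
   forall x, x \in E -> (c x < a)%N & forall s, chain P b (fiber c E s)].
Proof.
move=> [c [cm cab cP]]; exists (fun x => c x %/ b)%N; split.
- by move=> x y xE yE xy; apply: leq_div2r; exact: cm.
- move=> x xE; have := cab _ xE => lt.
  by rewrite ltn_divLR //; case: (b) lt; rewrite ?muln0.
- move=> s; exists (fun x => c x %% b)%N; split.
  + move=> x y; rewrite !in_fiber => /andP[xE /eqP ex] /andP[yE /eqP ey] xy.
    have := cm _ _ xE yE xy; rewrite {1}(divn_eq (c x) b) {1}(divn_eq (c y) b) ex ey.
    by rewrite leq_add2l.
  + move=> x; rewrite in_fiber => /andP[xE _].
    have := cab _ xE => lt.
    by rewrite ltn_mod; case: (b) lt; rewrite ?muln0.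
  + move=> t; have [tb|bt] := ltnP t b.
      have := cP (s * b + t)%N; congr P; apply/fsetP => x; rewrite !in_fiber -andbA.
      have [xE|] //= := boolP (x \in E).
      apply/idP/idP => [/eqP ->|/andP[/eqP <- /eqP <-]].
        have b0 : (0 < b)%N by exact: leq_ltn_trans tb.
        by rewrite divnMDl // divn_small // addn0 eqxx modnMDl modn_small /=.
      by rewrite -divn_eq.
    have := cP (a * b)%N; congr P; apply/fsetP => x; rewrite !in_fiber -andbA.
    have [xE|] //= := boolP (x \in E).
    have lt := cab _ xE; rewrite (ltn_eqF lt); symmetry; apply/negbTE.
    apply/negP => /andP[_ /eqP e].
    have : (c x %% b < b)%N by rewrite ltn_mod; case: (b) lt; rewrite ?muln0.
    by rewrite e ltnNge bt.
Qed.

Lemma chain_hereditary P k : hereditary P -> hereditary (chain P k).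
Proof.
move=> hP E F /fsubsetP FE [c [cm ck cP]]; exists c; split.
- by move=> x y /FE xE /FE yE; exact: cm.
- by move=> x /FE; exact: ck.
- move=> s; apply: hP (cP s); apply/fsubsetP => x; rewrite !in_fiber.
  by move=> /andP[/FE -> ->].
Qed.

Lemma chain0 P k : P fset0 -> chain P k fset0.
Proof.
move=> P0; exists (fun=> 0%N); split=> // s.
by have -> : fiber (fun=> 0%N) fset0 s = fset0 by apply/fsetP => x; rewrite in_fiber.
Qed.

Lemma chain1 P E : P fset0 -> P E -> chain P 1 E.
Proof.
move=> P0 PE; exists (fun=> 0%N); split=> // s.
have [->|s0] := eqVneq s 0%N.
  suff -> : fiber (fun=> 0%N) E 0 = E by [].
  by apply/fsetP => x; rewrite in_fiber eqxx andbT.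
suff -> : fiber (fun=> 0%N) E s = fset0 by [].
by apply/fsetP => x; rewrite in_fiber eq_sym (negbTE s0) andbF.
Qed.

Lemma chain_cat P k l t E : P fset0 ->
  chain P k [fset x in E | (x < t)%N]%fset ->
  chain P l [fset x in E | (t <= x)%N]%fset -> chain P (k + l) E.
Proof.
move=> P0 [c [cm ck cP]] [c' [cm' ck' cP']].
exists (fun x => if (x < t)%N then c x else k + c' x)%N; split.
- move=> x y xE yE xy; case: (ltnP x t) => xt; case: (ltnP y t) => yt.
  + by apply: cm; rewrite ?inE ?xE ?yE.
  + have : (c x < k)%N by apply: ck; rewrite !inE xE.
    by move=> /ltnW h; apply: leq_trans h (leq_addr _ _).
  + by move: (leq_ltn_trans xy yt); rewrite ltnNge xt.
  + by rewrite leq_add2l; apply: cm'; rewrite ?inE ?xE ?yE.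
- move=> x xE; case: (ltnP x t) => xt.
    by apply: ltn_addr; apply: ck; rewrite !inE xE.
  by rewrite ltn_add2l; apply: ck'; rewrite !inE xE.
- move=> s; have [sk|ks] := ltnP s k.
    have := cP s; congr P; apply/fsetP => x; rewrite !inE.
    by have [xE|]//= := boolP (x \in E); case: (ltnP x t) => //= xt; symmetry; apply/eqP; lia.
  have := cP' (s - k)%N; congr P; apply/fsetP => x; rewrite !inE.
  have [xE|]//= := boolP (x \in E); case: (ltnP x t) => //= xt.
    have : (c x < k)%N by apply: ck; rewrite !inE xE.
    by move=> ?; symmetry; apply/eqP; lia.
  by apply/eqP/eqP; lia.
Qed.

End chains.

Section schreier_families.
Local Open Scope nat_scope.
Variables (d : Order.disp_t) (Omega : orderType d).
Hypothesis wf : well_founded (fun eta xi : Omega => (eta < xi)%O).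
Variable fs : Omega -> nat -> Omega.
Hypothesis hfs : schreier_sequences fs.
Implicit Types xi zeta eta iota rho sigma tau : Omega.
Implicit Types (E F H : {fset nat}) (P Q : {fset nat} -> Prop) (x y s n k : nat).

Local Notation S := (schreier fs).

(** The union in [schreier_succ] becomes a colouring, which is easier to restrict and to pull back
    than a sequence of sets. The bound k <= min E_0 passes to the whole union, since the later
    pieces lie to the right of the nonempty E_0. *)
Lemma schreier_inv xi E : S xi E ->
  [\/ E = fset0, is_zero xi /\ exists n, E = [fset n]%fset,
   (exists eta k, [/\ is_succ eta xi, chain (S eta) k E & fset_geq k E]) |
   is_limit xi /\ exists n zeta,
     [/\ is_succ (fs xi n) zeta, fset_geq n.+1 E & S zeta E]].
Proof.
case=> {xi E} [xi|xi n z|xi zeta k E sx k0 hE hlt hk|xi n zeta E lx E0 hn sz h].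
- by constructor 1.
- by constructor 2; split=> //; exists n.
- constructor 3; exists xi, k.
  set U := (\big[_/_]_(i < k) E i)%fset.
  have UP x : reflect (exists2 i, i < k & x \in E i) (x \in U).
    apply: (iffP (bigfcupP _ _ _ _)) => [[i _ xi']|[i ik xi']].
      by exists i.
    by exists (Ordinal ik); rewrite // mem_index_enum.
  have ltE i j x y : i < k -> j < k -> x \in E i -> y \in E j -> i < j -> x < y.
    by move=> ik jk xE yE ij; apply: (hlt i j _ x y xE yE); rewrite ij jk.
  have /choice[c hc] : forall x, exists i, x \in U -> i < k /\ x \in E i.
    move=> x; have [/UP[i ik xi']|nx] := boolP (x \in U); first by exists i.
    by exists 0.
  have cE x i : i < k -> x \in E i -> c x = i.
    move=> ik xE; have [|ck xc] := hc x; first by apply/UP; exists i.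
    have [lt|lt|//] := ltngtP (c x) i.
      by have := ltE _ _ _ _ ck ik xc xE lt; rewrite ltnn.
    by have := ltE _ _ _ _ ik ck xE xc lt; rewrite ltnn.
  split=> //.
    exists c; split.
    + move=> x y /hc[ckx xc] /hc[cky yc] xy.
      rewrite leqNgt; apply/negP => lt.
      by have := ltE _ _ _ _ cky ckx yc xc lt; rewrite ltnNge xy.
    + by move=> x /hc[].
    + move=> s; have [sk|ks] := ltnP s k.
        have [_] := hE s sk; congr (schreier _ _ _); apply/fsetP => x.
        rewrite in_fiber; apply/idP/andP => [xs|[xU /eqP <-]].
          by split; [apply/UP; exists s|rewrite (cE x s)].
        by have [] := hc x xU.
      suff -> : fiber c U s = fset0 by exact: schreier_empty.
      apply/fsetP => x; rewrite in_fiber inE; apply/negbTE/negP.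
      by move=> /andP[/hc[ck _] /eqP e]; move: ck; rewrite e ltnNge ks.
  move=> x /UP[i ik xi'].
  have [E00 _] := hE 0 k0; have /fset0Pn[y yE] := E00.
  have := hk y yE; case: i ik xi' => [|i] ik xi' ky; first exact: hk.
  have := ltE _ _ _ _ k0 ik yE xi' (ltn0Sn i); lia.
- by constructor 4; split=> //; exists n, zeta.
Qed.

Lemma schreier0 xi : S xi fset0. Proof. exact: schreier_empty. Qed.
Hint Resolve schreier0 : core.

Lemma schreier_succI eta xi k E :
  is_succ eta xi -> chain (S eta) k E -> fset_geq k E -> S xi E.
Proof.
move=> sx [c [cm ck cS]] kE.
have [->//|E0] := eqVneq E fset0.
pose vals := [seq v <- iota 0 k | fiber c E v != fset0].
pose G i := fiber c E (nth 0 vals i).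
have nthP i : i < size vals -> G i != fset0 /\ nth 0 vals i < k.
  move=> iv; have := mem_nth 0 iv; rewrite mem_filter mem_iota.
  by rewrite add0n => /andP[-> /andP[_ ->]].
have vE x : x \in E -> c x \in vals.
  move=> xE; rewrite mem_filter mem_iota /= add0n ck // andbT.
  by apply/fset0Pn; exists x; rewrite in_fiber xE eqxx.
have -> : E = (\big[fsetU/fset0]_(i < size vals) G i)%fset.
  apply/fsetP => x; apply/idP/bigfcupP => [xE|[i _]]; last first.
    by rewrite in_fiber => /andP[].
  have lt : index (c x) vals < size vals by rewrite index_mem vE.
  exists (Ordinal lt); first by rewrite mem_index_enum.
  by rewrite in_fiber xE /= nth_index ?eqxx // vE.
apply: (schreier_succ sx).
- by have /fset0Pn[x /vE] := E0; case: (vals).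
- by move=> i /nthP[Gi _]; split=> //; exact: cS.
- move=> i j /andP[ij jv] x y.
  rewrite !in_fiber => /andP[xE /eqP ex] /andP[yE /eqP ey].
  have srt : sorted ltn vals.
    by apply: sorted_filter; [exact: ltn_trans|exact: iota_ltn_sorted].
  have : nth 0 vals i < nth 0 vals j.
    have := sorted_ltn_nth ltn_trans 0 srt; apply=> //.
    by rewrite inE (ltn_trans ij jv).
  rewrite -ex -ey; apply: contraTT; rewrite -!leqNgt => yx.
  exact: cm.
- move=> x; rewrite in_fiber => /andP[xE _].
  apply: leq_trans (kE _ xE); rewrite /vals size_filter.
  by apply: leq_trans (count_size _ _) _; rewrite size_iota.
Qed.

Lemma schreier_succE eta xi E : is_succ eta xi -> S xi E ->
  exists k, chain (S eta) k E /\ fset_geq k E.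
Proof.
move=> sx /schreier_inv[->|[z _]|[eta' [k [sx' h1 h2]]]|[[_ /(_ _ sx)]]//].
- by exists 0; split=> //; exact: chain0.
- by case: (zeroNsucc sx).
- by exists k; rewrite (succ_inj sx sx').
Qed.

Lemma schreier_zeroE xi E : is_zero xi -> S xi E ->
  E = fset0 \/ exists n, E = [fset n]%fset.
Proof.
move=> z /schreier_inv[->|[_ ?]|[eta' [k [sx' _ _]]]|[[/(_ z)]]//].
- by left.
- by right.
- by case: (zeroNsucc sx').
Qed.

Lemma schreier_limitE xi E : is_limit xi -> S xi E ->
  E = fset0 \/ exists n zeta,
     [/\ is_succ (fs xi n) zeta, fset_geq n.+1 E & S zeta E].
Proof.
move=> lx /schreier_inv[->|[z _]|[eta' [k [sx' _ _]]]|[_ ?]].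
- by left.
- by case: lx.
- by case: lx => _ /(_ _ sx').
- by right.
Qed.

Lemma schreier_limitI xi n zeta E : is_limit xi ->
  is_succ (fs xi n) zeta -> fset_geq n.+1 E -> S zeta E -> S xi E.
Proof.
move=> lx sz nE h; have [->//|E0] := eqVneq E fset0.
exact: (schreier_limit lx E0 nE sz h).
Qed.

Lemma fs_lt xi n : is_limit xi -> (fs xi n < xi)%O.
Proof.
move=> lx; have [inc [ub _] _] := hfs lx.
by apply: lt_le_trans (inc n n.+1 (ltnSn n)) (ub _ _); exists n.+1.
Qed.

Lemma fs_succ xi n : is_limit xi ->
  exists zeta, is_succ (fs xi n) zeta /\ (zeta < xi)%O.
Proof. by move=> lx; have := limit_lt wf lx (fs_lt n lx). Qed.

Lemma fs_cofinal xi tau : is_limit xi -> (tau < xi)%O ->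
  exists n, (tau <= fs xi n)%O.
Proof.
move=> lx tx; apply: contrapT => nex.
have [_ [_ lb] _] := hfs lx.
have : (xi <= tau)%O; last by rewrite leNgt tx.
apply: lb => _ [n _ <-]; rewrite leNgt; apply/negP => lt.
by apply: nex; exists n; exact: ltW.
Qed.

(* F is a spread, in the usual sense, of the subset f(F) of E. *)
Definition spread E F : Prop := exists f : nat -> nat,
  smono_on f F /\ {in F, forall x, f x \in E /\ f x <= x}.

(** Colourings pull back along f, and the lower bounds on min E survive because f x <= x. *)
Lemma schreier_spread xi E F : spread E F -> S xi E -> S xi F.
Proof.
elim/(ord_ind wf): xi E F => xi IH E F [f [fm fE]].
have geqF k : fset_geq k E -> fset_geq k F.
  by move=> kE x /fE[/kE h1 h2]; apply: leq_trans h1 _.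
have [z|[eta sx]|lx] := ord_kind xi.
- have Fsub n : (E `<=` [fset n])%fset -> S xi F.
    move=> /fsubsetP En; have [->//|/fset0Pn[x xF]] := eqVneq F fset0.
    suff -> : F = [fset x]%fset by exact: schreier_zero.
    apply/fsetP => y; rewrite inE; apply/idP/eqP => [yF|->//].
    apply: (smono_inj fm) => //; apply/eqP.
    have [/En + _] := fE _ xF; have [/En + _] := fE _ yF.
    by rewrite !inE => /eqP -> /eqP ->.
  by move=> /(schreier_zeroE z)[E0|[n E0]]; [apply: (Fsub 0)|apply: (Fsub n)];
    rewrite E0 ?fsub0set ?fsubset_refl.
- move=> /(schreier_succE sx)[k [[c [cm ck cS]] kE]].
  apply: (schreier_succI sx _ (geqF _ kE)); exists (c \o f); split.
  + move=> x y xF yF xy; apply: cm; [by have [] := fE _ xF|by have [] := fE _ yF|].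
    exact: smonoW fm _ _ xF yF xy.
  + by move=> x /fE[/ck].
  + move=> s; apply: (IH _ sx.1 _ _ _ (cS s)); exists f; split.
      by move=> x y; rewrite !in_fiber => /andP[xF _] /andP[yF _]; exact: fm.
    by move=> x; rewrite !in_fiber => /andP[/fE[-> ->] ->].
- move=> /(schreier_limitE lx)[E0|[n [zeta [sz nE h]]]].
    suff -> : F = fset0 by [].
    by apply/fsetP => x; rewrite inE; apply/negbTE/negP => /fE[]; rewrite E0.
  apply: (schreier_limitI lx sz (geqF _ nE)); apply: IH h; last by exists f.
  exact: limit_succ lx (fs_lt n lx) sz.
Qed.

Lemma schreier_sub xi : hereditary (S xi).
Proof.
move=> E F /fsubsetP FE; apply: schreier_spread; exists id; split=> //.
by move=> x /FE ->.
Qed.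

Lemma schreier_single xi n : S xi [fset n]%fset.
Proof.
elim/(ord_ind wf): xi n => xi IH n.
have [z|[eta sx]|lx] := ord_kind xi.
- exact: schreier_zero.
- apply: (@schreier_succI _ _ 1 _ sx); last by move=> i; rewrite inE => /eqP ->.
  by apply: chain1 => //; apply: IH sx.1 _.
- have [zeta [sz zx]] := fs_succ 0 lx.
  by apply: (schreier_limitI lx sz) => //; exact: IH.
Qed.

Lemma schreier_succ_sub eta xi E : is_succ eta xi -> S eta E -> S xi E.
Proof.
by move=> sx h; apply: (@schreier_succI _ _ 1 _ sx) => //; exact: chain1.
Qed.

(** At a limit tau, sigma is below some term of the sequence of tau, and entering S_tau through this
    term requires a lower bound on min E. Hence the threshold N. *)
Lemma schreier_le sigma tau : (sigma <= tau)%O ->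
  exists N, forall E, fset_geq N E -> S sigma E -> S tau E.
Proof.
elim/(ord_ind wf): tau => tau IH; rewrite le_eqVlt => /predU1P[->|st].
  by exists 0.
have [z|[eta sx]|lx] := ord_kind tau.
- by move: (z sigma); rewrite leNgt st.
- have [N hN] := IH _ sx.1 (succ_le sx st).
  by exists N => E NE h; apply: (schreier_succ_sub sx); exact: hN.
- have [n sn] := fs_cofinal lx st.
  have [N hN] := IH _ (fs_lt n lx) sn.
  have [zeta [sz _]] := fs_succ n lx.
  exists (maxn N n.+1) => E NE h.
  apply: (schreier_limitI lx sz).
    by move=> i /NE; apply: leq_trans; exact: leq_maxr.
  apply: (schreier_succ_sub sz); apply: hN => //.
  by move=> i /NE; apply: leq_trans; exact: leq_maxl.
Qed.

Lemma fs_chain xi n m zeta zeta' E : is_limit xi -> n <= m ->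
  is_succ (fs xi n) zeta -> is_succ (fs xi m) zeta' -> S zeta E -> S zeta' E.
Proof.
move=> lx nm; elim: m nm zeta' => [|m IH].
  by rewrite leqn0 => /eqP -> zeta' s1 s2; rewrite (succ_fun s1 s2).
rewrite leq_eqVlt => /predU1P[->|nm] zeta' s1 s2.
  by rewrite (succ_fun s1 s2).
have [z [sz _]] := fs_succ m lx.
move=> /(IH nm z s1 sz) h; apply: (schreier_succ_sub s2).
by have [_ _ h'] := hfs lx; exact: h' sz _ h.
Qed.

Lemma fs_chainS xi n zeta E : is_limit xi ->
  is_succ (fs xi n) zeta -> S zeta E -> S (fs xi n.+1) E.
Proof. by move=> lx sz; have [_ _ h'] := hfs lx; exact: h' sz E. Qed.

(** Each group of b consecutive pieces is a single set of S_(eta+1), because b <= min E. *)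
Lemma chain_succ eta xi a b E : is_succ eta xi -> fset_geq b E ->
  chain (S eta) (a * b) E -> chain (S xi) a E.
Proof.
move=> sx bE /chain_group[c [cm ca cP]]; exists c; split=> // s.
apply: schreier_succI sx (cP s) _ => x; rewrite in_fiber => /andP[xE _].
exact: bE.
Qed.

Lemma fset_geq_sub k E F : (F `<=` E)%fset -> fset_geq k E -> fset_geq k F.
Proof. by move=> /fsubsetP FE h x /FE /h. Qed.

(* Hence a vector with a small S_eta-norm has little mass on the sets of S_iota
   that start before s. *)
Lemma schreier_tail iota s : is_zero iota \/ exists eta K, (eta < iota)%O /\
  forall F v, S iota F -> v \in F -> v < s -> chain (S eta) K F.
Proof.
have [z|[eta sx]|lx] := ord_kind iota; [by left| |]; right.
- exists eta, s; split=> [|F v /(schreier_succE sx)[k [h kF]] vF vs]; first exact: sx.1.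
  apply: chain_mon h => //; have := kF _ vF; lia.
- have [z [sz zx]] := fs_succ s lx; exists z, 1; split=> // F v.
  move=> /(schreier_limitE lx)[->|[n [z' [sz' nF h]]]] // vF vs.
  apply: chain1 => //; apply: (fs_chain lx _ sz' sz h).
  have := nF _ vF; lia.
Qed.

End schreier_families.

(** * Unions along Schreier families *)

Section diagonal_sums.
Local Open Scope nat_scope.

(** A limit ordinal produces one threshold for every n, but the n-th one matters only for sets
    beyond n; there the diagonal sum dominates it. *)
Lemma diag_sum_ge (f : nat -> nat -> nat) n i :
  n <= i -> f n i <= \sum_(j < i.+1) f j i.
Proof.
move=> ni; have lt : n < i.+1 by [].
by rewrite (bigD1 (Ordinal lt)) //= leq_addr.
Qed.

Lemma diag_sum_mono (f : nat -> nat -> nat) :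
  (forall n, {homo f n : x y / x <= y}) ->
  {homo (fun i => i + \sum_(j < i.+1) f j i) : x y / x < y}.
Proof.
move=> fm x y xy; rewrite -addSn leq_add //.
rewrite -(big_mkord xpredT (f^~ x)) -(big_mkord xpredT (f^~ y)) /=.
rewrite (@big_cat_nat _ _ _ x.+1 0 y.+1) //=; last exact: ltnW.
apply: leq_trans (leq_addr _ _); apply: leq_sum => j _.
exact: fm (ltnW xy).
Qed.

End diagonal_sums.

Section images.
Local Open Scope nat_scope.
Implicit Types (E F H : {fset nat}) (P Q : {fset nat} -> Prop) (x y s n k h : nat).

Lemma img_fiber (c g : nat -> nat) H s :
  img g (fiber (c \o g) H s) = fiber c (img g H) s.
Proof.
apply/fsetP => v; rewrite in_fiber; apply/imgP/andP.
  move=> [w /[!in_fiber]/andP[wH /eqP e] ->].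
  by rewrite mem_img // -e /=.
move=> [/imgP[w wH ->] e]; exists w => //.
by rewrite in_fiber wH.
Qed.

Lemma fiber_fiber (c g : nat -> nat) H s r :
  fiber g (fiber (c \o g) H s) r = if c r == s then fiber g H r else fset0.
Proof.
apply/fsetP => v; case: ifPn => [/eqP e|ne].
  rewrite !in_fiber -andbA /=; case: (v \in H) => //=.
  by case: (eqVneq (g v) r) => [->|]; rewrite ?andbF // e eqxx.
rewrite in_fset0 !in_fiber -andbA /=; case: (v \in H) => //=.
by case: (eqVneq (g v) r) => [->|]; rewrite ?andbF // (negbTE ne).
Qed.

Lemma chain_img (c f : nat -> nat) P k E : mono_on f E -> mono_on c E ->
  {in E &, forall x y, f x = f y -> c x = c y} ->
  (forall x, x \in E -> c x < k) ->
  (forall s, P (img f (fiber c E s))) -> chain P k (img f E).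
Proof.
move=> fm cm fc ck cP; have [g hg] := img_inv f E.
exists (c \o g); split.
- move=> x y xE yE xy /=; have [gx ex] := hg _ xE; have [gy ey] := hg _ yE.
  have [/cm|lt] := leqP (g x) (g y); first exact.
  rewrite (fc _ _ gx gy) //; apply/eqP; rewrite eqn_leq ex ey xy /=.
  by rewrite -ex -ey; apply: fm => //; exact: ltnW.
- by move=> x xE /=; apply: ck; have [] := hg _ xE.
- move=> s; suff -> : fiber (c \o g) (img f E) s = img f (fiber c E s) by [].
  apply/fsetP => y; rewrite in_fiber /=; apply/andP/imgP => [[yE e]|[x]].
    by have [gy ey] := hg _ yE; exists (g y); rewrite // in_fiber gy.
  rewrite in_fiber => /andP[xE e] ->; split; first exact: mem_img.
  have [gy ey] := hg _ (mem_img f xE).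
  by rewrite (fc _ _ gy xE).
Qed.

End images.

Lemma ltnW_homo (u : nat -> nat) :
  {homo u : x y / (x < y)%N} -> {homo u : x y / (x <= y)%N}.
Proof. by move=> um x y; rewrite leq_eqVlt => /predU1P[->//|/um/ltnW]. Qed.

Section composition.
Local Open Scope nat_scope.
Variables (d : Order.disp_t) (Omega : orderType d).
Hypothesis wf : well_founded (fun eta xi : Omega => (eta < xi)%O).
Variable fs : Omega -> nat -> Omega.
Hypothesis hfs : schreier_sequences fs.
Implicit Types xi zeta eta iota rho sigma tau : Omega.
Implicit Types (E F H : {fset nat}) (P Q : {fset nat} -> Prop) (x y s n k h : nat).

Local Notation S := (schreier fs).

(* Unions along S_zeta of sets of P that start far enough are in S_xi: the union
   is H, its pieces are the fibers of g, and g h is the element of the set of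
   S_zeta that labels the piece of h. *)
Definition union_closed P zeta xi : Prop := exists l : nat -> nat, forall g H,
  mono_on g H -> S zeta (img g H) -> (forall r, P (fiber g H r)) ->
  (forall h, h \in H -> l (g h) <= h) -> S xi H.

(** P and the starting ordinal z0 are arbitrary since the induction is needed twice: with P = S_iota
    from z0 = 0, and with P the unions of R sets of S_eta from z0 = 1. *)
Lemma union_closed_sum P iota z0 : P fset0 ->
  (forall x y : Omega, is_succ x y -> (z0 <= y)%O) ->
  (forall xi, ord_sum iota z0 xi -> union_closed P z0 xi) ->
  forall zeta xi, (z0 <= zeta)%O -> ord_sum iota zeta xi -> union_closed P zeta xi.
Proof.
move=> P0 hz0 base zeta; elim/(ord_ind wf): zeta => zeta IH xi.
rewrite le_eqVlt => /predU1P[<-|z0z]; first exact: base.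
have [z|[eta sz]|lz] := ord_kind zeta.
- by move: (z z0); rewrite leNgt z0z.
- move=> /(ord_sum_succr sz)[x sx hx].
  have [l hl] := IH _ sz.1 _ (succ_le sz z0z) hx.
  (* The summand r yields k <= min H: each label is bounded below by k, and is itself at most the
     points of its piece. *)
  exists (fun r => r + l r) => g H gm /(schreier_succE sz)[k [[c [cm ck cS]] kH]] hP hl'.
  apply: (schreier_succI (k := k) sx); last first.
    move=> h hH; have := hl' _ hH; have := kH _ (mem_img g hH); lia.
  exists (c \o g); split.
  + by move=> a b aH bH ab; apply: cm; rewrite ?mem_img //; exact: gm.
  + by move=> a aH; apply: ck; exact: mem_img.
  + move=> s; apply: (hl g).
    * by move=> a b; rewrite !in_fiber => /andP[aH _] /andP[bH _]; exact: gm.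
    * by rewrite img_fiber.
    * by move=> r; rewrite fiber_fiber; case: eqP.
    * by move=> h; rewrite in_fiber => /andP[/hl' + _]; lia.
- move=> lz' ; have lx := ord_sum_limitr wf lz lz'.
  have /choice[p hp] : forall n, exists p : (nat -> nat) * nat,
      forall z, is_succ (fs zeta n) z -> forall g H, mono_on g H ->
      S z (img g H) -> (forall r, P (fiber g H r)) ->
      (forall h, h \in H -> p.1 (g h) <= h) -> fset_geq p.2 H -> S xi H.
    move=> n; have [z [szn zz]] := fs_succ wf hfs n lz.
    have [t tx ht] := ord_sum_lt_ex wf lz' zz.
    have [l hl] := IH _ zz _ (hz0 _ _ szn) ht.
    have [N hN] := schreier_le wf hfs (ltW tx).
    exists (l, N) => z' sz'; rewrite (succ_fun sz' szn) => g H gm gS gP gl HN.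
    by apply: hN => //; exact: hl gS gP gl.
  exists (fun i => \sum_(n < i.+1) ((p n).1 i + (p n).2)) => g H gm.
  move=> /(schreier_limitE lz)[H0|[n [z [szn nH h]]]] hP hl.
    suff -> : H = fset0 by exact: schreier0.
    apply/fsetP => x; rewrite inE; apply/negbTE/negP => /(mem_img g).
    by rewrite H0.
  have le x : x \in H -> (p n).1 (g x) + (p n).2 <= x.
    move=> xH; apply: leq_trans (hl _ xH).
    apply: (diag_sum_ge (fun n i => (p n).1 i + (p n).2)).
    exact: nH _ (mem_img g xH).
  by apply: (hp n z szn g H) => // x /le; lia.
Qed.

Lemma union_closed_schreier iota zeta xi :
  ord_sum iota zeta xi -> union_closed (S iota) zeta xi.
Proof.
have [z zz zle] := zero_exists wf zeta.
apply: (@union_closed_sum _ _ z) => //; first exact: schreier0.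
move=> x hx; rewrite (ord_sum_zeror zz hx); exists id => g H gm.
move=> /(schreier_zeroE zz) h hP _.
have [->|/fset0Pn[v vH]] := eqVneq H fset0; first exact: schreier0.
case: h => [|[n]] e; first by have := mem_img g vH; rewrite e.
suff <- : fiber g H n = H by exact: hP.
apply/fsetP => w; rewrite in_fiber; case: (boolP (w \in H)) => //= wH.
by have := mem_img g wH; rewrite e inE.
Qed.

(* pi h is the minimum of the piece of E that contains h. *)
Lemma schreier_split iota zeta xi : ord_sum iota zeta xi ->
  exists u : nat -> nat, [/\ {homo u : x y / x < y}, forall v, v <= u v &
  forall E, S xi E -> exists pi : nat -> nat, [/\ mono_on pi E,
    forall h, h \in E -> [/\ pi h \in E, pi h <= h & pi (pi h) = pi h],
    forall v, S iota (fiber pi E v) & S zeta (img (u \o pi) E)]].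
Proof.
elim/(ord_ind wf): zeta xi => zeta IH xi.
have [z|[eta sz]|lz] := ord_kind zeta.
- move=> /(ord_sum_zeror z) ->; exists id; split=> // E ES.
  have [->|/fset0Pn[v vE]] := eqVneq E fset0.
    exists id; split=> // [w|].
      by suff -> : fiber id fset0 w = fset0; [exact: schreier0|apply/fsetP => x; rewrite in_fiber].
    suff -> : img (id \o id) fset0 = fset0 by exact: schreier0.
    by apply/fsetP => x; rewrite inE; apply/negbTE/imgP => -[].
  have [m [mE mmin]] : exists m, m \in E /\ forall x, x \in E -> m <= x.
    have exE : exists x, x \in E by exists v.
    by exists (ex_minn exE); case: ex_minnP => m mE mmin; split.
  exists (fun=> m); split=> // [h hE|w|].
  + by rewrite mmin.
  + by apply: (schreier_sub wf hfs) ES; apply/fsubsetP => x; rewrite in_fiber => /andP[].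
  + suff -> : img (id \o fun=> m) E = [fset m]%fset by exact: schreier_single.
    apply/fsetP => x; rewrite inE; apply/imgP/eqP => [[y yE ->//]|->].
    by exists v.
- move=> /(ord_sum_succr sz)[x sx hx].
  have [u [um uge hu]] := IH _ sz.1 _ hx.
  exists u; split=> // E /(schreier_succE sx)[k [[c [cm ck cS]] kE]].
  have /choice[q hq] := fun s => hu _ (cS s).
  have qE h : h \in E -> [/\ q (c h) h \in E, c (q (c h) h) = c h,
      q (c h) h <= h & q (c h) (q (c h) h) = q (c h) h].
    move=> hE; have [_ h2 _ _] := hq (c h); have [|] := h2 h.
      by rewrite in_fiber hE eqxx.
    by rewrite in_fiber => /andP[h3 /eqP h4] h5 h6.
  pose pi h := q (c h) h.
  have cpi h : h \in E -> c (pi h) = c h by move=> /qE[].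
  have pim : mono_on pi E.
    move=> a b aE bE ab; have := cm _ _ aE bE ab; rewrite leq_eqVlt.
    have [aE' ea _ _] := qE _ aE; have [bE' eb _ _] := qE _ bE.
    move=> /predU1P[e|lt].
      rewrite /pi e; have [h1 _ _ _] := hq (c b); apply: h1 => //.
        by rewrite in_fiber aE e eqxx.
      by rewrite in_fiber bE eqxx.
    rewrite leqNgt; apply/negP => /ltnW /(cm _ _ bE' aE').
    by rewrite ea eb leqNgt lt.
  exists pi; split=> //.
  + move=> h hE; have [h1 h2 h3 h4] := qE _ hE; split=> //.
    by rewrite {1}/pi cpi.
  + move=> v; have [vE|vE] := boolP (v \in E).
      have [_ _ /(_ v) h3 _] := hq (c v).
      suff -> : fiber pi E v = fiber (q (c v)) (fiber c E (c v)) v by [].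
      apply/fsetP => w; rewrite !in_fiber -andbA; case: (boolP (w \in E)) => //= wE.
      apply/eqP/andP => [e|[/eqP e1 /eqP e2]]; last by rewrite /pi e1.
      have e' : c w = c v by rewrite -(cpi _ wE) e.
      by split; [exact/eqP|rewrite -e' -/(pi w) e].
    suff -> : fiber pi E v = fset0 by exact: schreier0.
    apply/fsetP => w; rewrite in_fiber inE; apply/negbTE/negP.
    move=> /andP[wE /eqP e]; move: vE; rewrite -e.
    by have [-> _ _ _] := qE _ wE.
  + apply: (schreier_succI (k := k) sz); last first.
      move=> w /imgP[h hE ->] /=; have [h1 _ _ _] := qE _ hE.
      by apply: leq_trans (kE _ h1) _; rewrite ltnS.
    apply: (chain_img (c := c)) => //.
    * by move=> a b aE bE ab /=; rewrite (ltnW_homo um) // pim.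
    * move=> a b aE bE /= e; rewrite -(cpi _ aE) -(cpi _ bE); congr c.
      by apply/eqP; rewrite eqn_leq; apply/andP; split; rewrite leqNgt;
        apply/negP => /um; rewrite e ltnn.
    * move=> s; have [_ _ _] := hq s; congr (schreier _ _ _).
      apply/fsetP => w; apply/imgP/imgP => -[h hE ->]; exists h => //=;
      by move: hE; rewrite in_fiber /pi => /andP[_ /eqP ->].
- move=> h; have lx := ord_sum_limitr wf lz h.
  have ix : (iota < xi)%O.
    have [z zz _] := zero_exists wf zeta.
    have zl : (z < zeta)%O by apply: zero_min => //; case: lz.
    by have := ord_sum_lt wf zl (ord_sum_zero iota zz) h.
  have [m0 im0] := fs_cofinal hfs lx ix.
  (* The conclusion is stated for every u that dominates [p.1] and [p.2] on E, so that a single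
     diagonal u can serve all n. *)
  have /choice[p hp] : forall n, exists p : (nat -> nat) * nat,
      [/\ {homo p.1 : x y / x < y} &
      forall z E, is_succ (fs xi n) z -> S z E -> exists pi : nat -> nat,
      [/\ mono_on pi E, forall h, h \in E -> [/\ pi h \in E, pi h <= h & pi (pi h) = pi h],
      forall v, S iota (fiber pi E v) &
      forall u, {homo u : x y / x < y} -> (forall x, x \in E -> p.1 x <= u x) ->
        (forall x, x \in E -> p.2 <= u x) -> S zeta (img (u \o pi) E)]].
    move=> n; pose m := maxn n m0.
    have [t [st tx]] := fs_succ wf hfs m lx.
    have it : (iota <= t)%O.
      apply: le_trans im0 (le_trans _ (ltW st.1)).
      have [inc _ _] := hfs lx.
      have : m0 <= m by exact: leq_maxr.
      by rewrite leq_eqVlt => /predU1P[->//|/inc/ltW].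
    have [s sz hs] := ord_sum_onto h it tx.
    have [u [um uge hu]] := IH _ sz _ hs.
    have [N hN] := schreier_le wf hfs (ltW sz).
    exists (u, N); split=> // z E sz' Ez.
    have [pi [pim piE piS piZ]] := hu _ (fs_chain wf hfs lx (leq_maxl n m0) sz' st Ez).
    exists pi; split=> // u' u'm u'u u'N; apply: hN.
      move=> _ /imgP[x xE ->] /=; apply: leqW; apply: u'N.
      by have [] := piE _ xE.
    apply: schreier_spread piZ => //.
    have [g hg] := img_inv (u' \o pi) E.
    have um' := ltnW_homo u'm.
    exists (u \o pi \o g); split.
      move=> x y xE yE xy /=; have [gx ex] := hg _ xE; have [gy ey] := hg _ yE.
      apply: um; rewrite ltnNge; apply/negP => /um'; rewrite -/((u' \o pi) _) ey.
      by rewrite -/((u' \o pi) _) ex leqNgt xy.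
    move=> x xE /=; have [gx ex] := hg _ xE; split; first exact: (mem_img (u \o pi)).
    by rewrite -{2}ex /= u'u //; have [] := piE _ gx.
  exists (fun i => i + \sum_(n < i.+1) ((p n).1 i + (p n).2)); split.
  + apply: (@diag_sum_mono (fun n i => (p n).1 i + (p n).2)) => n x y xy; rewrite leq_add2r.
    by have [um _] := hp n; exact: (ltnW_homo um).
  + by move=> v; exact: leq_addr.
  + move=> E /(schreier_limitE lx)[->|[n [z [szn nE Ez]]]].
      exists id; split=> // [w|].
        by suff -> : fiber id fset0 w = fset0; [exact: schreier0|apply/fsetP => x; rewrite in_fiber].
      rewrite (_ : img _ _ = fset0); first exact: schreier0.
      by apply/fsetP => x; rewrite inE; apply/negbTE/imgP => -[].
    have [um /(_ _ _ szn Ez)[pi [pim piE piS piZ]]] := hp n.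
    exists pi; split=> //; apply: piZ.
    * apply: (@diag_sum_mono (fun n i => (p n).1 i + (p n).2)) => n' x y xy; rewrite leq_add2r.
      by have [um' _] := hp n'; exact: (ltnW_homo um').
    * move=> x xE; apply: leq_trans (leq_addl _ _).
      apply: leq_trans (diag_sum_ge (fun n i => (p n).1 i + (p n).2) _).
        exact: leq_addr.
      exact: nE.
    * move=> x xE; apply: leq_trans (leq_addl _ _).
      apply: leq_trans (diag_sum_ge (fun n i => (p n).1 i + (p n).2) _).
        exact: leq_addl.
      exact: nE.
Qed.

End composition.

(** * Interleaved unions *)

Section monotone_extension.
Local Open Scope nat_scope.
Implicit Types (E F H : {fset nat}) (P Q : {fset nat} -> Prop) (x y s n k h : nat).

(** A point outside E gets the colour of the last point of E before it (0 if there is none).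
    Colourings of different sets can then be added. *)
Lemma chain_ext P k E : chain P k E -> exists c : nat -> nat,
  [/\ {homo c : x y / x <= y}, forall x, c x <= k.-1, 
   forall x, x \in E -> c x < k & forall s, P (fiber c E s)].
Proof.
move=> [c [cm ck cP]].
pose c' x := \max_(e <- E | e <= x) c e.
have c'E : {in E, c' =1 c}.
  move=> x xE; apply/eqP; rewrite eqn_leq; apply/andP; split.
    by rewrite /c' big_seq_cond; apply/bigmax_leqP_seq => e eE /andP[_ ex]; exact: cm.
  by rewrite /c'; apply: leq_bigmax_seq.
exists c'; split.
- move=> x y xy; apply/bigmax_leqP_seq => e eE ex.
  by rewrite /c'; apply: leq_bigmax_seq => //; exact: leq_trans xy.
- move=> x; apply/bigmax_leqP_seq => e eE _; have := ck _ eE; lia.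
- by move=> x xE; rewrite c'E // ck.
- move=> s; have := cP s; congr P; apply/fsetP => x; rewrite !in_fiber.
  by case: (boolP (x \in E)) => //= xE; rewrite c'E.
Qed.

End monotone_extension.

Section interleaved_unions.
Local Open Scope nat_scope.
Variables (d : Order.disp_t) (Omega : orderType d).
Hypothesis wf : well_founded (fun eta xi : Omega => (eta < xi)%O).
Variable fs : Omega -> nat -> Omega.
Hypothesis hfs : schreier_sequences fs.
Implicit Types xi zeta eta iota rho sigma tau : Omega.
Implicit Types (E F H : {fset nat}) (P Q : {fset nat} -> Prop) (x y s n k h : nat).

Local Notation S := (schreier fs).

Definition subsingleton E : Prop := {in E &, forall x y, x = y}.

Lemma subsingleton_schreier xi E : subsingleton E -> S xi E.
Proof.
move=> sE; have [->|/fset0Pn[x xE]] := eqVneq E fset0; first exact: schreier0.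
suff -> : E = [fset x]%fset by exact: schreier_single.
by apply/fsetP => y; rewrite inE; apply/idP/eqP => [yE|->//]; exact: sE.
Qed.

Lemma subsingleton_zero xi E : is_zero xi -> S xi E -> subsingleton E.
Proof.
move=> z /(schreier_zeroE z)[->|[n ->]] x y; first by rewrite inE.
by rewrite !inE => /eqP -> /eqP ->.
Qed.

(* A member of [chain subsingleton q] is a set with at most q elements. *)
Definition contains_small eta q : Prop := forall E, fset_geq 5 E ->
  chain subsingleton q E -> S eta E.

Lemma contains_small_succ eta xi q : is_succ eta xi ->
  contains_small eta q -> contains_small xi (5 * q).
Proof.
move=> sx hq E E5 /chain_group[c [cm c5 cP]]; apply: (schreier_succI sx _ E5).
exists c; split=> // s; apply: hq => // x.
rewrite in_fiber => /andP[xE _]; exact: E5.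
Qed.

(* At a limit eta the index n with E, F in S_(eta_n + 1) is only bounded by the
   minimum of E and F, while the number 5 * q of pieces given by the induction
   hypothesis is not; [contains_small] repairs this, since S_(eta_n + 1) then
   absorbs the part of the union below 5 * q. *)
Lemma schreier_union eta : exists q, [/\ 0 < q, contains_small eta q &
  forall E F, fset_geq 5 E -> fset_geq 5 F -> S eta E -> S eta F ->
  chain (S eta) (5 * q) (E `|` F)%fset].
Proof.
elim/(ord_ind wf): eta => xi IH.
have [z|[eta sx]|lx] := ord_kind xi.
- exists 1; split=> // [E _ [c [_ c1 cP]]|E F _ _ /(subsingleton_zero z) sE /(subsingleton_zero z) sF].
    suff <- : fiber c E 0 = E by exact: subsingleton_schreier.
    apply/fsetP => x; rewrite in_fiber; have [xE|//] /= := boolP (x \in E).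
    by have := c1 x xE; case: (c x).
  apply: (@chain_mon (S xi) _ 2) => //.
  exists (fun x => has (fun y => y < x) (E `|` F)%fset : nat); split.
  + move=> x y _ _ xy; case: hasP => //= -[w wE wx].
    by case: hasP => // -[]; exists w => //; exact: leq_trans xy.
  + by move=> x _; case: has.
  + move=> s; apply: subsingleton_schreier => x y; rewrite !in_fiber.
    move=> /andP[xU /eqP ex] /andP[yU /eqP ey].
    have lt a b : a \in (E `|` F)%fset -> b \in (E `|` F)%fset -> a < b ->
        has (fun y => y < a) (E `|` F)%fset = has (fun y => y < b) (E `|` F)%fset -> False.
      move=> aU bU ab e; have : has (fun y => y < b) (E `|` F)%fset.
        by apply/hasP; exists a.
      rewrite -e => /hasP[w wU wa]; move: aU bU wU; rewrite !inE.
      move=> /orP[aE|aF] /orP[bE|bF] /orP[wE|wF];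
        by [have := sE _ _ aE bE; lia|have := sF _ _ aF bF; lia|
            have := sE _ _ wE aE; lia|have := sE _ _ wE bE; lia|
            have := sF _ _ wF aF; lia|have := sF _ _ wF bF; lia].
    have e : has (fun w => w < x) (E `|` F)%fset = has (fun w => w < y) (E `|` F)%fset.
      by move: ex ey; case: has; case: has => // <-.
    have [/lt h|/lt h|//] := ltngtP x y; first by case: (h xU yU e).
    by case: (h yU xU (esym e)).
- have [q [q0 hq hU]] := IH _ sx.1.
  exists (5 * q); split; [lia|exact: contains_small_succ sx hq|].
  (* The points before l belong to E alone and form one piece. On the others, [cE x + cF x] takes at
     most k + l <= 2 l values, and by monotonicity both colours are constant where the sum is: each
     class lies in the union of one piece of E and one of F. This gives 2 l * 5 q sets of S_eta,
     hence 10 q sets of S_xi because l <= min, and 1 + 10 q <= 25 q. *)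
  have wl k l (E F : {fset nat}) : k <= l -> fset_geq k E -> fset_geq l F -> fset_geq 5 E ->
      fset_geq 5 F -> chain (S eta) k E -> chain (S eta) l F ->
      chain (S xi) (5 * (5 * q)) (E `|` F)%fset.
    move=> kl kE lF E5 F5 ckE /chain_ext[cF [cFm cFl cFl' cFS]].
    apply: (@chain_mon (S xi) _ (1 + 10 * q)) => //; first lia.
    apply: (@chain_cat _ _ _ l.-1); first exact: schreier0.
      apply: chain1; first exact: schreier0.
      apply: (@schreier_sub _ _ wf _ hfs _ E).
        by apply/fsubsetP => x; rewrite !inE => /andP[/orP[//|/lF]]; lia.
      exact: schreier_succI sx ckE kE.
    have [cE [cEm cEk cEk' cES]] := chain_ext ckE.
    set H := [fset _ | _ in _ & _]%fset.
    have HE x : x \in H -> l <= x.+1 /\ ((x \in E) || (x \in F)).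
      rewrite !inE => /andP[-> ?]; split=> //; lia.
    apply: (chain_succ (b := l) sx); first by move=> x /HE[].
    apply: (@chain_mon (S eta) _ ((k + l) * (5 * q))) => //; first nia.
    apply: (@chain_comp _ _ _ _ (fun x => cE x + cF x)).
    + by move=> x y _ _ xy; apply: leq_add; [exact: cEm|exact: cFm].
    + move=> x /HE[_ /orP[/cEk'|/cFl']]; have := cEk x; have := cFl x; lia.
    + move=> s; have [-> | /fset0Pn[w]] := eqVneq (fiber (fun x => cE x + cF x) H s) fset0.
        by apply: chain0; exact: schreier0.
      rewrite in_fiber => /andP[wH /eqP ew].
      have same x : x \in H -> cE x + cF x = s -> cE x = cE w /\ cF x = cF w.
        by move=> _; have [/ltnW xw|/ltnW xw|->//] := ltngtP x w; have := cEm _ _ xw;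
          have := cFm _ _ xw; lia.
      have G5 (G : {fset nat}) c i : fset_geq 5 G -> fset_geq 5 (fiber c G i).
        by move=> h x; rewrite in_fiber => /andP[/h].
      have := hU _ _ (G5 _ cE (cE w) E5) (G5 _ cF (cF w) F5) (cES (cE w)) (cFS (cF w)).
      apply: chain_hereditary; first exact: schreier_sub.
      apply/fsubsetP => x; rewrite in_fiber => /andP[xH /eqP ex].
      have [e1 e2] := same _ xH ex; have [_ h] := HE _ xH.
      by rewrite inE !in_fiber e1 e2 !eqxx !andbT.
  move=> E F E5 F5 /(schreier_succE sx)[k [ckE kE]] /(schreier_succE sx)[l [clF lF]].
  have [kl|/ltnW lk] := leqP k l; first exact: (wl k l).
  by rewrite fsetUC; apply: (wl l k).
- exists 1; split=> // [E _ [c [_ c1 cP]]|].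
    apply: subsingleton_schreier; suff <- : fiber c E 0 = E by exact: cP.
    apply/fsetP => x; rewrite in_fiber; have [xE|//] /= := boolP (x \in E).
    by have := c1 x xE; case: (c x).
  have wl m n zm zn (E F : {fset nat}) : m <= n -> is_succ (fs xi m) zm -> is_succ (fs xi n) zn ->
      fset_geq m.+1 E -> fset_geq n.+1 F -> fset_geq 5 E -> fset_geq 5 F ->
      S zm E -> S zn F -> chain (S xi) 5 (E `|` F)%fset.
    move=> mn sm sn mE nF E5 F5 ES FS.
    (* Both sets are now in S_(xi_n + 1), and the union is cut at n, n + 1 and 5 q. Before n there
       is only E, and n is one point. What follows may use the next term of the sequence, and so may
       be any set of S_(xi_n + 2). Its points before 5 q are few ([contains_small]), and those after
       form at most 5 q sets of S_(xi_n + 1). *)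
    have ES' := fs_chain wf hfs lx mn sm sn ES.
    have [z [_ zx]] := fs_succ wf hfs n lx.
    have znx : (zn < xi)%O by exact: limit_succ lx (fs_lt hfs n lx) sn.
    have [q [q0 hq hU]] := IH _ znx.
    apply: (@chain_cat _ 1 4 n); first exact: schreier0.
      apply: chain1; first exact: schreier0.
      apply: (@schreier_sub _ _ wf _ hfs _ E).
        by apply/fsubsetP => x; rewrite !inE => /andP[/orP[//|/nF]]; lia.
      exact: schreier_limitI lx sm mE ES.
    apply: (@chain_cat _ 1 3 n.+1); first exact: schreier0.
      apply: chain1; first exact: schreier0.
      by apply: subsingleton_schreier => x y; rewrite !inE; lia.
    have [zn' [sn' zn'x]] := fs_succ wf hfs n.+1 lx.
    have [zn2 [sn2 _]] := limit_lt wf lx znx.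
    have S2 (G : {fset nat}) : S zn2 G -> fset_geq n.+2 G -> S xi G.
      move=> /(schreier_succE sn2)[k [h kG]] nG.
      apply: (schreier_limitI lx sn' nG); apply: (schreier_succI sn' _ kG).
      by apply: chain_mon h => // G'; exact: fs_chainS.
    have gH (G : {fset nat}) : (forall x, x \in G -> n < x /\ x \in (E `|` F)%fset) ->
        fset_geq n.+2 G /\ fset_geq 5 G.
      move=> h; split=> x /h[nx]; first lia.
      by rewrite inE => /orP[/E5|/F5].
    apply: (@chain_cat _ 1 2 (5 * q)); first exact: schreier0.
      apply: chain1; first exact: schreier0.
      set G := [fset _ | _ in _ & _]%fset.
      have [|G2 G5] := gH G; first by move=> x; rewrite !inE => /andP[/andP[/andP[-> _] ->] _].
      apply: S2 => //; apply: (contains_small_succ sn2 hq) => //.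
      exists id; split=> // [x|s x y]; first by rewrite !inE => /andP[].
      by rewrite !in_fiber => /andP[_ /eqP ->] /andP[_ /eqP ->].
    apply: (@chain_mon (S xi) _ 1) => //; apply: chain1; first exact: schreier0.
    set G := [fset _ | _ in _ & _]%fset.
    have [|G2 G5] := gH G; first by move=> x; rewrite !inE => /andP[/andP[/andP[-> _] ->] _].
    apply: S2 => //; apply: (schreier_succI (k := 5 * q) sn2).
      apply: chain_hereditary (hU _ _ E5 F5 ES' FS); first exact: schreier_sub.
      by apply/fsubsetP => x; rewrite !inE => /andP[/andP[/andP[-> _] _] _].
    by move=> x; rewrite !inE => /andP[_ h]; exact: leqW.
  move=> E F E5 F5 ES FS.
  have triv (G : {fset nat}) : S xi G -> chain (S xi) (5 * 1) G.
    move=> GS; apply: (@chain_mon (S xi) _ 1) => //; apply: chain1 => //.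
    exact: schreier0.
  case: (schreier_limitE lx ES) => [->|[m [zm [sm mE ES']]]].
    by rewrite fset0U; exact: triv.
  case: (schreier_limitE lx FS) => [->|[n [zn [sn nF FS']]]].
    by rewrite fsetU0; exact: triv.
  have [mn|/ltnW nm] := leqP m n; first exact: (wl m n zm zn).
  by rewrite fsetUC; apply: (wl n m zn zm).
Qed.

(** Unlike the pieces of a [chain], the R sets may interleave. *)
Fixpoint rfold P R E : Prop :=
  if R is R'.+1 then exists A B, [/\ rfold P R' A, P B & E = (A `|` B)%fset]
  else E = fset0.

Lemma rfold_chain eta R : exists K, 0 < K /\ forall E, fset_geq 5 E ->
  rfold (S eta) R E -> chain (S eta) K E.
Proof.
elim: R => [|R [K [K0 hK]]].
  by exists 1; split=> // E _ ->; apply: chain0; exact: schreier0.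
have [q [q0 _ hU]] := schreier_union eta.
exists (K * (5 * q)); split; first lia.
move=> E E5 [A [B [hA hB eE]]].
have A5 : fset_geq 5 A by apply: fset_geq_sub E5; rewrite eE fsubsetUl.
have B5 : fset_geq 5 B by apply: fset_geq_sub E5; rewrite eE fsubsetUr.
have [c [cm cK _ cS]] := chain_ext (hK _ A5 hA).
apply: (@chain_comp _ _ _ _ c).
- by move=> x y _ _; exact: cm.
- by move=> x _; have := cK x; lia.
- move=> s; have -> : fiber c E s = (fiber c A s `|` fiber c B s)%fset.
    by apply/fsetP => x; rewrite in_fsetU !in_fiber eE in_fsetU andb_orl.
  apply: hU => //.
  + by move=> x; rewrite in_fiber => /andP[/A5].
  + by move=> x; rewrite in_fiber => /andP[/B5].
  + apply: (schreier_sub wf hfs) hB; apply/fsubsetP => x.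
    by rewrite in_fiber => /andP[].
Qed.

Lemma rfold_sub eta R : hereditary (rfold (S eta) R).
Proof.
elim: R => [|R IH] E F FE; first by move=> /= e; apply/eqP; rewrite -fsubset0 -e.
move=> [A [B [hA hB eE]]]; exists (F `&` A)%fset, (F `&` B)%fset; split.
- by apply: IH hA; exact: fsubsetIr.
- by apply: (schreier_sub wf hfs) hB; exact: fsubsetIr.
- by rewrite -fsetIUr -eE; symmetry; apply/fsetIidPl.
Qed.

(* For sigma >= 1 each point of a set of S_sigma can be replaced by K points
   that start far enough; this fails for sigma = 0. *)
Lemma union_closed_rfold eta zeta xi sigma R : ord_sum eta zeta xi ->
  (sigma <= zeta)%O -> ~ is_zero sigma ->
  union_closed fs (rfold (S eta) R) sigma xi.
Proof.
move=> hx sz nz.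
have [z zz zle] := zero_exists wf sigma.
have [one [so _]] : exists one, is_succ z one /\ (one <= sigma)%O.
  by have [one so os] := succ_exists wf (zero_min zz nz); exists one.
have hz0 (x y : Omega) : is_succ x y -> (one <= y)%O.
  by move=> sy; apply: so.2; apply: le_lt_trans (zz x) sy.1.
have r0 : rfold (S eta) R fset0.
  by elim: (R) => //= R' IH; exists fset0, fset0; rewrite fsetU0; split=> //; exact: schreier0.
have oz : (one <= zeta)%O by apply: so.2; exact: lt_le_trans (zero_min zz nz) sz.
have [l hl] : union_closed fs (rfold (S eta) R) zeta xi.
  apply: (union_closed_sum wf hfs r0 hz0 _ oz hx) => x /(ord_sum_succr so)[x' sx'].
  move=> /(ord_sum_zeror zz) e; rewrite {}e in sx'.
  have [K [K0 hK]] := rfold_chain eta R.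
  (* k pieces form a chain of k * K sets of S_eta, and k <= r + 1 for every label r; 5 is the lower
     bound required by [schreier_union]. *)
  exists (fun r => K * r.+1 + 5) => g H gm /(schreier_succE so)[k [[c [cm ck cS]] kH]] hR hg.
  have H5 : fset_geq 5 H by move=> h /hg; lia.
  apply: (schreier_succI (k := k * K) sx'); last first.
    by move=> h hH; have := hg _ hH; have := kH _ (mem_img g hH); nia.
  apply: (@chain_comp _ _ _ _ (c \o g)).
  - by move=> a b aH bH ab; apply: cm; rewrite ?mem_img //; exact: gm.
  - by move=> a aH; apply: ck; exact: mem_img.
  - move=> s; have [->|/fset0Pn[w]] := eqVneq (fiber (c \o g) H s) fset0.
      by apply: chain0; exact: schreier0.
    rewrite in_fiber => /andP[wH /eqP ew].
    have -> : fiber (c \o g) H s = fiber g H (g w).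
      apply/fsetP => y; rewrite !in_fiber; case: (boolP (y \in H)) => //= yH.
      apply/eqP/eqP => [ey|->//].
      apply: (subsingleton_zero zz (cS s)); rewrite in_fiber mem_img //=; exact/eqP.
    by apply: hK => // y; rewrite in_fiber => /andP[/H5].
have [N hN] := schreier_le wf hfs sz.
(* The labels are moved up by N, beyond which sets of S_sigma are in S_zeta. *)
exists (fun r => l (r + N) + (r + N)) => g H gm gS gR hg.
apply: (hl (fun h => g h + N) H).
- by move=> x y xH yH xy; rewrite leq_add2r gm.
- apply: hN; first by move=> _ /imgP[x xH ->]; lia.
  apply: schreier_spread gS => //.
  have [f hf] := img_inv (fun h => g h + N) H.
  exists (g \o f); split.
    move=> x y xH yH xy /=; have [fx ex] := hf _ xH; have [fy ey] := hf _ yH; lia.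
  by move=> x xH /=; have [fx ex] := hf _ xH; split; [exact: mem_img|lia].
- move=> r; have [Nr|rN] := leqP N r.
    suff -> : fiber (fun h => g h + N) H r = fiber g H (r - N) by [].
    apply/fsetP => x; rewrite !in_fiber; congr andb; lia.
  suff -> : fiber (fun h => g h + N) H r = fset0 by [].
  apply/fsetP => x; rewrite in_fiber inE; apply/negbTE/negP => /andP[_ /eqP]; lia.
- by move=> h /hg; lia.
Qed.

End interleaved_unions.

(** * Repeated averages and blocks *)

Section block_index.
Local Open Scope nat_scope.
Variable e : nat -> nat.
Hypothesis em : {homo e : x y / x < y}.

Lemma homo_ge i : i <= e i.
Proof. by elim: i => // i IH; apply: leq_ltn_trans IH _; exact: em. Qed.

(* The index i of the interval [e i, e i.+1) containing r. *)
Definition blk r := \sum_(i < r) (e i.+1 <= r).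

Lemma blk_mono : {homo blk : x y / x <= y}.
Proof.
move=> x y xy; rewrite /blk -(big_mkord xpredT (fun i => (e i.+1 <= x) : nat)).
rewrite -(big_mkord xpredT (fun i => (e i.+1 <= y) : nat)).
rewrite (@big_cat_nat _ _ _ x 0 y) //=.
apply: leq_trans (leq_addr _ _); apply: leq_sum => i _.
by case: (leqP (e i.+1) x) => // h; rewrite (leq_trans h xy).
Qed.

Lemma blkE i r : e i <= r < e i.+1 -> blk r = i.
Proof.
move=> /andP[ir ri]; have eW := ltnW_homo em.
have ler : i <= r by exact: leq_trans (homo_ge i) ir.
rewrite /blk -(big_mkord xpredT (fun i => (e i.+1 <= r) : nat)).
rewrite (@big_cat_nat _ _ _ i 0 r) //=.
rewrite [X in _ + X]big_nat_cond [X in _ + X]big1 ?addn0; last first.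
  move=> j /andP[/andP[ij _] _]; rewrite leqNgt.
  by rewrite (leq_trans ri) // eW.
rewrite (eq_big_nat _ _ (F2 := fun=> 1)); first by rewrite sum_nat_const_nat muln1 subn0.
by move=> j /andP[_ ji]; rewrite (leq_trans _ ir) // eW.
Qed.

Lemma blk_between r : e 0 <= r -> e (blk r) <= r < e (blk r).+1.
Proof.
move=> e0; have [i ei] : exists i, e i <= r < e i.+1; last by rewrite (blkE ei).
have ex : exists i, r < e i.+1 by exists r; exact: (homo_ge r.+1).
exists (ex_minn ex); case: ex_minnP => i ri imin; rewrite ri andbT.
case: i ri imin => // i ri imin; rewrite leqNgt; apply/negP => /imin.
by rewrite ltnn.
Qed.

End block_index.

Section spread_index.
Local Open Scope nat_scope.
Variables (d : Order.disp_t) (Omega : orderType d).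
Hypothesis wf : well_founded (fun eta xi : Omega => (eta < xi)%O).
Variable fs : Omega -> nat -> Omega.
Hypothesis hfs : schreier_sequences fs.
Implicit Types (xi : Omega) (G : {fset nat}).

(** This replaces an index sequence by one that grows faster, possibly after a change of positions
    p. *)
Lemma schreier_reindex xi (m m' p : nat -> nat) G G' :
  smono_on (m \o p) G' -> mono_on m' G' ->
  (forall r, r \in G' -> p r \in G /\ m (p r) <= m' r) ->
  schreier fs xi (img m G) -> schreier fs xi (img m' G').
Proof.
move=> mp m'm hp; apply: schreier_spread => //.
have [g hg] := img_inv m' G'.
exists (m \o p \o g); split.
  move=> x y xG yG xy /=; have [gx ex] := hg _ xG; have [gy ey] := hg _ yG.
  apply: mp => //; rewrite ltnNge; apply/negP => yx.
  by have := m'm _ _ gy gx yx; rewrite ex ey leqNgt xy.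
move=> x xG /=; have [gx ex] := hg _ xG; have [h1 h2] := hp _ gx.
by split; [exact: mem_img|rewrite -{2}ex].
Qed.

End spread_index.

Section mass.
Variable R : realType.
Implicit Types (y a : nat -> R) (E F G : {fset nat}).

Definition mass y E : R := \sum_(i <- E) y i.

(* The norm given by P is at most c at y (for y >= 0). *)
Definition norm_le (P : {fset nat} -> Prop) y (c : R) : Prop :=
  forall E, P E -> mass y E <= c.

Lemma mass0 y : mass y fset0 = 0.
Proof. exact: big_seq_fset0. Qed.

Lemma mass1 y n : mass y [fset n]%fset = y n.
Proof. exact: big_seq_fset1. Qed.

Lemma mass_sub y E F : (forall k, 0 <= y k) -> (E `<=` F)%fset ->
  mass y E <= mass y F.
Proof.
move=> y0 EF; rewrite /mass (big_fsetID _ (mem E) F) /=.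
rewrite (_ : [fset x in F | x \in E]%fset = E).
  by rewrite lerDl sumr_ge0.
apply/fsetP => x; rewrite !inE andbC; case: (boolP (x \in E)) => //=.
exact: (fsubsetP EF).
Qed.

Lemma mass_ge0 y E : (forall k, 0 <= y k) -> 0 <= mass y E.
Proof. by move=> y0; exact: sumr_ge0. Qed.

Lemma mass_eq y E F : (forall k, y k != 0 -> (k \in E) = (k \in F)) ->
  mass y E = mass y F.
Proof.
move=> h; rewrite /mass; transitivity (\sum_(i <- (E `&` F)%fset) y i).
  symmetry; apply: big_fset_incl; first exact: fsubsetIl.
  move=> x xE; rewrite in_fsetI xE /= => xF; apply/eqP.
  by apply: contraNT xF => /h <-.
apply: big_fset_incl; first exact: fsubsetIr.
move=> x xF; rewrite in_fsetI xF andbT => xE; apply/eqP.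
by apply: contraNT xE => /h ->.
Qed.

Lemma mass_chain a (c : nat -> nat) K G :
  (forall x, x \in G -> (c x < K)%N) ->
  mass a G = \sum_(s < K) mass a (fiber c G s).
Proof.
move=> cK; under eq_bigr => s _ do rewrite /mass /fiber big_fset /=.
rewrite (exchange_big_dep predT) //= /mass big_seq [RHS]big_seq; apply: eq_bigr => x xG.
rewrite (bigD1 (Ordinal (cK x xG))) //= big1 ?addr0 // => s /andP[/eqP e].
by move=> /eqP; case; apply: val_inj.
Qed.

Lemma mass_le_chain (P : {fset nat} -> Prop) K y c F :
  norm_le P y c -> chain P K F -> mass y F <= K%:R * c.
Proof.
move=> yc [col [_ cK cP]]; rewrite (mass_chain _ cK).
apply: (@le_trans _ _ (\sum_(s < K) c)); last by rewrite sumr_const card_ord mulr_natl.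
by apply: ler_sum => s _; exact: yc.
Qed.

End mass.

Section averages.
Variable R : realType.
Variables (d : Order.disp_t) (Omega : orderType d).
Hypothesis wf : well_founded (fun eta xi : Omega => (eta < xi)%O).
Variable fs : Omega -> nat -> Omega.
Hypothesis hfs : schreier_sequences fs.
Implicit Types (sigma tau : Omega) (y a : nat -> R) (E F G A : {fset nat}).
Implicit Types (eps : R) (r v : nat).

Local Notation S := (schreier fs).

Definition convex_on a A : Prop :=
  [/\ forall k, 0 <= a k, forall k, k \notin A -> a k = 0 & mass a A = 1].

(** It suffices to reach S_(sigma+1), with the average of k vectors carried by successive sets of
    S_sigma, each so far out that sets of S_sigma starting before it have mass at most eps / 2 on
    it. A set of S_sigma then has mass at most 1 on the first vector that it meets, and at most eps
    / 2 on the others. *)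
Lemma averages sigma tau (m : nat -> nat) : (sigma < tau)%O ->
  {homo m : x y / (x < y)%N} -> forall N eps, 0 < eps ->
  exists A a, [/\ forall r, r \in A -> (N <= r)%N, convex_on a A,
    S tau (img m A) & forall G, S sigma (img m G) -> mass a G <= eps].
Proof.
move=> + mm; elim/(ord_ind wf): sigma tau => sigma IH tau st.
have [sig' [ss sle]] : exists s', is_succ sigma s' /\ (s' <= tau)%O.
  by have [s' h1 h2] := succ_exists wf st; exists s'.
move=> N0 eps eps0; have mge := homo_ge mm.
have eps2 : 0 < eps / 2 by rewrite divr_gt0.
(* By [schreier_tail], the sets of S_sigma that start early are chains of K sets of a smaller S_eta,
   to which the induction hypothesis applies with eps / 2 / (K + 1). If sigma = 0, a set with a
   point before N misses N, and the unit vector at N will do. *)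
have /choice[p hp] : forall N, exists p : (nat -> R) * {fset nat},
    [/\ forall r, r \in p.2 -> (N <= r)%N, convex_on p.1 p.2,
      S sigma (img m p.2) & forall G v, S sigma (img m G) -> v \in G ->
        (v < N)%N -> mass p.1 G <= eps / 2].
  move=> N; have [z|[eta [K [es hK]]]] := schreier_tail wf hfs sigma (m N).
    exists (fun r => (r == N)%:R, [fset N]%fset); split => /=.
    - by move=> r; rewrite inE => /eqP ->.
    - split=> [k|k|]; rewrite ?ler0n // ?mass1 ?eqxx //.
      by rewrite inE => /negbTE ->.
    - apply: subsingleton_schreier => // x y /imgP[v + ->] /imgP[w + ->].
      by rewrite !inE => /eqP -> /eqP ->.
    - move=> G v GS vG vN; apply: le_trans (ltW eps2).
      rewrite /mass big_seq big1 // => r rG; case: eqVneq => // e.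
      have := subsingleton_zero z GS (mem_img m vG) (mem_img m rG).
      by have := mm _ _ vN; rewrite e => + e'; rewrite e' ltnn.
  have epsK : 0 < eps / 2 / K.+1%:R by rewrite divr_gt0.
  have [A [a [AN ac AS aG]]] := IH _ es _ es N _ epsK.
  exists (a, A); split=> //= G v GS vG vN.
  have [c [cm ck cS]] := hK _ _ GS (mem_img m vG) (mm _ _ vN).
  rewrite (@mass_chain _ _ (c \o m) K); last by move=> x xG; exact: ck (mem_img m xG).
  apply: (@le_trans _ _ (\sum_(s < K) (eps / 2 / K.+1%:R))).
    by apply: ler_sum => s _; apply: aG; rewrite img_fiber.
  rewrite sumr_const card_ord -[_ *+ K]mulr_natr mulrAC ler_pdivrMr //.
  by apply: ler_wpM2l; [exact: ltW|rewrite ler_nat].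
pose A N := (p N).2; pose a N := (p N).1.
(* This choice makes (1 + k eps / 2) / k at most eps. *)
have [k [k0 hk]] : exists k : nat, (0 < k)%N /\ 1 <= k%:R * (eps / 2).
  exists (Num.bound (eps / 2)^-1); have h := archi_boundP (ltW (_ : 0 < (eps / 2)^-1)).
  rewrite invr_gt0 in h; have {}h := h eps2; split.
    by rewrite -(ltr_nat R); apply: le_lt_trans h; rewrite invr_ge0 ltW.
  by rewrite -ler_pdivrMr // div1r ltW.
have [M hM] := schreier_le wf hfs sle.
pose nxt N := (N + \max_(r <- A N) r.+1)%N.
have Anxt N r : r \in A N -> (N <= r < nxt N)%N.
  move=> rA; have [h _ _ _] := hp N; rewrite h //=.
  apply: (@leq_trans (\max_(r <- A N) r.+1)); last exact: leq_addl.
  exact: (@leq_bigmax_seq nat (enum_fset (A N)) xpredT (fun r => r.+1) r rA isT).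
have lt_nxt N : (N < nxt N)%N.
  have [_ [_ _ m1] _ _] := hp N.
  have [e|/fset0Pn[r /Anxt/andP[h1 h2]]] := eqVneq (A N) fset0.
    by move: m1; rewrite -/(A N) e mass0 => /eqP; rewrite eq_sym oner_eq0.
  exact: leq_ltn_trans h1 h2.
(* The vectors start beyond N0 as required, beyond M where sets of S_(sigma+1) are in S_tau, and
   beyond k so that k sets may be united. *)
pose e i := iter i nxt (N0 + M + k)%N.
have em : {homo e : x y / (x < y)%N}.
  by apply: homo_ltn => [y x z|i]; [exact: ltn_trans|exact: lt_nxt].
have eW := ltnW_homo em.
have blkA i r : r \in A (e i) -> blk e r = i.
  by move=> /Anxt h; apply: blkE.
pose B := (\bigcup_(i <- iota 0 k) A (e i))%fset.
have BP r : reflect (exists2 i, (i < k)%N & r \in A (e i)) (r \in B).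
  apply: (iffP (bigfcupP _ _ _ _)) => [[j]|[j]].
    by rewrite mem_iota andbT add0n => jk rA; exists j.
  by move=> jk rA; exists j; rewrite // mem_iota andbT add0n.
have Bge r : r \in B -> (N0 + M + k <= r)%N.
  move=> /BP[i _ /Anxt/andP[h _]]; apply: leq_trans h.
  exact: (eW 0%N i).
pose b r : R := k%:R^-1 * \sum_(i < k) a (e i) r.
have massb G : mass b G = k%:R^-1 * \sum_(i < k) mass (a (e i)) G.
  by rewrite /mass /b -mulr_sumr; congr (_ * _); exact: exchange_big.
have k0R : 0 < k%:R :> R by rewrite ltr0n.
exists B, b; split.
- by move=> r /Bge; lia.
- split.
  + move=> r; rewrite mulr_ge0 ?invr_ge0 ?ler0n // sumr_ge0 // => i _.
    have [_ [h _ _] _ _] := hp (e i); exact: h.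
  + move=> r rB; rewrite /b big1 ?mulr0 // => i _.
    have [_ [_ h _] _ _] := hp (e i); apply: h.
    by apply: contra rB => rA; apply/BP; exists i.
  + rewrite massb (eq_bigr (fun=> 1)) => [|i _].
      by rewrite sumr_const card_ord mulVf // gt_eqF.
    have [_ [h0 h1 h2] _ _] := hp (e i); rewrite -h2.
    apply: mass_eq => r ar; have -> : r \in (p (e i)).2.
      by apply: contraNT ar => /h1; rewrite /a => ->.
    by apply/BP; exists i => //; apply: contraNT ar => /h1; rewrite /a => ->.
- apply: hM; first by move=> _ /imgP[r /Bge rB ->]; have := mge r; lia.
  apply: (schreier_succI (k := k) ss); last first.
    by move=> _ /imgP[r /Bge rB ->]; have := mge r; lia.
  apply: (@chain_img (blk e)).
  + exact/smonoW/(in2W mm).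
  + by move=> x y _ _; exact: blk_mono.
  + move=> x y xB yB /eqP; rewrite eqn_leq => /andP[h1 h2]; congr blk.
    apply/eqP; rewrite eqn_leq; apply/andP; split; rewrite leqNgt;
    by apply/negP => /mm; rewrite ltnNge ?h1 ?h2.
  + by move=> x /BP[i ik /blkA ->].
  + move=> s; have [_ _ h _] := hp (e s); apply: (schreier_sub wf hfs) h.
    apply/fsubsetP => _ /imgP[r + ->]; rewrite in_fiber => /andP[/BP[i ik rA] /eqP].
    by rewrite (blkA _ _ rA) => <-; exact: mem_img.
- move=> G GS; rewrite massb ler_pdivrMl //.
  pose P i := has (fun r => r \in A (e i)) G.
  have noP i : ~~ P i -> mass (a (e i)) G = 0.
    move=> /hasPn h; rewrite /mass big_seq big1 // => r /h rA.
    by have [_ [_ h1 _] _ _] := hp (e i); exact: h1.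
  have le1 i : mass (a (e i)) G <= 1.
    have [_ [h0 h1 h2] _ _] := hp (e i); rewrite -h2 -(@mass_eq _ _ (G `&` A (e i))%fset).
      by apply: mass_sub => //; exact: fsubsetIr.
    move=> r ar; rewrite in_fsetI; case: (r \in G) => //=.
    by apply: contraNT ar => /h1; rewrite /a => ->.
  have [[i0 Pi0]|nP] := pselect (exists i, P i); last first.
    rewrite big1 ?mulr_ge0 ?ler0n ?ltW // => i _; apply: noP.
    by apply/negP => h; apply: nP; exists i.
  have exP : exists i, P i by exists i0.
  pose i1 := ex_minn exP.
  have [Pi1 min1] : P i1 /\ forall i, P i -> (i1 <= i)%N.
    by rewrite /i1; case: ex_minnP.
  have bound i : mass (a (e i)) G <= (i == i1)%:R + eps / 2.
    have [->|ne] := eqVneq i i1; first by rewrite ler_wpDr // ltW.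
    rewrite add0r; have [Pi|/noP ->] := boolP (P i); last exact: ltW.
    have lt : (i1 < i)%N by rewrite ltn_neqAle eq_sym ne min1.
    have /hasP[v vG /Anxt/andP[_ v1]] := Pi1.
    have [_ _ _ h] := hp (e i); apply: (h G v) => //.
    exact: leq_trans v1 (eW i1.+1 i lt).
  apply: (@le_trans _ _ (\sum_(i < k) ((i == i1 :> nat)%:R + eps / 2))).
    by apply: ler_sum => i _; exact: bound.
  rewrite big_split /= sumr_const card_ord -[_ *+ k]mulr_natl.
  have : \sum_(i < k) (i == i1 :> nat)%:R <= 1 :> R.
    have [ik|ik] := ltnP i1 k.
      rewrite (bigD1 (Ordinal ik)) //= eqxx big1 ?addr0 // => i ne.
      by rewrite (_ : (i == i1 :> nat) = false) //; apply/negbTE.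
    rewrite big1 ?ler01 // => i _; rewrite (_ : (i == i1 :> nat) = false) //.
    by apply/negbTE; rewrite neq_ltn (leq_trans (ltn_ord i) ik).
  move: (\sum_(i < k) _) => t t1.
  apply: (@le_trans _ _ (k%:R * (eps / 2) + k%:R * (eps / 2))); last by rewrite -mulrDr -splitr.
  by rewrite lerD // (le_trans t1).
Qed.

End averages.

(** * Estimates for block sequences in the space *)

Section block_sequences.
Variable R : realType.
Variables (d : Order.disp_t) (Omega : orderType d).
Hypothesis wf : well_founded (fun eta xi : Omega => (eta < xi)%O).
Variable fs : Omega -> nat -> Omega.
Hypothesis hfs : schreier_sequences fs.
Implicit Types (sigma tau iota zeta xi eta : Omega) (y a : nat -> R).
Implicit Types (E F G A H : {fset nat}) (eps delta : R) (r v n h k : nat).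

Local Notation S := (schreier fs).

Lemma fset_min E : E != fset0 ->
  exists2 x : nat, x \in E & forall z : nat, z \in E -> (x <= z)%N.
Proof.
move=> /fset0Pn[x xE]; have ex : exists x, x \in E by exists x.
by exists (ex_minn ex); case: ex_minnP.
Qed.

(* If m_(G+1) is in S_sigma, then so is m_(G minus its minimum). *)
Lemma shift_mass sigma (m : nat -> nat) a c : {homo m : x y / (x < y)%N} ->
  (forall k, 0 <= a k) -> (forall G, S sigma (img m G) -> mass a G <= c) ->
  forall G, S sigma (img (m \o succn) G) -> mass a G <= c *+ 2.
Proof.
move=> mm a0 ac G GS; have mW := ltnW_homo mm.
have c1 r : a r <= c.
  rewrite -(mass1 a r); apply: ac; apply: subsingleton_schreier => // x y.
  by move=> /imgP[v + ->] /imgP[w + ->]; rewrite !inE => /eqP -> /eqP ->.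
have c0 : 0 <= c by exact: le_trans (a0 0%N) (c1 0%N).
have [->|/fset_min[g gG gmin]] := eqVneq G fset0.
  by rewrite mass0 mulrn_wge0.
rewrite /mass (big_fsetD1 g) //= mulr2n lerD //.
(* p r is the predecessor of r in G, so that p r + 1 <= r. *)
apply: ac; pose p r := (\max_(x <- G | (x < r)%N) x)%N.
have pP r : r \in (G `\ g)%fset -> [/\ p r \in G, (p r < r)%N &
    forall x, x \in G -> (x < r)%N -> (x <= p r)%N].
  rewrite !inE => /andP[rg rG].
  have gr : (g < r)%N by rewrite ltn_neqAle eq_sym rg gmin.
  have le x : x \in G -> (x < r)%N -> (x <= p r)%N.
    by move=> xG xr; rewrite /p; apply: leq_bigmax_seq.
  suff [h1 h2] : p r \in G /\ (p r < r)%N by split.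
  have [x [xG xr ->]] : exists x, [/\ x \in G, (x < r)%N & p r = x]; last by [].
  have ex : exists x, (x \in G) && (x < r)%N by exists g; rewrite gG.
  have bd x : (x \in G) && (x < r)%N -> (x <= r)%N by move=> /andP[_ /ltnW].
  case: (ex_maxnP ex bd) => x /andP[xG xr] xmax; exists x; split=> //.
  apply/eqP; rewrite eqn_leq le // andbT.
  by apply/bigmax_leqP_seq => w wG wr; apply: xmax; rewrite wG.
apply: (@schreier_reindex _ _ wf _ hfs _ (m \o succn) m p G) GS.
- move=> x y xG yG xy /=; apply: mm; rewrite ltnS.
  have [px pxx _] := pP _ xG; have [_ _ h] := pP _ yG.
  apply: leq_trans pxx _; apply: h => //.
  by move: xG; rewrite !inE => /andP[].
- by move=> x y _ _; exact: mW.
- by move=> r /pP[h1 h2 _]; split=> //; exact: mW.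
Qed.

(* The estimate behind the upper bounds. A set E in S_xi is split into pieces
   of S_iota along S_zeta; a block y_r that meets no piece starting in its own
   interval is met by only one piece, which is small on y_r. *)
Lemma block_estimate iota zeta xi : ord_sum iota zeta xi ->
  exists u : nat -> nat, [/\ {homo u : x y / (x < y)%N}, forall v, (v <= u v)%N &
  forall (e : nat -> nat) (y : nat -> nat -> R) (delta : nat -> R),
    {homo e : x y / (x < y)%N} ->
    (forall r k, 0 <= y r k) -> (forall r, 0 <= delta r) ->
    (forall r k, y r k != 0 -> (e r <= k < e r.+1)%N) ->
    (forall r F v, S iota F -> v \in F -> (v < e r)%N -> mass (y r) F <= delta r) ->
  forall E, S xi E -> exists G, S zeta (img (u \o e \o succn) G) /\
    forall r, r \notin G -> mass (y r) E <= delta r].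
Proof.
move=> /(schreier_split wf hfs)[u [um uge hu]]; exists u; split=> //.
move=> e y delta em y0 d0 ysupp ytail E ES; have eW := ltnW_homo em.
have uW := ltnW_homo um.
have [pi [pim piE piS piZ]] := hu _ ES.
(* These are the points whose piece starts in their own interval. The minima of such pieces lie
   before the ends [e r.+1] of the intervals, which therefore form a spread of them: hence the shift
   by [succn]. *)
pose E' := [fset h in E | (e 0 <= h)%N && (e (blk e h) <= pi h)%N]%fset.
exists (img (blk e) E'); split.
  have [f hf] := img_inv (blk e) E'.
  have hfE r : r \in img (blk e) E' -> [/\ f r \in E, (e r <= pi (f r))%N,
      (pi (f r) <= f r)%N & (f r < e r.+1)%N].
    move=> /hf[]; rewrite !inE => /and3P[fE e0 ef] br; rewrite br in ef.
    have [_ pf _] := piE _ fE; split=> //.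
    by have /andP[_] := blk_between em e0; rewrite br.
  have [g hg] := img_inv (u \o e \o succn) (img (blk e) E').
  apply: schreier_spread piZ => //; exists (u \o pi \o f \o g); split.
    move=> a b aG bG ab /=; have [ga ea] := hg _ aG; have [gb eb] := hg _ bG.
    have [h1 h2 h3 h4] := hfE _ ga; have [h5 h6 h7 h8] := hfE _ gb.
    apply: um; apply: leq_ltn_trans h3 (leq_trans h4 (leq_trans _ h6)).
    apply: (eW); rewrite ltnNge; apply/negP => le.
    have : (u (e (g b).+1) <= u (e (g a).+1))%N by apply/uW/eW.
    by move: ea eb => /= -> ->; rewrite leqNgt ab.
  move=> a aG /=; have [ga ea] := hg _ aG; have [h1 h2 h3 h4] := hfE _ ga.
  split; first exact: (mem_img (u \o pi)).
  rewrite -{2}ea /=; apply: uW; exact: ltnW (leq_ltn_trans h3 h4).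
move=> r rG; pose Er := [fset h in E | (e r <= h < e r.+1)%N]%fset.
have -> : mass (y r) E = mass (y r) Er.
  by apply: mass_eq => k /ysupp h; rewrite !inE h andbT.
have [->|/fset0Pn[h0 h0E]] := eqVneq Er fset0; first by rewrite mass0.
have hEr h : h \in Er -> [/\ h \in E /\ (e r <= h)%N, pi h \in E, (pi h < e r)%N,
    (pi h <= h)%N & pi (pi h) = pi h].
  rewrite !inE => /andP[hE hr]; have [h1 h2 h3] := piE _ hE.
  split=> //; first by case/andP: hr.
  rewrite ltnNge; apply/negP => le; case/negP: rG; apply/imgP; exists h.
    rewrite !inE hE (blkE em hr) le andbT /=.
    by apply: leq_trans (eW 0%N r _) _ => //; case/andP: hr.
  by rewrite (blkE em hr).
have [[h0E' er0] p0E p0e p0h pp0] := hEr _ h0E.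
(* The pieces are successive, and those of h and h0 both start before e r, that is, before h and h0;
   so they coincide. *)
have sub : (Er `<=` fiber pi E (pi h0))%fset.
  apply/fsubsetP => h hE; have [[h1 er1] h2 h3 h4 h5] := hEr _ hE.
  rewrite in_fiber h1 /=; apply/eqP.
  have [lt|lt|//] := ltngtP (pi h) (pi h0).
    have := pim _ _ p0E h1 (ltnW (leq_trans p0e er1)).
    by rewrite pp0 leqNgt lt.
  have := pim _ _ h2 h0E' (ltnW (leq_trans h3 er0)).
  by rewrite h5 leqNgt lt.
apply: le_trans (mass_sub (y0 r) sub) _.
by apply: (ytail r _ (pi h0)) => //; rewrite in_fiber p0E pp0 eqxx.
Qed.

(* If zeta < rho, blocks y_i with small S_eta-norms, eta < iota, cannot dominate
   a subsequence of the basis of X_rho. *)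
Lemma upper_contrast iota zeta xi rho (j b : nat -> nat)
    (Q : nat -> (nat -> R) -> Prop) (C : R) :
  ord_sum iota zeta xi -> (zeta < rho)%O ->
  {homo j : x y / (x < y)%N} -> {homo b : x y / (x < y)%N} -> 0 <= C ->
  (forall i y, Q i y -> [/\ forall k, 0 <= y k,
     forall k, y k != 0 -> (b i <= k < b i.+1)%N & norm_le (S xi) y C]) ->
  (forall n, exists i y, (n <= i)%N /\ Q i y) ->
  (forall eta, (eta < iota)%O -> forall n eps, 0 < eps ->
    exists i y, [/\ (n <= i)%N, Q i y & norm_le (S eta) y eps]) ->
  forall eps, 0 < eps -> exists (i : nat -> nat) A a (y : nat -> nat -> R),
    [/\ {homo i : x y / (x < y)%N}, forall r, Q (i r) (y r), convex_on a A,
      S rho (img (j \o i) A) &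
      forall E, S xi E -> \sum_(r <- A) a r * mass (y r) E <= eps].
Proof.
move=> hx zr jm bm C0 hQ Qex Qeta eps eps0.
have [u [um uge hu]] := block_estimate hx.
(* The final bound is 2 eps' * C + eps': the first term comes from the blocks of G, by [shift_mass],
   and the second from the others. *)
pose eps' := eps / (2 * C + 1).
have eps'0 : 0 < eps' by rewrite divr_gt0 // ltr_wpDl // mulr_ge0.
(* Since the index of the block exceeds u N, [j (i r.+1)] dominates [u (e r.+1)], and the sets G of
   [block_estimate] can be read along j. *)
have /choice[p hp] : forall N, exists p : nat * (nat -> R), [/\ (u N + N <= p.1)%N,
    Q p.1 p.2 & forall F v, S iota F -> v \in F -> (v < N)%N -> mass p.2 F <= eps'].
  move=> N; have [z|[eta [K [ei hK]]]] := schreier_tail wf hfs iota N.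
    have [i [y [ni Qy]]] := Qex (u N + N)%N; exists (i, y); split=> // F v FS vF vN.
    have [y0 ysupp _] := hQ _ _ Qy.
    apply: le_trans (ltW eps'0); rewrite /mass big_seq big1 // => k kF.
    apply/eqP; apply/negPn/negP => /ysupp /andP[bk _].
    have := subsingleton_zero z FS vF kF => e.
    have := homo_ge bm i; lia.
  have epsK : 0 < eps' / K.+1%:R by rewrite divr_gt0.
  have [i [y [ni Qy yn]]] := Qeta _ ei (u N + N)%N _ epsK.
  exists (i, y); split=> //= F v FS vF vN.
  apply: le_trans (mass_le_chain yn (hK _ _ FS vF vN)) _.
  rewrite mulrCA ler_piMr ?(ltW eps'0) //.
  by rewrite ler_pdivrMr // mul1r ler_nat.
pose e r := iter r (fun N => b (p N).1.+1) 0%N.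
pose i r := (p (e r)).1; pose y r := (p (e r)).2.
have eS r : e r.+1 = b (i r).+1 by [].
have hi r : (u (e r) + e r <= i r)%N by have [] := hp (e r).
have eb r : (e r <= b (i r))%N.
  apply: leq_trans (homo_ge bm _); apply: leq_trans (hi r); exact: leq_addl.
have em : {homo e : x y / (x < y)%N}.
  apply: homo_ltn => [? ? ?|r]; first exact: ltn_trans.
  by rewrite eS; apply: leq_ltn_trans (eb r) _; exact: bm.
have im : {homo i : x y / (x < y)%N}.
  apply: homo_ltn => [? ? ?|r]; first exact: ltn_trans.
  apply: leq_trans (hi r.+1); apply: leq_trans (leq_addl _ _).
  by rewrite eS; exact: (homo_ge bm (i r).+1).
have yQ r : Q (i r) (y r) by have [] := hp (e r).
have mm : {homo (j \o i) : x y / (x < y)%N} by move=> x z /im/jm.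
have [A [a [_ [a0 aA a1] AS aG]]] := averages wf hfs zr mm 0%N eps'0.
exists i, A, a, y; split=> // E ES.
have [||||G [GS hG]] := hu e y (fun=> eps') em _ _ _ _ E ES.
- by move=> r; have [] := hQ _ _ (yQ r).
- by move=> r; exact: ltW.
- move=> r k; have [_ h _] := hQ _ _ (yQ r) => /h /andP[h1 h2].
  by rewrite eS h2 andbT; exact: leq_trans (eb r) h1.
- by move=> r F v; have [_ _] := hp (e r); exact.
have {}GS : S zeta (img (j \o i \o succn) G).
  apply: (@schreier_reindex _ _ wf _ hfs _ (u \o e \o succn) _ id G) GS.
  + by move=> x w _ _ xw; apply/um/em.
  + by move=> x w _ _ xw; apply: (ltnW_homo jm); apply: (ltnW_homo im).
  + move=> r rG; split=> //; apply: leq_trans (homo_ge jm _).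
    by apply: leq_trans (hi r.+1); exact: leq_addr.
have massG := shift_mass mm a0 aG GS.
apply: (@le_trans _ _ (\sum_(r <- A) (a r * (C *+ (r \in G)) + a r * eps'))).
  apply: ler_sum => r _; rewrite -mulrDr ler_wpM2l //.
  have [rG|rG] := boolP (r \in G).
    by have [_ _ h] := hQ _ _ (yQ r); rewrite mulr1n ler_wpDr ?(ltW eps'0) // h.
  by rewrite mulr0n add0r hG.
rewrite big_split /= -mulr_suml -/(mass a A) a1 mul1r.
have -> : \sum_(r <- A) a r * (C *+ (r \in G)) = mass a [fset r in A | r \in G]%fset * C.
  rewrite /mass big_fset /= mulr_suml [RHS]big_mkcond /=.
  by apply: eq_bigr => r _; case: (r \in G); rewrite ?mulr1n ?mulr0n ?mulr0.
have le : mass a [fset r in A | r \in G]%fset <= eps' *+ 2.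
  apply: le_trans (mass_sub a0 _) massG.
  by apply/fsubsetP => r; rewrite !inE => /andP[].
apply: (@le_trans _ _ (eps' *+ 2 * C + eps')); first by rewrite lerD2r ler_wpM2r.
rewrite -mulr_natr /eps' -mulrA -[X in _ + X]mulr1 -mulrDr.
by rewrite mulfVK // gt_eqF // ltr_wpDl // mulr_ge0.
Qed.

(* If rho < zeta, blocks with S_iota-norm at least delta are not dominated by
   a subsequence of the basis of X_rho. *)
Lemma lower_contrast iota zeta xi rho (j b : nat -> nat)
    (y : nat -> nat -> R) (delta : R) :
  ord_sum iota zeta xi -> (rho < zeta)%O ->
  {homo j : x y / (x < y)%N} -> {homo b : x y / (x < y)%N} ->
  (forall i k, 0 <= y i k) ->
  (forall n, exists i E, [/\ (n <= i)%N, S iota E,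
     forall k, k \in E -> (b i <= k < b i.+1)%N & delta <= mass (y i) E]) ->
  forall eps, 0 < eps -> exists (i : nat -> nat) A a H,
    [/\ {homo i : x y / (x < y)%N}, convex_on a A, S xi H,
      forall r, r \in A -> delta <= mass (y (i r)) H &
      forall G, S rho (img (j \o i) G) -> mass a G <= eps].
Proof.
move=> hx rz jm bm y0 /choice[I /choice[E_ hE]] eps eps0.
have [l hl] := union_closed_schreier wf hfs hx.
pose w := fix w r := if r is r'.+1 then (l (j (I (w r'))) + (I (w r')).+1)%N else 0%N.
pose i r := I (w r).
have iS r : (l (j (i r)) + (i r).+1 <= i r.+1)%N by have [] := hE (w r.+1).
have im : {homo i : x y / (x < y)%N}.
  apply: homo_ltn => [? ? ?|r]; first exact: ltn_trans.
  apply: leq_trans (iS r); exact: leq_addl.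
have mm : {homo (j \o i) : x y / (x < y)%N} by move=> x z /im/jm.
have eps2 : 0 < eps / 2 by rewrite divr_gt0.
have [A [a [_ [a0 aA a1] AS aG]]] := averages wf hfs rz mm 0%N eps2.
pose H := (\bigcup_(r <- A) E_ (w r.+1))%fset.
have HP k : reflect (exists2 r, r \in A & k \in E_ (w r.+1)) (k \in H).
  apply: (iffP (bigfcupP _ _ _ _)) => [[r /andP[rA _]]|[r rA]] kE; exists r => //.
  by rewrite rA.
pose e r := b (i r).
have em : {homo e : x y / (x < y)%N} by move=> x z /im/bm.
have bE r k : k \in E_ (w r.+1) -> blk e k = r.+1.
  have [_ _ h _] := hE (w r.+1) => /h /andP[h1 h2]; apply: blkE => //.
  rewrite /e h1 /=; apply: leq_trans h2 _.
  by apply: (ltnW_homo bm); exact: im.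
exists (i \o succn), A, a, H; split=> //.
- by move=> x z xz /=; apply: im.
- apply: (hl (fun k => j (i (blk e k).-1))).
  + move=> x z _ _ xz; apply/(ltnW_homo jm)/(ltnW_homo im).
    by have := blk_mono e xz; case: (blk e x); case: (blk e z).
  + apply: (schreier_sub wf hfs) AS; apply/fsubsetP => _ /imgP[k /HP[r rA kE] ->].
    by rewrite (bE _ _ kE); exact: (mem_img (j \o i)).
  + move=> v; have [->|/fset0Pn[k]] := eqVneq (fiber (fun k => j (i (blk e k).-1)) H v) fset0.
      exact: schreier0.
    rewrite in_fiber => /andP[/HP[r rA kE] /eqP ev].
    have [_ h _ _] := hE (w r.+1); apply: (schreier_sub wf hfs) h.
    apply/fsubsetP => k'; rewrite in_fiber => /andP[/HP[r' r'A k'E] /eqP].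
    rewrite -ev (bE _ _ kE) (bE _ _ k'E) /= => e'.
    suff -> : r = r' by [].
    by apply: (smono_inj (c := j \o i) (E := A)) => // x z _ _; exact: mm.
  + move=> k /HP[r rA kE]; rewrite (bE _ _ kE) /=.
    have [h1 _ h _] := hE (w r.+1); have /andP[h2 _] := h _ kE.
    apply: leq_trans h2; apply: leq_trans (homo_ge bm _).
    by apply: leq_trans h1; exact: leq_addr.
- move=> r rA; have [_ _ _ h] := hE (w r.+1); apply: le_trans h _.
  apply: mass_sub => //; apply/fsubsetP => k kE; apply/HP; exists r => //.
- move=> G GS; rewrite (splitr eps) -mulr2n.
  exact: (@shift_mass rho (j \o i)).
Qed.

End block_sequences.

(** * Blocks in the dual *)

Section dual_blocks.
Variable R : realType.
Variables (d : Order.disp_t) (Omega : orderType d).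
Hypothesis wf : well_founded (fun eta xi : Omega => (eta < xi)%O).
Variable fs : Omega -> nat -> Omega.
Hypothesis hfs : schreier_sequences fs.
Implicit Types (sigma tau iota zeta xi eta : Omega) (y q a b : nat -> R).
Implicit Types (E F G A H B : {fset nat}) (eps delta c K t : R) (r v n h k m : nat).

Local Notation S := (schreier fs).

Definition pairing B b y : R := \sum_(k <- B) b k * y k.

Lemma pairingZ B b q t : pairing B b (fun k => t * q k) = t * pairing B b q.
Proof. by rewrite /pairing mulr_sumr; apply: eq_bigr => k _; rewrite mulrCA. Qed.

Lemma massZ q t E : mass (fun k => t * q k) E = t * mass q E.
Proof. by rewrite /mass mulr_sumr. Qed.

(* Dually: b is the sum of a functional of norm at most eps on X_xi and of one
   of norm at most K on X_eta. *)
Definition splits xi eta B b eps K : Prop := forall q c1 c2,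
  (forall k, 0 <= q k) -> norm_le (S xi) q c1 -> norm_le (S eta) q c2 ->
  pairing B b q <= eps * c1 + K * c2.

Definition cutoff E y : nat -> R := fun k => if k \in E then y k else 0.

Lemma cutoff_ge0 E y : (forall k, 0 <= y k) -> forall k, 0 <= cutoff E y k.
Proof. by move=> y0 k; rewrite /cutoff; case: ifP. Qed.

Lemma mass_cutoff E F y : mass (cutoff E y) F = mass y [fset k in F | k \in E]%fset.
Proof. by rewrite /mass big_fset /= [RHS]big_mkcond. Qed.

Lemma mass_cutoff_le E F y : (forall k, 0 <= y k) -> mass (cutoff E y) F <= mass y F.
Proof.
move=> y0; rewrite mass_cutoff; apply: mass_sub => //.
by apply/fsubsetP => k; rewrite !inE => /andP[].
Qed.

Lemma mass_cutoff_le2 E F y : (forall k, 0 <= y k) -> mass (cutoff E y) F <= mass y E.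
Proof.
move=> y0; rewrite mass_cutoff; apply: mass_sub => //.
by apply/fsubsetP => k; rewrite !inE => /andP[].
Qed.

Lemma mass_setU y E F : (forall k, k \in E -> k \notin F) ->
  mass y (E `|` F)%fset = mass y E + mass y F.
Proof.
move=> dis; rewrite /mass (big_fsetID _ (mem E) (E `|` F)%fset) /=.
congr (_ + _); apply: eq_fbigl => k; rewrite !inE.
  by case: (k \in E); rewrite ?andbF.
by case: (boolP (k \in E)) => [kE|] //=; rewrite ?(negbTE (dis _ kE)) // andbT.
Qed.

Lemma rfold0 P n : P fset0 -> rfold P n fset0.
Proof. by move=> P0; elim: n => //= n IH; exists fset0, fset0; rewrite fsetU0. Qed.

Lemma rfold_mon P n n' E : P fset0 -> (n <= n')%N -> rfold P n E -> rfold P n' E.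
Proof.
move=> P0 nn' h; rewrite -(subnK nn'); elim: (n' - n)%N => //= l IH.
by exists E, fset0; rewrite fsetU0.
Qed.

(* H is a union of as many sets of S_eta of mass delta * t as possible; their
   number is bounded, since their union is in S_xi. *)
Lemma remove_large xi eta N L delta t y : 0 < delta -> 0 < t -> 1 < N%:R * delta ->
  (forall k, 0 <= y k) -> (forall k, y k != 0 -> (L <= k)%N) ->
  norm_le (S xi) y t ->
  (forall H, rfold (S eta) N H -> (forall k, k \in H -> (L <= k)%N) -> S xi H) ->
  exists H, [/\ rfold (S eta) N H, forall k, k \in H -> (L <= k)%N &
    forall E, S eta E -> mass y [fset k in E | k \notin H]%fset <= delta * t].
Proof.
move=> d0 t0 Nd y0 yL yt far.
pose P n := exists H, [/\ rfold (S eta) n H, forall k, k \in H -> (L <= k)%N &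
  n%:R * delta * t <= mass y H].
have P0 : P 0%N by exists fset0; split=> //; rewrite !mul0r mass0.
have nPN : ~ P N.
  move=> [H [h1 h2 h3]]; have := yt _ (far _ h1 h2).
  by move/(le_trans h3); rewrite ger_pMl // leNgt Nd.
have [n [nN [H [h1 h2 h3]] nP]] : exists n, [/\ (n < N)%N, P n & ~ P n.+1].
  apply: contrapT => nex; have Pn : forall n, (n <= N)%N -> P n.
    elim=> // n IH nN; apply: contrapT => nP; apply: nex; exists n; split=> //.
    by apply: IH; exact: ltnW.
  exact: nPN (Pn _ (leqnn N)).
exists H; split=> //; first exact: rfold_mon (schreier0 _ _) (ltnW nN) h1.
move=> E ES; rewrite leNgt; apply/negP => lt; apply: nP.
pose E' := [fset k in E | (k \notin H) && (L <= k)%N]%fset.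
exists (H `|` E')%fset; split.
- exists H, E'; split=> //; apply: (schreier_sub wf hfs) ES.
  by apply/fsubsetP => k; rewrite !inE => /andP[].
- by move=> k; rewrite !inE => /orP[/h2//|/and3P[]].
- rewrite mass_setU => [|k kH]; last by rewrite !inE kH andbF.
  rewrite -natr1 mulrDl mul1r mulrDl lerD //.
  rewrite (@mass_eq _ _ E' [fset k in E | k \notin H]%fset) ?ltW //.
  by move=> k /yL h; rewrite !inE h andbT.
Qed.

Definition scale m : R := 2^-1 ^+ m.
(* The precision needed at level m of [peel]. *)
Definition level_eps m : R := scale m * scale m / 32.

Lemma scale_gt0 m : 0 < scale m. Proof. by rewrite exprn_gt0. Qed.
Lemma scale_le1 m : scale m <= 1.
Proof. by apply: exprn_ile1; rewrite ?invr_ge0 // invf_le1 // ler1n. Qed.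
Lemma scaleS m : scale m = 2 * scale m.+1.
Proof. by rewrite /scale exprS mulVKf. Qed.
Lemma level_eps_gt0 m : 0 < level_eps m.
Proof. by rewrite divr_gt0 // mulr_gt0 // scale_gt0. Qed.

Lemma scale_sum n : \sum_(m < n) scale m <= 2.
Proof.
suff : \sum_(m < n) scale m <= 2 - 2 * scale n.
  by move=> h; apply: le_trans h _; rewrite gerBl mulr_ge0 // ltW // scale_gt0.
elim: n => [|n IH]; first by rewrite big_ord0 /scale expr0; lra.
by rewrite big_ord_recr /=; have := scaleS n; lra.
Qed.

Lemma pairing_cutoff B b y E :
  pairing B b y = pairing B b (cutoff E y) + pairing B b (cutoff (B `\` E)%fset y).
Proof.
rewrite /pairing -big_split /= big_seq [RHS]big_seq; apply: eq_bigr => k kB.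
by rewrite /cutoff inE kB andbT; case: (k \in E); rewrite /= ?mulr0 ?addr0 ?add0r.
Qed.

Section peeling.
Variables (xi : Omega) (eta : nat -> Omega) (K : nat -> R) (N : nat -> nat).
Variables (B : {fset nat}) (b : nat -> R) (r0 L : nat).
Hypothesis K0 : forall m, 0 < K m.
Hypothesis hN : forall m, 1 < (N m)%:R * (level_eps m / K m).
Hypothesis hsplit : forall m, (m <= r0)%N -> splits xi (eta m) B b (level_eps m) (K m).
Hypothesis bxi : forall q c, (forall k, 0 <= q k) -> norm_le (S xi) q c ->
  pairing B b q <= c.
Hypothesis far : forall m, (m <= r0)%N -> forall H, rfold (S (eta m)) (N m) H ->
  (forall k, k \in H -> (L <= k)%N) -> S xi H.

(** H comes from [remove_large]. Outside H, y has S_eta-norm at most level_eps m / K m * t, so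
    [splits] bounds the pairing there by 2 * level_eps m * t; by assumption this is at most the
    fraction scale m / 4 of the whole. *)
Lemma peel_step m y t : (m <= r0)%N -> (forall k, 0 <= y k) ->
  (forall k, y k != 0 -> (L <= k)%N) -> 0 < t -> norm_le (S xi) y t ->
  2 * level_eps m * t <= scale m / 4 * pairing B b y ->
  exists H, [/\ rfold (S (eta m)) (N m) H, forall k, k \in H -> (L <= k)%N,
    (1 - scale m / 4) * pairing B b y <= pairing B b (cutoff H y) &
    norm_le (S xi) (cutoff H y) (mass y H)].
Proof.
move=> mr y0 yL t0 yt hy.
have d0 : 0 < level_eps m / K m by rewrite divr_gt0 // level_eps_gt0.
have [H [h1 h2 h3]] := remove_large d0 t0 (hN m) y0 yL yt (far mr).
exists H; split=> //; last by move=> E _; exact: mass_cutoff_le2.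
have q0 := cutoff_ge0 (B `\` H)%fset y0.
have : pairing B b (cutoff (B `\` H)%fset y) <= level_eps m * t + K m * (level_eps m / K m * t).
  apply: hsplit => //.
    by move=> E ES; apply: le_trans (mass_cutoff_le _ _ y0) _; exact: yt.
  move=> E ES; rewrite mass_cutoff; apply: le_trans (h3 _ ES).
  by apply: mass_sub => //; apply/fsubsetP => k; rewrite !inE => /andP[-> /andP[->]].
have -> : K m * (level_eps m / K m * t) = level_eps m * t.
  by rewrite mulrA mulrCA divff ?mulr1 // gt_eqF.
by have := pairing_cutoff B b y H; move: hy; lra.
Qed.

(* The gain [scale m'] is what makes the sum over m' converge in [upper_dual].
   It comes from the induction on m: if the part of y on the sets removed at
   level m has a small norm, the statement for m - 1 applies to this part, and
   otherwise b y is at most a multiple of [scale m] times its mass. *)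
Lemma peel m y t : (m <= r0)%N -> (forall k, 0 <= y k) ->
  (forall k, y k != 0 -> (L <= k)%N) -> 0 < t -> norm_le (S xi) y t ->
  2 * level_eps m * t <= scale m / 4 * pairing B b y ->
  exists m' H, [/\ (m' <= m)%N, rfold (S (eta m')) (N m') H,
    forall k, k \in H -> (L <= k)%N &
    pairing B b y <= (2 - scale m) * (2 * scale m' * mass y H)].
Proof.
elim: m y t => [|m IH] y t mr y0 yL t0 yt hy.
  have [H [h1 h2 h3 h4]] := peel_step mr y0 yL t0 yt hy.
  exists 0%N, H; split=> //; have := bxi (cutoff_ge0 H y0) h4.
  have := mass_ge0 H y0; move: h3; rewrite /scale expr0; lra.
have [H [h1 h2 h3 h4]] := peel_step mr y0 yL t0 yt hy.
have p0 := cutoff_ge0 H y0; have bp := bxi p0 h4.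
have s0 := scale_gt0 m.+1; have s1 := scale_le1 m.+1; have sS := scaleS m.
(* In the first case the part of y on H satisfies the assumptions of level m. With s = scale m.+1,
   the factor 1 - s / 4 lost in [h3] is absorbed by the passage from 2 - 2 s to 2 - s. *)
have [[t0' hp]|nh] := pselect (0 < mass y H /\
    2 * level_eps m * mass y H <= scale m / 4 * pairing B b (cutoff H y)).
  have pL k : cutoff H y k != 0 -> (L <= k)%N.
    by rewrite /cutoff; case: ifP => // [_ /yL//|_ /eqP].
  have [m' [H' [mm' h1' h2' h3']]] := IH _ _ (ltnW mr) p0 pL t0' h4 hp.
  exists m', H'; split=> //; first exact: leqW.
  set w := 2 * scale m'; have w0 : 0 <= w by rewrite mulr_ge0 // ltW // scale_gt0.
  have lem : w * mass (cutoff H y) H' <= w * mass y H'.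
    by rewrite ler_wpM2l // mass_cutoff_le.
  have : 0 <= w * mass y H' by rewrite mulr_ge0 // mass_ge0.
  move: h3 h3' lem; rewrite sS -/w.
  move: (w * mass y H') (w * mass _ _) (pairing _ _ _) (pairing _ _ _) => Y Z p q.
  move: (scale _) s0 s1 => {}s s0 s1 h3 h3' lem Y0.
  rewrite -(@ler_pM2l _ (1 - s / 4)); last lra.
  apply: le_trans h3 (le_trans h3' _).
  apply: (@le_trans _ _ ((2 - 2 * s) * Y)); first by rewrite ler_wpM2l //; lra.
  rewrite mulrA ler_wpM2r //; nra.
exists m.+1, H; split=> //.
have M0 := mass_ge0 H y0.
have le : pairing B b (cutoff H y) <= scale m / 4 * mass y H.
  have [M0'|] := ltP 0 (mass y H); last first.
    move=> M0'; have M00 : mass y H = 0 by apply: le_anti; rewrite M0 M0'.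
    by move: bp; rewrite M00 mulr0.
  rewrite leNgt; apply/negP => lt; apply: nh; split=> //.
  (* The factor 1 / 32 in [level_eps] makes 2 * level_eps m the square of scale m / 4. *)
  apply: (@le_trans _ _ (scale m / 4 * (scale m / 4 * mass y H))).
    by rewrite le_eqVlt; apply/orP; left; apply/eqP; rewrite /level_eps; field.
  by rewrite ler_wpM2l ?(ltW lt) // divr_ge0 // ltW // scale_gt0.
move: h3 le; rewrite sS.
move: (scale m.+1) s0 s1 (mass y H) M0 (pairing _ _ _) (pairing _ _ _) => s s0 s1 M M0 p q h3 le.
have sM : 0 <= s * M by rewrite mulr_ge0 // ltW.
have rhs : s * M <= (2 - s) * (2 * s * M) by nra.
have [q0|q0] := leP q 0; first by apply: le_trans q0 (le_trans sM rhs).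
have q_le : 3 / 4 * q <= p by nra.
apply: le_trans rhs; lra.
Qed.

End peeling.
End dual_blocks.

(** * Bounded sums of dual blocks *)

Section dual_estimates.
Variable R : realType.
Variables (d : Order.disp_t) (Omega : orderType d).
Hypothesis wf : well_founded (fun eta xi : Omega => (eta < xi)%O).
Variable fs : Omega -> nat -> Omega.
Hypothesis hfs : schreier_sequences fs.
Implicit Types (sigma tau iota zeta xi eta rho : Omega) (y q : nat -> R).
Implicit Types (E F G A H : {fset nat}) (eps delta c t : R) (r v n h m : nat).

Local Notation S := (schreier fs).
Local Notation scale := (@scale R).
Local Notation level_eps := (@level_eps R).

Lemma mass_const_chain (a : nat -> R) (A : {fset nat}) (c : nat -> nat) (w : nat -> R) :
  (forall m, mass a (fiber c A m) <= w m) ->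
  exists n, mass a A <= \sum_(m < n) w m.
Proof.
move=> h; exists (\max_(r <- A) (c r).+1)%N.
rewrite (@mass_chain _ a c (\max_(r <- A) (c r).+1)%N) => [|x xA].
  by apply: ler_sum => m _; exact: h.
exact: (@leq_bigmax_seq nat (enum_fset A) xpredT (fun r => (c r).+1) x xA isT).
Qed.

Lemma mass_scale A : mass scale A <= 2.
Proof.
have [|n le] := @mass_const_chain scale A id scale; last exact: le_trans le (scale_sum R n).
move=> m; rewrite -[leRHS](mass1 scale m); apply: mass_sub.
  by move=> k; rewrite ltW // scale_gt0.
by apply/fsubsetP => x; rewrite in_fiber inE => /andP[].
Qed.

Section upper_dual.
Variables (xi sigma : Omega) (eta : nat -> Omega) (K : nat -> R) (N : nat -> nat).
Variables (B : nat -> {fset nat}) (b : nat -> nat -> R) (e k : nat -> nat).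
Variable (l : nat -> nat -> nat).
Hypothesis em : {homo e : x y / (x < y)%N}.
Hypothesis km : {homo k : x y / (x < y)%N}.
Hypothesis K0 : forall m, 0 < K m.
Hypothesis hN : forall m, 1 < (N m)%:R * (level_eps m / K m).
Hypothesis Be : forall r x, x \in B r -> (e r <= x < e r.+1)%N.
Hypothesis hsplit : forall r m, (m <= r)%N ->
  splits fs xi (eta m) (B r) (b r) (level_eps m) (K m).
Hypothesis bxi : forall r q c, (forall j, 0 <= q j) -> norm_le (S xi) q c ->
  pairing (B r) (b r) q <= c.
Hypothesis hl : forall m (g : nat -> nat) H, mono_on g H -> S sigma (img g H) ->
  (forall v, rfold (S (eta m)) (N m) (fiber g H v)) ->
  (forall h, h \in H -> (l m (g h) <= h)%N) -> S xi H.
Hypothesis lk : forall r m, (m <= r)%N -> (l m (k r) <= e r)%N.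

(** Each block r of A is charged to a set of some level m <= r. At a fixed level these sets unite to
    a set of S_xi, on which y has mass at most 1, and the weights scale m are summable. The bound is
    2 + 4 * 2, where the first 2 accounts for pairings too small for [peel]. *)
Lemma upper_dual A y : S sigma (img k A) -> (forall j, 0 <= y j) ->
  norm_le (S xi) y 1 -> \sum_(r <- A) pairing (B r) (b r) y <= 10.
Proof.
move=> AS y0 y1; have fold0 m : rfold (S (eta m)) (N m) fset0.
  by apply: rfold0; exact: schreier0.
have fold_sub m : hereditary (rfold (S (eta m)) (N m)) by exact: rfold_sub.
have one r : exists p : nat * {fset nat}, [/\ rfold (S (eta p.1)) (N p.1) p.2,
    (p.1 <= r)%N, forall x, x \in p.2 -> (e r <= x < e r.+1)%N &
    pairing (B r) (b r) y <= scale r + 4 * scale p.1 * mass y p.2].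
  pose z := cutoff (B r) y; have z0 := cutoff_ge0 (B r) y0.
  have z1 : norm_le (S xi) z 1 by move=> E ES; apply: le_trans (mass_cutoff_le _ _ y0) (y1 _ ES).
  have zL j : z j != 0 -> (e r <= j < e r.+1)%N.
    by rewrite /z /cutoff; case: ifP => [/Be//|]; rewrite eqxx.
  have -> : pairing (B r) (b r) y = pairing (B r) (b r) z.
    by rewrite /pairing big_seq [RHS]big_seq; apply: eq_bigr => j jB; rewrite /z /cutoff jB.
  have [hp|hp] := leP (2 * level_eps r * 1) (scale r / 4 * pairing (B r) (b r) z); last first.
    exists (0%N, fset0); split=> //; rewrite mass0 mulr0 addr0.
    move: hp; rewrite /level_eps => hp.
    have s0 := scale_gt0 R r; rewrite -(ler_pM2l (divr_gt0 s0 (ltr0n _ 4))).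
    by apply: ltW (lt_le_trans hp _); have := mulr_gt0 s0 s0; lra.
  have far m : (m <= r)%N -> forall H, rfold (S (eta m)) (N m) H ->
      (forall x, x \in H -> (e r <= x)%N) -> S xi H.
    move=> mr H HR He; apply: (hl (m := m) (g := fun=> k r)) => //.
    - apply: subsingleton_schreier => // u v /imgP[? _ ->] /imgP[? _ ->] //.
    - move=> v; apply: fold_sub HR; apply/fsubsetP => x.
      by rewrite in_fiber => /andP[].
    - by move=> h /He; apply: leq_trans; exact: lk.
  have [m [H [h1 h2 h3 h4]]] := peel wf hfs K0 hN (@hsplit r) (@bxi r) far
    (leqnn r) z0 (fun j zj => proj1 (andP (zL j zj))) ltr01 z1 hp.
  exists (m, [fset x in H | (e r <= x < e r.+1)%N]%fset); split=> //=.
  - by apply: fold_sub h2; apply/fsubsetP => x; rewrite !inE => /andP[].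
  - by move=> x; rewrite !inE => /andP[].
  have zH : mass z H <= mass y [fset x in H | (e r <= x < e r.+1)%N]%fset.
    rewrite (@mass_eq _ z H [fset x in H | (e r <= x < e r.+1)%N]%fset).
      exact: mass_cutoff_le.
    by move=> j /zL zj; rewrite !inE zj andbT.
  have s0 := scale_gt0 R r; have := scale_gt0 R m; move: h4 zH.
  have := mass_ge0 H z0.
  move: (pairing _ _ _) (mass z _) (mass y _) (scale _) (scale _) s0.
  move=> P Z Y s s' s0 Z0 hP ZY s'0.
  have : s' * Z <= s' * Y by rewrite ler_wpM2l // ltW.
  have : 0 <= s' * Z by rewrite mulr_ge0 // ltW.
  nra.
have /choice[p hp] := one.
pose w r : R := scale (p r).1 * mass y (p r).2.
apply: (@le_trans _ _ (mass scale A + 4 * mass w A)).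
  rewrite /mass mulr_sumr -big_split /=; apply: ler_sum => r _.
  by have [_ _ _] := hp r; rewrite mulrA.
have [|n le] := @mass_const_chain w A (fun r => (p r).1) scale.
  move=> m; pose A' := fiber (fun r => (p r).1) A m.
  have -> : mass w A' = scale m * \sum_(r <- A') mass y (p r).2.
    rewrite /mass mulr_sumr big_seq [RHS]big_seq; apply: eq_bigr => r.
    by rewrite in_fiber /w => /andP[_ /eqP ->].
  rewrite -[leRHS]mulr1 ler_wpM2l ?(ltW (scale_gt0 _ _)) //.
  pose U := (\bigcup_(r <- A') (p r).2)%fset.
  have UP x : reflect (exists2 r, r \in A' & x \in (p r).2) (x \in U).
    apply: (iffP (bigfcupP _ _ _ _)) => [[r /andP[rA _]]|[r rA]] xE; exists r => //.
    by rewrite rA.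
  have bU r x : x \in (p r).2 -> blk e x = r.
    by have [_ _ h _] := hp r => /h; exact: blkE.
  have -> : \sum_(r <- A') mass y (p r).2 = mass y U.
    rewrite /mass partition_disjoint_bigfcup // => i j _ _ ij.
    apply/fdisjointP => x /bU xi'; apply/negP => /bU xj.
    by move: ij; rewrite -xi' -xj eqxx.
  apply: y1; apply: (hl (m := m) (g := k \o blk e)).
  - by move=> a c _ _ ac; apply: (ltnW_homo km); exact: blk_mono.
  - apply: (schreier_sub wf hfs) AS; apply/fsubsetP => _ /imgP[x /UP[r rA xr] ->].
    by rewrite /= (bU _ _ xr) mem_img //; move: rA; rewrite in_fiber => /andP[].
  - move=> v; have [->|/fset0Pn[x]] := eqVneq (fiber (k \o blk e) U v) fset0; first exact: fold0.
    rewrite in_fiber => /andP[/UP[r rA xr] /eqP ev].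
    have [h1 _ _ _] := hp r.
    have em' : (p r).1 = m by move: rA; rewrite in_fiber => /andP[_ /eqP].
    rewrite em' in h1; apply: fold_sub h1; apply/fsubsetP => x'.
    rewrite in_fiber => /andP[/UP[r' r'A x'r'] /eqP].
    rewrite -ev /= (bU _ _ xr) (bU _ _ x'r') => e'.
    suff -> : r = r' by [].
    by apply: (smono_inj (c := k) (E := A')) => // a c _ _; exact: km.
  - move=> x /UP[r rA xr]; rewrite /= (bU _ _ xr).
    have [_ h1 h2 _] := hp r; have /andP[h3 _] := h2 _ xr.
    apply: leq_trans h3; apply: lk.
    by move: rA h1; rewrite in_fiber => /andP[_ /eqP ->].
have := mass_scale A; have := scale_sum R n; lra.
Qed.

End upper_dual.
End dual_estimates.

Section dual_contrast.
Variable R : realType.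
Variables (d : Order.disp_t) (Omega : orderType d).
Hypothesis wf : well_founded (fun eta xi : Omega => (eta < xi)%O).
Variable fs : Omega -> nat -> Omega.
Hypothesis hfs : schreier_sequences fs.
Implicit Types (sigma tau iota zeta eta : Omega) (y q : nat -> R).
Implicit Types (E F G A H : {fset nat}) (eps delta c t : R) (r v n h m : nat).

Local Notation S := (schreier fs).
Local Notation level_eps := (@level_eps R).

Variables (xi rho : Omega) (j bd : nat -> nat) (B : nat -> {fset nat}).
Variables (b : nat -> nat -> R) (C : R).
Hypothesis C0 : 0 <= C.
Hypothesis jm : {homo j : x y / (x < y)%N}.
Hypothesis bm : {homo bd : x y / (x < y)%N}.
Hypothesis Bbd : forall i (x : nat), x \in B i -> (bd i <= x < bd i.+1)%N.
Hypothesis b0 : forall i k, 0 <= b i k.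
Hypothesis bxi : forall i q c, (forall k, 0 <= q k) -> norm_le (S xi) q c ->
  pairing (B i) (b i) q <= c.
Hypothesis hit : forall i, exists q, [/\ forall k, 0 <= q k, norm_le (S xi) q 2 &
  1 <= pairing (B i) (b i) q].
Hypothesis dominated : forall (i : nat -> nat) A q c, {homo i : x y / (x < y)%N} ->
  S rho (img (j \o i) A) -> (forall k, 0 <= q k) -> norm_le (S xi) q c ->
  \sum_(r <- A) pairing (B (i r)) (b (i r)) q <= C * c.
Hypothesis nrem : ~ remainders xi rho.

Local Notation infinitely M := (forall n, exists i, (n <= i)%N /\ M i).

Lemma pairing_cutoff_supp i q :
  pairing (B i) (b i) (cutoff (B i) q) = pairing (B i) (b i) q.
Proof.
rewrite /pairing big_seq [RHS]big_seq; apply: eq_bigr => k kB.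
by rewrite /cutoff kB.
Qed.

(* Otherwise vectors y_i with b_i y_i = 1 and small S_eta-norms for all
   eta < iota would contradict [dominated]. *)
Lemma splits_often iota zeta eps (M : nat -> Prop) :
  ord_sum iota zeta xi -> (zeta < rho)%O -> 0 < eps -> eps <= 1 / 2 ->
  infinitely M -> exists eta K, [/\ (eta < iota)%O, 0 < K &
    infinitely (fun i => M i /\ splits fs xi eta (B i) (b i) eps K)].
Proof.
move=> hx zr eps0 eps2 Minf; apply: contrapT => nex.
have nsplit eta K : (eta < iota)%O -> 0 < K -> exists n, forall i, (n <= i)%N ->
    M i -> ~ splits fs xi eta (B i) (b i) eps K.
  move=> ei K0; apply: contrapT => nn; apply: nex; exists eta, K; split=> // n.
  apply: contrapT => ni; apply: nn; exists n => i ni' Mi sp.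
  by apply: ni; exists i.
pose Q i y := M i /\ [/\ forall k, 0 <= y k,
  forall k, y k != 0 -> (bd i <= k < bd i.+1)%N, norm_le (S xi) y eps^-1 &
  1 <= pairing (B i) (b i) y].
have cutB i q k : cutoff (B i) q k != 0 -> (bd i <= k < bd i.+1)%N.
  by rewrite /cutoff; case: ifP => [/Bbd|]; rewrite ?eqxx.
have eps'0 : 0 < 1 / (2 * (C + 1)).
  by rewrite divr_gt0 // mulr_gt0 // ltr_wpDl.
have [||n|eta ei n eps' eps'0'|i [A [a [y [im yQ [a0 aA a1] AS ya]]]]] :=
    @upper_contrast R _ _ wf fs hfs iota zeta xi rho j bd Q eps^-1 hx zr jm bm _ _ _ _ _ eps'0.
- by rewrite invr_ge0 ltW.
- by move=> i y [_ []].
- have [i [ni Mi]] := Minf n; have [q [q0 q2 hq]] := hit i.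
  exists i, (cutoff (B i) q); split=> //; split=> //; split.
  + exact: cutoff_ge0.
  + exact: cutB.
  + move=> E ES; apply: le_trans (mass_cutoff_le _ _ q0) (le_trans (q2 _ ES) _).
    by rewrite -[leLHS]invrK lef_pV2 ?posrE ?invr_gt0 // -div1r.
  + by rewrite pairing_cutoff_supp.
(* A failure of [splits] with K = 1 / eps' gives a vector with pairing t > eps c1 + c2 / eps'. After
   division by t, its S_xi-norm is at most 1 / eps and its S_eta-norm at most eps'. *)
- have [n' hn'] := nsplit eta eps'^-1 ei (etrans (invr_gt0 _) eps'0').
  have [i [ni Mi]] := Minf (maxn n n').
  have := hn' _ (leq_trans (leq_maxr _ _) ni) Mi.
  move=> /existsNP[q /existsNP[c1 /existsNP[c2 /not_implyP[q0 /not_implyP[q1 /not_implyP[q2 /negP]]]]]].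
  rewrite -ltNge; set t := pairing _ _ _ => lt.
  have c1_0 : 0 <= c1 by have := q1 _ (schreier0 _ _); rewrite mass0.
  have c2_0 : 0 <= c2 by have := q2 _ (schreier0 _ _); rewrite mass0.
  have h1 : 0 <= eps * c1 by rewrite mulr_ge0 // ltW.
  have h2 : 0 <= eps'^-1 * c2 by rewrite mulr_ge0 // invr_ge0 ltW.
  have t0 : 0 < t by lra.
  have ti0 : 0 <= t^-1 by rewrite invr_ge0 ltW.
  exists i, (fun k => t^-1 * cutoff (B i) q k); split.
  + exact: leq_trans (leq_maxl _ _) ni.
  + split=> //; split.
    * by move=> k; rewrite mulr_ge0 //; exact: cutoff_ge0.
    * by move=> k; rewrite mulf_eq0 negb_or => /andP[_ /cutB].
    * move=> E ES; rewrite massZ mulrC ler_pdivrMr // -ler_pdivrMl ?invr_gt0 // invrK.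
      apply: (@le_trans _ _ (eps * c1)); last by lra.
      by rewrite ler_pM2l //; apply: le_trans (mass_cutoff_le _ _ q0) (q1 _ ES).
    * by rewrite pairingZ pairing_cutoff_supp mulVf // gt_eqF.
  + move=> E ES; rewrite massZ mulrC ler_pdivrMr // -ler_pdivrMl //.
    apply: (@le_trans _ _ (eps'^-1 * c2)); last by lra.
    by rewrite ler_pM2l ?invr_gt0 //; apply: le_trans (mass_cutoff_le _ _ q0) (q2 _ ES).
(* The norm of Y is at most 1 / (2 (C + 1)), while its pairings with the blocks sum to at least 1,
   which contradicts [dominated]. *)
pose Y k := \sum_(r <- A) a r * y r k.
have yP r : [/\ forall k, 0 <= y r k, norm_le (S xi) (y r) eps^-1 &
    1 <= pairing (B (i r)) (b (i r)) (y r)].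
  by have [_ []] := yQ r.
have Y0 k : 0 <= Y k by rewrite sumr_ge0 // => r _; rewrite mulr_ge0 //; have [] := yP r.
have Yn : norm_le (S xi) Y (1 / (2 * (C + 1))).
  move=> E ES; apply: le_trans (ya _ ES); rewrite /mass /Y exchange_big /=.
  by apply: ler_sum => r _; rewrite mulr_sumr.
have := dominated im AS Y0 Yn.
have : 1 <= \sum_(r <- A) pairing (B (i r)) (b (i r)) Y.
  rewrite -a1 /mass big_seq [leRHS]big_seq; apply: ler_sum => r rA.
  apply: (@le_trans _ _ (pairing (B (i r)) (b (i r)) (fun k => a r * y r k))).
    by rewrite pairingZ ler_peMr //; have [] := yP r.
  apply: ler_sum => k _; rewrite ler_wpM2l // /Y (big_fsetD1 r) //= lerDl.
  by apply: sumr_ge0 => r' _; rewrite mulr_ge0 //; have [] := yP r'.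
move=> le1 /(le_trans le1); rewrite mul1r ler_pdivlMr ?mulr_gt0 ?ltr_wpDl //.
by move=> h; move: C0 h; lra.
Qed.

(** In the dual of X_rho, the sum of the corresponding coordinate functionals takes the value 1 at
    the vector with coefficients a, of norm at most eps; so its norm is at least 1 / eps, whereas
    the same sum of blocks has norm at most 10. *)
Lemma dual_contrast eps : 0 < eps -> exists (i : nat -> nat) A a,
  [/\ {homo i : x y / (x < y)%N}, convex_on a A,
    forall G, S rho (img (j \o i) G) -> mass a G <= eps &
    forall y, (forall k, 0 <= y k) -> norm_le (S xi) y 1 ->
      \sum_(r <- A) pairing (B (i r)) (b (i r)) y <= 10].
Proof.
move=> eps0.
have nz : ~ is_zero rho.
  by move=> z; apply: nrem; exists xi => //; exact: ord_sum_zero.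
(* For eta < iota, minimality gives xi - eta >= rho, and equality is excluded by [nrem]. *)
have [iota [ix [zeta zr hx]] imin] : exists2 iota, (iota <= xi)%O /\
    (exists2 zeta, (zeta < rho)%O & ord_sum iota zeta xi) & forall eta, (eta < iota)%O ->
    forall zeta, ord_sum eta zeta xi -> (rho < zeta)%O.
  have [|iota hi imin] := @ord_min _ _ wf [set iota | (iota <= xi)%O /\
      exists2 zeta, (zeta < rho)%O & ord_sum iota zeta xi].
    have [z zz _] := zero_exists wf rho; exists xi; split => //; exists z.
      exact: zero_min.
    exact: ord_sum_zero.
  exists iota => // eta ei zeta hz; have ex : (eta <= xi)%O by case: hi => /(lt_le_trans ei)/ltW.
  have [lt|gt|e] := ltgtP zeta rho => //.
    have : (iota <= eta)%O by apply: imin; split=> //; exists zeta.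
    by rewrite leNgt ei.
  by case: nrem; exists eta => //; rewrite -e.
have level_eps_le m : level_eps m <= 1 / 2.
  have := scale_le1 R m; have := scale_gt0 R m; rewrite /level_eps; nra.
have /choice[f hf] : forall p : nat * (nat -> Prop), exists w : Omega * R,
    infinitely p.2 -> [/\ (w.1 < iota)%O, 0 < w.2 &
    infinitely (fun i => p.2 i /\ splits fs xi w.1 (B i) (b i) (level_eps p.1) w.2)].
  move=> [m M]; have [Minf|nM] := pselect (infinitely M); last by exists (xi, 0).
  have [eta [K [h1 h2 h3]]] := splits_often hx zr (level_eps_gt0 R m) (level_eps_le m) Minf.
  by exists (eta, K).
(* Nested infinite sets of blocks: all blocks in [M m.+1] split at level m with the same eta and
   K. *)
pose M := fix M m : nat -> Prop := if m is m'.+1 then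
  fun i => M m' i /\ splits fs xi (f (m', M m')).1 (B i) (b i) (level_eps m') (f (m', M m')).2
  else fun=> True.
have Minf m : infinitely (M m).
  by elim: m => [n|m IH]; [exists n|have [_ _ h] := hf (m, M m) IH].
pose eta m := (f (m, M m)).1; pose K m := (f (m, M m)).2.
have hfM m : (eta m < iota)%O /\ 0 < K m by have [] := hf (m, M m) (Minf m).
have Msplit m r i : (m <= r)%N -> M r.+1 i -> splits fs xi (eta m) (B i) (b i) (level_eps m) (K m).
  elim: r => [|r IH]; first by rewrite leqn0 => /eqP -> [_].
  rewrite leq_eqVlt => /predU1P[-> [_]//|mr [Mi _]]; exact: IH.
have /choice[N hN] : forall m, exists N : nat, 1 < N%:R * (level_eps m / K m).
  move=> m; have e0 : 0 < level_eps m / K m by rewrite divr_gt0 ?level_eps_gt0 //; have [] := hfM m.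
  exists (Num.bound (level_eps m / K m)^-1).
  rewrite -ltr_pdivrMr // div1r; apply: archi_boundP.
  by rewrite invr_ge0 ltW.
have [sigma [sr _]] : exists sigma, is_succ rho sigma /\ (sigma <= xi)%O.
  have [eta0 _] := hfM 0%N.
  have ex : (eta 0%N <= xi)%O by exact: le_trans (ltW eta0) ix.
  have [z hz] := ord_sum_exists wf ex.
  have rz := imin _ eta0 _ hz.
  have [s ss sz] := succ_exists wf rz; exists s; split=> //.
  exact: le_trans sz (ord_sum_ger wf hz).
have /choice[l hl] : forall m, exists l : nat -> nat, forall g H, mono_on g H ->
    S sigma (img g H) -> (forall v, rfold (S (eta m)) (N m) (fiber g H v)) ->
    (forall h, h \in H -> (l (g h) <= h)%N) -> S xi H.
  move=> m; have [em _] := hfM m.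
  have ex : (eta m <= xi)%O by exact: le_trans (ltW em) ix.
  have [z hz] := ord_sum_exists wf ex.
  apply: (@union_closed_rfold _ _ wf _ hfs _ z) => //.
    by apply: sr.2; exact: imin hz.
  by move=> /(_ rho); rewrite leNgt sr.1.
have /choice[I hI] : forall p : nat * nat, exists i, (p.2 <= i)%N /\ M p.1 i.
  by move=> p; exact: Minf.
(* Diagonal choice: the block [i r.+1] splits at all levels m <= r and lies beyond the thresholds
   [l m (j (i r))] of these levels. *)
pose i := fix i r := if r is r'.+1 then
  I (r'.+1, ((i r').+1 + \sum_(m < r'.+1) l m (j (i r')))%N) else I (0%N, 0%N).
have iS r : ((i r).+1 + \sum_(m < r.+1) l m (j (i r)) <= i r.+1)%N /\ M r.+1 (i r.+1).
  exact: hI (r.+1, _).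
have im : {homo i : x y / (x < y)%N}.
  apply: homo_ltn => [? ? ?|r]; first exact: ltn_trans.
  by apply: leq_trans (proj1 (iS r)); exact: leq_addr.
have mm : {homo (j \o i) : x y / (x < y)%N} by move=> x z /im/jm.
have eps2 : 0 < eps / 2 by rewrite divr_gt0.
have [A [a [_ ac AS aG]]] := averages wf hfs sr.1 mm 0%N eps2.
have [a0 _ _] := ac.
exists (i \o succn), A, a; split=> //.
- by move=> x z xz; apply: im.
- move=> G GS; rewrite (splitr eps) -mulr2n.
  exact: (@shift_mass _ _ _ wf _ hfs rho (j \o i)) GS.
- move=> y y0 y1.
  apply: (@upper_dual _ _ _ wf _ hfs xi sigma eta K N (fun r => B (i r.+1))
    (fun r => b (i r.+1)) (fun r => bd (i r.+1)) (j \o i) l) => //.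
  + by move=> x z xz; apply/bm/im.
  + by move=> m; have [] := hfM m.
  + move=> r x /Bbd /andP[h1 h2]; apply/andP; split=> //; apply: leq_trans h2 _.
    by apply: (ltnW_homo bm); apply: im.
  + by move=> r m mr; apply: Msplit mr _; have [] := iS r.
  + by move=> r q c; exact: bxi.
  + move=> r m mr; apply: leq_trans (homo_ge bm _).
    apply: leq_trans (proj1 (iS r)); apply: leq_trans (leq_addl _ _).
    exact: (diag_sum_ge (fun m _ => l m (j (i r))) mr).
Qed.

End dual_contrast.

(** * Norms of finite combinations *)

Section scalars.
Variables (R : realType) (s : scalars).
Local Notation K := (scalar_field R s).
Implicit Types (x y : K) (r t : R).

Lemma scalar_reD x y : scalar_re (x + y) = scalar_re x + scalar_re y.
Proof. by case: s x y => //= -[a b] [c e]. Qed.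

Lemma scalar_re0 : scalar_re (0 : K) = 0.
Proof. by case: s. Qed.

Lemma scalar_re_le x y : x <= y -> scalar_re x <= scalar_re y.
Proof. by case: s x y => //= -[a b] [c e]; rewrite lecE => /andP[]. Qed.

Lemma scalar_re_of r : scalar_re (scalar_of_real s r) = r.
Proof. by case: s. Qed.

Lemma scalar_of_re x : 0 <= x -> scalar_of_real s (scalar_re x) = x.
Proof. by case: s x => //= -[a b]; rewrite lecE /= => /andP[/eqP -> _]. Qed.

Lemma scalar_ofD r t : scalar_of_real s (r + t) = scalar_of_real s r + scalar_of_real s t.
Proof. by case: s => //=; rewrite rmorphD. Qed.

Lemma scalar_ofN r : scalar_of_real s (- r) = - scalar_of_real s r.
Proof. by case: s => //=; rewrite rmorphN. Qed.

Lemma scalar_ofM r t : scalar_of_real s (r * t) = scalar_of_real s r * scalar_of_real s t.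
Proof. by case: s => //=; rewrite rmorphM. Qed.

Lemma scalar_of0 : scalar_of_real s (0 : R) = 0.
Proof. by case: s => //=; rewrite rmorph0. Qed.

Lemma scalar_of1 : scalar_of_real s (1 : R) = 1.
Proof. by case: s => //=; rewrite rmorph1. Qed.

Lemma scalar_of_sum (r : seq nat) (f : nat -> R) :
  scalar_of_real s (\sum_(k <- r) f k) = \sum_(k <- r) scalar_of_real s (f k).
Proof.
by elim: r => [|k r IH]; rewrite ?big_nil ?scalar_of0 // !big_cons scalar_ofD IH.
Qed.

Lemma scalar_of_ge0 r : 0 <= r -> 0 <= scalar_of_real s r.
Proof. by case: s => //= h; rewrite ler0c. Qed.

Lemma scalar_of_gt0 r : 0 < r -> 0 < scalar_of_real s r.
Proof. by case: s => //= h; rewrite ltcE /= eqxx. Qed.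

Lemma scalar_reM r x : scalar_re (scalar_of_real s r * x) = r * scalar_re x.
Proof. by case: s x => //= -[a b] /=; rewrite mul0r subr0. Qed.

Definition nrm x : R := scalar_re `|x|.

Lemma nrmE x : `|x| = scalar_of_real s (nrm x).
Proof. by rewrite scalar_of_re. Qed.

Lemma nrm_ge0 x : 0 <= nrm x.
Proof. by rewrite -scalar_re0; apply: scalar_re_le; exact: normr_ge0. Qed.

Lemma nrm0 : nrm 0 = 0.
Proof. by rewrite /nrm normr0 scalar_re0. Qed.

Lemma nrm1 : nrm 1 = 1.
Proof. by rewrite /nrm normr1 -scalar_of1 scalar_re_of. Qed.

Lemma nrmM x y : nrm (x * y) = nrm x * nrm y.
Proof. by rewrite {1}/nrm normrM (nrmE x) scalar_reM. Qed.

Lemma nrmD x y : nrm (x + y) <= nrm x + nrm y.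
Proof. by rewrite /nrm -scalar_reD; apply/scalar_re_le/ler_normD. Qed.

Lemma nrm_of r : 0 <= r -> nrm (scalar_of_real s r) = r.
Proof. by move=> r0; rewrite /nrm ger0_norm ?scalar_re_of // scalar_of_ge0. Qed.

Lemma nrm_eq0 x : (nrm x == 0) = (x == 0).
Proof.
apply/eqP/eqP => [h|->]; last exact: nrm0.
by apply/eqP; rewrite -normr_eq0 nrmE h scalar_of0.
Qed.

Lemma nrm_sum (I : Type) (r : seq I) (P : pred I) (F : I -> K) :
  nrm (\sum_(i <- r | P i) F i) <= \sum_(i <- r | P i) nrm (F i).
Proof.
elim/big_ind2 : _ => [|x a y b xa yb|//]; first by rewrite nrm0.
by apply: le_trans (nrmD _ _) _; exact: lerD.
Qed.

Definition phase x : K := if x == 0 then 0 else `|x| / x.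

Lemma phaseM x : x * phase x = scalar_of_real s (nrm x).
Proof.
rewrite /phase -nrmE; case: eqP => [->|/eqP x0]; first by rewrite mul0r normr0.
by rewrite mulrCA divff ?mulr1.
Qed.

Lemma nrm_phase x : nrm (phase x) <= 1.
Proof.
rewrite /phase; case: eqP => [_|/eqP x0]; first by rewrite nrm0.
by rewrite /nrm normrM normfV normr_id divff ?normr_eq0 // -scalar_of1 scalar_re_of.
Qed.

Section vectors.
Variable V : normedModType K.
Implicit Types v w : V.

Lemma rnormE v : `|v| = scalar_of_real s (rnorm v).
Proof. by rewrite scalar_of_re. Qed.

Lemma rnorm_ge0 v : 0 <= rnorm v.
Proof. by rewrite -scalar_re0; apply: scalar_re_le; exact: normr_ge0. Qed.

Lemma rnorm0 : rnorm (0 : V) = 0.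
Proof. by rewrite /rnorm normr0 scalar_re0. Qed.

End vectors.

Lemma rnorm_scalar (x : K^o) : rnorm x = nrm x.
Proof. by []. Qed.

Section linear_combinations.
Variables (V : lmodType K).
Implicit Types (v : nat -> V) (a c : nat -> K).

Lemma c00P a : c00 a <-> exists E : {fset nat}, forall i, a i != 0 -> i \in E.
Proof.
split=> [/finite_fsetP[E hE]|[E hE]].
  by exists E => i ai; have : [set i | a i != 0] i by []; rewrite hE.
apply: (sub_finite_set _ (finite_fset E)) => i /= ai; exact: hE.
Qed.

Lemma lincombE v a (E : {fset nat}) : (forall i, a i != 0 -> i \in E) ->
  lincomb v a = \sum_(i <- E) a i *: v i.
Proof.
move=> h; apply: fsbigTE => i iE.
have -> : a i = 0 by apply/eqP; apply: contraNT iE; exact: h.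
by rewrite scale0r.
Qed.

End linear_combinations.
End scalars.

(** * Norms in the space and in its dual *)

Section spaces.
Variables (R : realType) (s : scalars) (F : set {fset nat}).
Hypothesis F0 : F fset0.
Hypothesis F1 : forall n, F [fset n]%fset.
Variable X : schreier_space R s F.
Local Notation K := (scalar_field R s).
Local Notation coord := Defs.coord.
Local Notation basis := Defs.basis.
Implicit Types (v w : X) (a b c : nat -> K) (q : nat -> R) (E A B : {fset nat}) (t : R) (k : nat).

Lemma coord_comb k (I : Type) (r : seq I) (P : pred I) (a : I -> K) (v : I -> X) :
  coord k (\sum_(i <- r | P i) a i *: v i) = \sum_(i <- r | P i) a i * coord k (v i).
Proof.
have c0 : coord k (0 : X) = 0.
  by have := @coord_linear _ _ _ X k (-1) 0 0; rewrite scaler0 addr0 scaleN1r addNr.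
elim: r => [|i r IH]; first by rewrite !big_nil.
rewrite !big_cons; case: (P i) => //.
by rewrite coord_linear IH.
Qed.

Lemma coord_lincomb a k : c00 a -> coord k (lincomb (basis X) a) = a k.
Proof.
move=> /c00P[E hE]; rewrite (lincombE _ hE) coord_comb.
have [kE|kE] := boolP (k \in E); last first.
  have -> : a k = 0 by apply/eqP; apply: contraNT kE; exact: hE.
  rewrite big_seq big1 // => i iE; rewrite Defs.coord_basis.
  by case: eqP => [e|_]; [move: kE; rewrite e iE|rewrite mulr0].
rewrite (big_fsetD1 k) //= Defs.coord_basis eqxx mulr1 big_seq big1 ?addr0 // => i.
by rewrite !inE Defs.coord_basis => /andP[/negbTE]; rewrite eq_sym => ->; rewrite mulr0.
Qed.

Lemma schreier_norm_ub a E : c00 a -> F E ->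
  mass (fun k => nrm (a k)) E <= rnorm (lincomb (basis X) a).
Proof.
move=> ca FE; rewrite norm_lincomb //; apply: ub_le_sup; last by exists E.
have /c00P[B hB] := ca; exists (mass (fun k => nrm (a k)) B) => _ [G _ <-].
rewrite -/(mass (fun k => nrm (a k)) G) (@mass_eq _ _ G (G `&` B)%fset).
  by apply: mass_sub; [move=> k; exact: nrm_ge0|exact: fsubsetIr].
move=> k; rewrite nrm_eq0 => /hB kB; by rewrite in_fsetI kB andbT.
Qed.

Lemma schreier_norm_lub a t : c00 a -> norm_le F (fun k => nrm (a k)) t ->
  rnorm (lincomb (basis X) a) <= t.
Proof.
move=> ca h; rewrite norm_lincomb //; apply: ge_sup.
  by exists (mass (fun k => nrm (a k)) fset0), fset0.
by move=> _ [E FE <-]; exact: h.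
Qed.

(** The norm is given on finitely supported vectors only. The difference [g] of the two sides is
    continuous, and at most 0 on this dense set. *)
Lemma mass_coord_le v E : F E -> mass (fun k => nrm (coord k v)) E <= rnorm v.
Proof.
move=> FE; rewrite leNgt; apply/negP => lt.
pose m w := mass (fun k => nrm (coord k w)) E.
pose g w : K := \sum_(k <- E) `|coord k w| - `|w|.
have gE w : g w = scalar_of_real s (m w - rnorm w).
  rewrite /g rnormE.
  have -> : \sum_(k <- E) `|coord k w| = scalar_of_real s (m w).
    by rewrite /m /mass scalar_of_sum; apply: eq_bigr => k _; exact: nrmE.
  by rewrite scalar_ofD scalar_ofN.
have gc : continuous g.
  move=> w; rewrite /g; apply: cvgB; last exact: cvg_norm.
  elim: (enum_fset E) => [|k r IH].
    under eq_cvg do rewrite big_nil; rewrite big_nil; exact: cvg_cst.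
  under eq_cvg do rewrite big_cons; rewrite big_cons; apply: cvgD => //.
  exact: (cvg_norm (@Defs.coord_continuous _ _ _ X k w)).
have gv0 : 0 < g v by rewrite gE scalar_of_gt0 // subr_gt0.
have nb : nbhs v [set w | `|g v - g w| < g v] by exact: (cvgr_dist_lt _ _ (gc v) _ gv0).
have [||w [wO [a ca aw]]] := @dense_lincomb _ _ _ X (interior [set w | `|g v - g w| < g v]).
- by exists v.
- exact: open_interior.
have /interior_subset /= : interior [set w | `|g v - g w| < g v] w by [].
have gw : g w <= 0.
  have le : m w <= rnorm w.
    rewrite -aw; apply: le_trans (schreier_norm_ub ca FE).
    by rewrite /m /mass; under eq_bigr do rewrite coord_lincomb //.
  by rewrite gE -oppr_ge0 -scalar_ofN scalar_of_ge0 // opprB subr_ge0.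
have : g v <= g v - g w by rewrite lerBrDr gerDl.
move=> le; rewrite ger0_norm ?(le_trans (ltW gv0)) //.
by move=> /(le_lt_trans le); rewrite ltxx.
Qed.

Lemma nrm_coord_le v k : nrm (coord k v) <= rnorm v.
Proof. by rewrite -[leLHS](mass1 (fun k => nrm (coord k v))); exact: mass_coord_le. Qed.

Lemma lincomb_coordE b B v : (forall k, b k != 0 -> k \in B) ->
  lincomb (@coord _ _ _ X : nat -> (X -> K^o)) b v = \sum_(k <- B) b k * coord k v.
Proof. by move=> hB; rewrite (lincombE _ hB) fct_sumE. Qed.

Lemma dual_coord_lincomb b k : c00 b ->
  dual_coord k (lincomb (@coord _ _ _ X : nat -> (X -> K^o)) b) = b k.
Proof.
move=> /c00P[B hB]; rewrite /dual_coord (lincomb_coordE _ hB).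
have [kB|kB] := boolP (k \in B); last first.
  have -> : b k = 0 by apply/eqP; apply: contraNT kB; exact: hB.
  rewrite big_seq big1 // => i iB; rewrite Defs.coord_basis.
  by case: eqP => [e|_]; [move: kB; rewrite -e iB|rewrite mulr0].
rewrite (big_fsetD1 k) //= Defs.coord_basis eqxx mulr1 big_seq big1 ?addr0 // => i.
by rewrite !inE Defs.coord_basis => /andP[/negbTE ->]; rewrite mulr0.
Qed.

Lemma op_norm_le (W : normedModType K) (f : X -> W) t :
  (forall v, rnorm v <= 1 -> rnorm (f v) <= t) -> op_norm f <= t.
Proof.
move=> h; apply: ge_sup; first by exists (rnorm (f 0)), 0 => //=; rewrite rnorm0.
by move=> _ [v v1 <-]; exact: h.
Qed.

(** The bound t ensures that the supremum is a genuine one, not the default value for unbounded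
    sets. *)
Lemma op_norm_ge (W : normedModType K) (f : X -> W) t v :
  (forall v, rnorm v <= 1 -> rnorm (f v) <= t) -> rnorm v <= 1 ->
  rnorm (f v) <= op_norm f.
Proof.
move=> h v1; apply: ub_le_sup; last by exists v.
by exists t => _ [w w1 <-]; exact: h.
Qed.

(** Together with [dual_norm_ge], this reduces dual norms to pairings of moduli with nonnegative
    vectors, because the basis is unconditional; the scalar field then enters only through
    moduli. *)
Lemma dual_norm_le b B t : (forall k, b k != 0 -> k \in B) ->
  (forall q, (forall k, 0 <= q k) -> norm_le F q 1 ->
     pairing B (fun k => nrm (b k)) q <= t) ->
  op_norm (lincomb (@coord _ _ _ X : nat -> (X -> K^o)) b : X -> K^o) <= t.
Proof.
move=> hB h; apply: op_norm_le => v v1; rewrite (lincomb_coordE _ hB).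
apply: le_trans (nrm_sum _ _ _) _; under eq_bigr do rewrite nrmM.
apply: (h (fun k => nrm (coord k v))) => [k|E FE]; first exact: nrm_ge0.
exact: le_trans (mass_coord_le _ FE) v1.
Qed.

Lemma dual_norm_ge b B q : (forall k, b k != 0 -> k \in B) ->
  (forall k, 0 <= q k) -> norm_le F q 1 ->
  pairing B (fun k => nrm (b k)) q <=
  op_norm (lincomb (@coord _ _ _ X : nat -> (X -> K^o)) b : X -> K^o).
Proof.
move=> hB q0 q1.
(* The phases of b are moved to the vector, at which the functional then takes the value of the
   pairing. *)
pose a k : K := if k \in B then phase (b k) * scalar_of_real s (q k) else 0.
have aB k : a k != 0 -> k \in B by rewrite /a; case: ifP; rewrite // eqxx.
have ca : c00 a by apply/c00P; exists B.
have aq k : nrm (a k) <= q k.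
  rewrite /a; case: ifP => _; last by rewrite nrm0.
  by rewrite nrmM nrm_of // ler_piMl // nrm_phase.
pose v := lincomb (basis X) a.
have v1 : rnorm v <= 1.
  apply: schreier_norm_lub => // E FE; apply: le_trans (q1 _ FE).
  by apply: ler_sum => k _.
have fv : rnorm (lincomb (@coord _ _ _ X : nat -> (X -> K^o)) b v : K^o) =
    pairing B (fun k => nrm (b k)) q.
  rewrite (lincomb_coordE _ hB) rnorm_scalar.
  have -> : \sum_(k <- B) b k * coord k v =
      scalar_of_real s (pairing B (fun k => nrm (b k)) q).
    rewrite /pairing scalar_of_sum big_seq [RHS]big_seq; apply: eq_bigr => k kB.
    by rewrite coord_lincomb // /a kB mulrA phaseM scalar_ofM.
  rewrite nrm_of // sumr_ge0 // => k _; by rewrite mulr_ge0 // nrm_ge0.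
rewrite -fv; apply: (op_norm_ge (t := \sum_(k <- B) nrm (b k))) v1 => w w1.
rewrite (lincomb_coordE _ hB); apply: le_trans (nrm_sum _ _ _) _.
apply: ler_sum => k _; rewrite nrmM ler_piMr ?nrm_ge0 //.
exact: le_trans (nrm_coord_le _ _) w1.
Qed.

End spaces.

Lemma block_bounds (W : nat -> {fset nat}) : (forall i, W i != fset0) ->
  (forall i k l, k \in W i -> l \in W i.+1 -> (k < l)%N) ->
  exists bd : nat -> nat, {homo bd : x y / (x < y)%N} /\
    forall i (x : nat), x \in W i -> (bd i <= x < bd i.+1)%N.
Proof.
move=> W0 Wlt; pose bd i := if i is i'.+1 then (\max_(x <- W i') x).+1 else 0%N.
have h i (x : nat) : x \in W i -> (bd i <= x < bd i.+1)%N.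
  move=> xW; apply/andP; split; last first.
    by rewrite ltnS; apply: (@leq_bigmax_seq nat (enum_fset (W i)) xpredT id x xW isT).
  case: i xW => // i xW; have /fset0Pn[w wW] := W0 i.
  rewrite /= -(prednK (leq_ltn_trans (leq0n w) (Wlt _ _ _ wW xW))) ltnS.
  by apply/bigmax_leqP_seq => v vW _; have := Wlt _ _ _ vW xW; lia.
exists bd; split=> //; apply: homo_ltn => [? ? ?|i]; first exact: ltn_trans.
have /fset0Pn[w wW] := W0 i; have /andP[h1 h2] := h _ _ wW.
exact: leq_ltn_trans h1 h2.
Qed.

Section combinations.
Variables (R : realType) (s : scalars).
Local Notation K := (scalar_field R s).
Implicit Types (a c : nat -> K) (A : {fset nat}).

Section one_space.
Variables (V : lmodType K) (b : nat -> V).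

Lemma lincomb_delta (n : nat) : lincomb b (fun k => (k == n)%:R) = b n.
Proof.
rewrite (@lincombE _ _ _ _ _ [fset n]%fset) ?big_seq_fset1 ?eqxx ?scale1r // => i.
by rewrite inE; case: (i == n) => //; rewrite eqxx.
Qed.

Lemma c00_delta (n : nat) : c00 (fun k => (k == n)%:R : K).
Proof.
apply/c00P; exists [fset n]%fset => i; rewrite inE.
by case: (i == n) => //; rewrite eqxx.
Qed.

Lemma comb_lincomb A c (a : nat -> nat -> K) : (forall r, c00 (a r)) ->
  c00 (fun k => \sum_(r <- A) c r * a r k) /\
  \sum_(r <- A) c r *: lincomb b (a r) = lincomb b (fun k => \sum_(r <- A) c r * a r k).
Proof.
move=> /(_ _)/c00P/cid-/all_sig[E hE].
pose U := (\bigcup_(r <- A) E r)%fset.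
have EU r : r \in A -> (E r `<=` U)%fset by move=> rA; exact: bigfcup_sup.
have hU k : \sum_(r <- A) c r * a r k != 0 -> k \in U.
  apply: contraNT => kU; rewrite big_seq big1 // => r rA.
  suff -> : a r k = 0 by rewrite mulr0.
  by apply/eqP; apply: contraNT kU => /hE; apply/fsubsetP/EU.
split; first by apply/c00P; exists U.
rewrite (lincombE _ hU).
under [RHS]eq_bigr => k _ do rewrite scaler_suml.
rewrite exchange_big big_seq [RHS]big_seq; apply: eq_bigr => r rA.
rewrite (@lincombE _ _ _ _ _ U); last by move=> i /hE; apply/fsubsetP/EU.
by rewrite scaler_sumr; apply: eq_bigr => k _; rewrite scalerA.
Qed.

(** The coefficients c are placed at the positions i r, so that [equivalent], which speaks of whole
    sequences, applies to finite sums along a subsequence. *)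
Definition push (i : nat -> nat) A c n : K := \sum_(r <- A | i r == n) c r.

Lemma push_supp i A c n : push i A c n != 0 -> n \in img i A.
Proof.
apply: contraNT => nA; rewrite /push big_seq_cond big1 // => r /andP[rA /eqP e].
by move: nA; rewrite -e mem_img.
Qed.

Lemma lincomb_push i A c :
  lincomb b (push i A c) = \sum_(r <- A) c r *: b (i r).
Proof.
rewrite (lincombE _ (@push_supp i A c)).
under eq_bigr => n _ do rewrite /push scaler_suml.
rewrite (exchange_big_dep predT) //= big_seq [RHS]big_seq.
apply: eq_bigr => r rA; rewrite big_mkcond (big_fsetD1 (i r)) ?mem_img //= eqxx.
rewrite big_seq big1 ?addr0 // => n; rewrite !inE => /andP[ne _].
by rewrite ifN // eq_sym.
Qed.

End one_space.

Lemma equivalent_comb (V W : lmodType K) (NV : V -> R) v (NW : W -> R) w :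
  equivalent NV v NW w -> exists2 C : R, 0 < C & forall i A c,
   NV (\sum_(r <- A) c r *: v (i r)) <= C * NW (\sum_(r <- A) c r *: w (i r)) /\
   NW (\sum_(r <- A) c r *: w (i r)) <= C * NV (\sum_(r <- A) c r *: v (i r)).
Proof.
move=> [C C0 h]; exists C => // i A c; rewrite -!lincomb_push; apply: h.
by apply/c00P; exists (img i A); exact: push_supp.
Qed.

Lemma nrm_disjoint_sum A (f : nat -> K) :
  {in A &, forall r r', f r != 0 -> f r' != 0 -> r = r'} ->
  nrm (\sum_(r <- A) f r) = \sum_(r <- A) nrm (f r).
Proof.
move=> dis; have [[r [rA fr]]|nex] := pselect (exists r, r \in A /\ f r != 0).
  rewrite (big_fsetD1 r) //= [RHS](big_fsetD1 r) //= !big_seq !big1 ?addr0 //.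
    move=> r'; rewrite !inE => /andP[ne r'A]; apply/eqP; rewrite nrm_eq0.
    by apply: contraNT ne => fr'; apply/eqP; exact: dis.
  move=> r'; rewrite !inE => /andP[ne r'A]; apply/eqP.
  by apply: contraNT ne => fr'; apply/eqP; exact: dis.
have f0 r : r \in A -> f r = 0.
  by move=> rA; apply/eqP/negPn/negP => fr; apply: nex; exists r.
rewrite big_seq big1 ?nrm0 // big_seq big1 // => r /f0 ->; exact: nrm0.
Qed.

Definition disjoint_supports (a : nat -> nat -> K) : Prop :=
  forall k r r', a r k != 0 -> a r' k != 0 -> r = r'.

Lemma disjoint_nrm A c (a : nat -> nat -> K) k : disjoint_supports a ->
  nrm (\sum_(r <- A) c r * a r k) = \sum_(r <- A) nrm (c r) * nrm (a r k).
Proof.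
move=> dis; rewrite nrm_disjoint_sum; first by apply: eq_bigr => r _; rewrite nrmM.
by move=> r r' _ _; rewrite !mulf_eq0 !negb_or => /andP[_ h] /andP[_]; exact: dis.
Qed.

Lemma block_sequence_coords (V : lmodType K) (b : nat -> V) (cf : nat -> V -> K) v :
  (forall a k, c00 a -> cf k (lincomb b a) = a k) ->
  block_sequence b cf v -> exists (a : nat -> nat -> K) (W : nat -> {fset nat}) (bd : nat -> nat),
  [/\ forall i, v i = lincomb b (a i), forall i k, a i k != 0 -> k \in W i,
    {homo bd : x y / (x < y)%N} & 
    forall i (x : nat), x \in W i -> (bd i <= x < bd i.+1)%N].
Proof.
move=> hcf [v0 vfin vlt].
have /choice[a ha] : forall i, exists a, c00 a /\ v i = lincomb b a.
  by move=> i; have [a ca ->] := vfin i; exists a.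
have /choice[E hE] : forall i, exists E : {fset nat}, forall k, a i k != 0 -> k \in E.
  by move=> i; apply/c00P; have [] := ha i.
pose W i := [fset k in E i | a i k != 0]%fset.
have aE i k : cf k (v i) = a i k by have [ca ->] := ha i; exact: hcf.
have [||bd [bm bdW]] := @block_bounds W.
- move=> i; apply/eqP => W0; apply: (v0 i); have [ca ->] := ha i.
  rewrite (lincombE _ (hE i)) big_seq big1 // => k kE.
  have -> : a i k = 0; last by rewrite scale0r.
  apply/eqP/negPn/negP => ak; have : k \in W i by rewrite !inE kE.
  by rewrite W0.
- move=> i k l; rewrite !inE => /andP[_ ak] /andP[_ al].
  by apply: (vlt i); rewrite aE.
exists a, W, bd; split=> // [i|i k ak]; first by have [] := ha i.
by rewrite !inE ak hE.
Qed.

Lemma disjoint_blocks (a : nat -> nat -> K) (W : nat -> {fset nat}) (bd i : nat -> nat) :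
  (forall i k, a i k != 0 -> k \in W i) -> {homo bd : x y / (x < y)%N} ->
  (forall i (x : nat), x \in W i -> (bd i <= x < bd i.+1)%N) ->
  {homo i : x y / (x < y)%N} -> disjoint_supports (fun r => a (i r)).
Proof.
move=> aW bm bW im k r r' /aW/bW h /aW/bW h'.
have e : i r = i r' by rewrite -(blkE bm h) -(blkE bm h').
by have [/im|/im|//] := ltngtP r r'; rewrite e ltnn.
Qed.

Lemma disjoint_deltas (m : nat -> nat) : {homo m : x y / (x < y)%N} ->
  disjoint_supports (fun r k => (k == m r)%:R).
Proof.
move=> mm k r r'; case: (eqVneq k (m r)) => [->|_]; last by rewrite eqxx.
case: (eqVneq (m r) (m r')) => [e|_ _]; last by rewrite eqxx.
by have [/mm|/mm|//] := ltngtP r r'; rewrite e ltnn.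
Qed.

Lemma nrm_delta (m k : nat) : nrm ((k == m)%:R : K) = (k == m)%:R.
Proof. by case: (k == m); rewrite ?nrm1 ?nrm0. Qed.

Section norms.
Variable F : set {fset nat}.
Hypothesis F0 : F fset0.
Hypothesis F1 : forall n, F [fset n]%fset.
Variable X : schreier_space R s F.
Local Notation coord := Defs.coord.
Local Notation basis := Defs.basis.
Local Notation coords := (@Defs.coord _ _ _ X : nat -> (X -> K^o)).
Implicit Types (t : R).

Lemma comb_norm_le A c (a : nat -> nat -> K) t :
  (forall r, c00 (a r)) -> disjoint_supports a ->
  (forall E, F E -> \sum_(r <- A) nrm (c r) * mass (fun k => nrm (a r k)) E <= t) ->
  rnorm (\sum_(r <- A) c r *: lincomb (basis X) (a r)) <= t.
Proof.
move=> ca dis h; have [c0 ->] := comb_lincomb (basis X) A c ca.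
apply: schreier_norm_lub => // E FE; apply: le_trans (h E FE).
rewrite /mass; under eq_bigr => k _ do rewrite disjoint_nrm //.
by rewrite exchange_big; apply: ler_sum => r _; rewrite mulr_sumr.
Qed.

Lemma comb_norm_ge A c (a : nat -> nat -> K) E :
  (forall r, c00 (a r)) -> disjoint_supports a -> F E ->
  \sum_(r <- A) nrm (c r) * mass (fun k => nrm (a r k)) E <=
  rnorm (\sum_(r <- A) c r *: lincomb (basis X) (a r)).
Proof.
move=> ca dis FE; have [c0 ->] := comb_lincomb (basis X) A c ca.
apply: le_trans (schreier_norm_ub X c0 FE).
rewrite /mass; under [leRHS]eq_bigr => k _ do rewrite disjoint_nrm //.
by rewrite exchange_big; apply: ler_sum => r _; rewrite mulr_sumr.
Qed.

Lemma comb_pairing A c (a : nat -> nat -> K) (B : nat -> {fset nat}) U (q : nat -> R) :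
  (forall r k, a r k != 0 -> k \in B r) -> disjoint_supports a ->
  (forall r, r \in A -> (B r `<=` U)%fset) ->
  pairing U (fun k => nrm (\sum_(r <- A) c r * a r k)) q =
  \sum_(r <- A) nrm (c r) * pairing (B r) (fun k => nrm (a r k)) q.
Proof.
move=> aB dis BU; rewrite /pairing.
under eq_bigr => k _ do rewrite disjoint_nrm // mulr_suml.
rewrite exchange_big big_seq [RHS]big_seq; apply: eq_bigr => r rA.
rewrite mulr_sumr [RHS](big_fset_incl _ (BU r rA)).
  by apply: eq_bigr => k _; rewrite mulrA.
move=> k _ kB; suff -> : a r k = 0 by rewrite nrm0 mul0r mulr0.
by apply/eqP; apply: contraNT kB; exact: aB.
Qed.

Lemma comb_dual_norm_le A c (a : nat -> nat -> K) (B : nat -> {fset nat}) t :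
  (forall r k, a r k != 0 -> k \in B r) -> disjoint_supports a ->
  (forall q, (forall k, 0 <= q k) -> norm_le F q 1 ->
    \sum_(r <- A) nrm (c r) * pairing (B r) (fun k => nrm (a r k)) q <= t) ->
  op_norm (\sum_(r <- A) c r *: lincomb coords (a r) : X -> K^o) <= t.
Proof.
move=> aB dis h; pose U := (\bigcup_(r <- A) B r)%fset.
have BU r : r \in A -> (B r `<=` U)%fset by move=> rA; exact: bigfcup_sup.
have ca r : c00 (a r) by apply/c00P; exists (B r); exact: aB.
have [c0 ->] := comb_lincomb coords A c ca.
apply: (@dual_norm_le _ _ _ X _ U) => [k|q q0 q1].
  apply: contraNT => kU; rewrite big_seq big1 // => r rA.
  suff -> : a r k = 0 by rewrite mulr0.
  by apply/eqP; apply: contraNT kU => /aB; apply/fsubsetP/BU.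
by rewrite (comb_pairing _ _ aB dis BU); exact: h.
Qed.

Lemma comb_dual_norm_ge A c (a : nat -> nat -> K) (B : nat -> {fset nat}) q t :
  (forall r k, a r k != 0 -> k \in B r) -> disjoint_supports a ->
  (forall k, 0 <= q k) -> 0 < t -> norm_le F q t ->
  \sum_(r <- A) nrm (c r) * pairing (B r) (fun k => nrm (a r k)) q <=
  t * op_norm (\sum_(r <- A) c r *: lincomb coords (a r) : X -> K^o).
Proof.
move=> aB dis q0 t0 qt; pose U := (\bigcup_(r <- A) B r)%fset.
have BU r : r \in A -> (B r `<=` U)%fset by move=> rA; exact: bigfcup_sup.
have ca r : c00 (a r) by apply/c00P; exists (B r); exact: aB.
have [c0 ->] := comb_lincomb coords A c ca.
rewrite -(comb_pairing _ _ aB dis BU) -ler_pdivrMl // -pairingZ.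
apply: dual_norm_ge => //.
- move=> k; apply: contraNT => kU; rewrite big_seq big1 // => r rA.
  suff -> : a r k = 0 by rewrite mulr0.
  by apply/eqP; apply: contraNT kU => /aB; apply/fsubsetP/BU.
- by move=> k; rewrite mulr_ge0 // invr_ge0 ltW.
- by move=> E FE; rewrite massZ ler_pdivrMl // mulr1; exact: qt.
Qed.

End norms.
End combinations.

(** * The equivalences *)

Section necessity.
Variables (R : realType) (s : scalars).
Variables (d : Order.disp_t) (Omega : orderType d).
Hypothesis wf : well_founded (fun eta xi : Omega => (eta < xi)%O).
Variable fs : Omega -> nat -> Omega.
Hypothesis hfs : schreier_sequences fs.
Variables (xi rho : Omega).
Variables (X : schreier_space R s (schreier fs xi)).
Variables (Y : schreier_space R s (schreier fs rho)).
Local Notation K := (scalar_field R s).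
Local Notation S := (schreier fs).
Local Notation coord := Defs.coord.
Local Notation basis := Defs.basis.
Implicit Types (A E G H : {fset nat}) (eps t : R).

Lemma schreier_has0 (zeta : Omega) : (S zeta : set _) fset0.
Proof. exact: schreier0. Qed.

Lemma schreier_has1 (zeta : Omega) n : (S zeta : set _) [fset n]%fset.
Proof. exact: schreier_single. Qed.

Lemma mass_delta n E : mass (fun k => nrm ((k == n)%:R : K)) E = (n \in E)%:R.
Proof.
rewrite (@mass_eq _ _ E (if n \in E then [fset n]%fset else fset0)).
  by case: ifP => _; rewrite ?mass0 // mass1 nrm_delta eqxx.
move=> k; rewrite nrm_delta; case: (eqVneq k n) => [->|_]; last by rewrite eqxx.
by case: ifP => _ _; rewrite !inE // eqxx.
Qed.

Lemma sum_mem A E (f : nat -> nat) (a : nat -> R) :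
  \sum_(r <- A) a r * (f r \in E)%:R = mass a [fset r in A | f r \in E]%fset.
Proof.
rewrite /mass big_fset [RHS]big_mkcond /=; apply: eq_bigr => r _.
by case: (f r \in E); rewrite ?mulr1 ?mulr0.
Qed.

Lemma img_sub E A (f : nat -> nat) :
  (img f [fset r in A | f r \in E] `<=` E)%fset.
Proof. by apply/fsubsetP => _ /imgP[r + ->]; rewrite !inE => /andP[]. Qed.

Lemma sum_of_nrm A (a f : nat -> R) : (forall r, 0 <= a r) ->
  \sum_(r <- A) nrm (scalar_of_real s (a r)) * f r = \sum_(r <- A) a r * f r.
Proof. by move=> a0; apply: eq_bigr => r _; rewrite nrm_of. Qed.

Lemma basis_norm_le (m : nat -> nat) A (c : nat -> K) t : {homo m : x y / (x < y)%N} ->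
  (forall E, (S rho) E -> \sum_(r <- A) nrm (c r) * (m r \in E)%:R <= t) ->
  rnorm (\sum_(r <- A) c r *: basis Y (m r)) <= t.
Proof.
move=> mm h.
rewrite (eq_bigr (fun r => c r *: lincomb (basis Y) (fun k => (k == m r)%:R))); last first.
  by move=> r _; rewrite lincomb_delta.
apply: comb_norm_le => [|r||E ES]; [exact: schreier_has0|exact: c00_delta|exact: disjoint_deltas|].
by under eq_bigr do rewrite mass_delta; exact: h.
Qed.

Lemma basis_norm_ge (m : nat -> nat) A (c : nat -> K) E : {homo m : x y / (x < y)%N} ->
  (S rho) E -> \sum_(r <- A) nrm (c r) * (m r \in E)%:R <=
  rnorm (\sum_(r <- A) c r *: basis Y (m r)).
Proof.
move=> mm ES.
rewrite (eq_bigr (fun r => c r *: lincomb (basis Y) (fun k => (k == m r)%:R))); last first.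
  by move=> r _; rewrite lincomb_delta.
apply: le_trans (comb_norm_ge Y A c (fun r => c00_delta R s (m r)) (disjoint_deltas mm) ES).
by under [leRHS]eq_bigr do rewrite mass_delta.
Qed.

Lemma remainder_of_blocks (x : nat -> X) (j : nat -> nat) :
  normalized_block x -> increasing j -> equiv_subbasis Y x j -> remainders xi rho.
Proof.
move=> [xb x1] jm /equivalent_comb[C C0 heq].
have [a [W [bd [xa aW bm bW]]]] := block_sequence_coords (@coord_lincomb _ _ _ X) xb.
have ca i : c00 (a i) by apply/c00P; exists (W i); exact: aW.
pose y i k : R := nrm (a i k).
have y0 i k : 0 <= y i k by exact: nrm_ge0.
have ysupp i k : y i k != 0 -> (bd i <= k < bd i.+1)%N by rewrite nrm_eq0 => /aW/bW.
have y1 i : norm_le (S xi) (y i) 1.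
  by move=> E ES; rewrite -(x1 i) xa; exact: schreier_norm_ub.
have ylow i : exists E, S xi E /\ 1 / 2 <= mass (y i) E.
  apply: contrapT => nex; have : rnorm (x i) <= 1 / 2.
    rewrite xa; apply: schreier_norm_lub => // [|E ES]; first exact: schreier_has0.
    by rewrite leNgt; apply/negP => /ltW h; apply: nex; exists E.
  by rewrite x1; lra.
pose P iota := (iota <= xi)%O /\ exists2 delta : R, 0 < delta & forall n : nat, exists i E,
  [/\ (n <= i)%N, S iota E & delta <= mass (y i) E].
have [|iota [ix [delta d0 hd]] imin] := @ord_min _ _ wf P.
  exists xi; split=> //; exists (1 / 2); first lra.
  by move=> n; have [E [ES hE]] := ylow n; exists n, E.
have [zeta hz] := ord_sum_exists wf ix.
have [lt|gt|e] := ltgtP rho zeta; last by exists iota => //; rewrite e.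
(* With this bound, the equivalence with constant C will give delta <= delta / 2. *)
- have epos : 0 < delta / (2 * C) by rewrite divr_gt0 // mulr_gt0.
  have [|i [A [c [H [im [c0 cA c1] HS cH cG]]]]] :=
      @lower_contrast R _ _ wf fs hfs iota zeta xi rho j bd y delta hz lt jm bm y0 _ _ epos.
    move=> n; have [i [E [ni ES dE]]] := hd n.
    exists i, (E `&` W i)%fset; split=> //.
    + by apply: (schreier_sub wf hfs) ES; exact: fsubsetIl.
    + by move=> k /[!in_fsetI]/andP[_ /bW].
    + rewrite (@mass_eq _ _ _ E) // => k; rewrite nrm_eq0 => /aW kW.
      by rewrite in_fsetI kW andbT.
  have [h _] := heq i A (fun r => scalar_of_real s (c r)).
  have lo : delta <= rnorm (\sum_(r <- A) scalar_of_real s (c r) *: x (i r)).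
    rewrite (eq_bigr (fun r => scalar_of_real s (c r) *: lincomb (basis X) (a (i r)))); last first.
      by move=> r _; rewrite xa.
    apply: le_trans (comb_norm_ge X A _ (fun r => ca (i r)) (disjoint_blocks aW bm bW im) HS).
    rewrite sum_of_nrm // -[leLHS]mul1r -c1 /mass mulr_suml big_seq [leRHS]big_seq.
    by apply: ler_sum => r rA; rewrite ler_wpM2l // cH.
  have up : rnorm (\sum_(r <- A) scalar_of_real s (c r) *: basis Y (j (i r))) <= delta / (2 * C).
    apply: (@basis_norm_le (j \o i)) => [x' y' /im/jm //|E ES].
    rewrite sum_of_nrm // sum_mem; apply: cG.
    by apply: (schreier_sub wf hfs) ES; exact: img_sub.
  have : delta <= C * (delta / (2 * C)).
    by apply: le_trans lo (le_trans h _); rewrite ler_pM2l.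
  have -> : C * (delta / (2 * C)) = delta / 2 by field; rewrite gt_eqF.
  lra.
- have epos : 0 < 1 / (2 * C) by rewrite divr_gt0 // mulr_gt0.
  have [|||i [A [c [z [im zQ [c0 cA c1] AS zE]]]]] :=
    @upper_contrast R _ _ wf fs hfs iota zeta xi rho j bd (fun i z => z = y i) 1
      hz gt jm bm ler01 _ _ _ _ epos.
  + move=> i _ ->; split=> //; exact: ysupp.
  + by move=> n; exists n, (y n).
  + move=> eta ei n eps eps0; apply: contrapT => nex.
    have : (iota <= eta)%O; last by rewrite leNgt ei.
    apply: imin; split; first exact: ltW (lt_le_trans ei ix).
    exists eps => // n'; apply: contrapT => nex'; apply: nex.
    exists (maxn n n'), (y (maxn n n')); split=> //; first exact: leq_maxl.
    move=> E ES; rewrite leNgt; apply/negP => /ltW h; apply: nex'.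
    by exists (maxn n n'), E; split=> //; exact: leq_maxr.
  have [_ h] := heq i A (fun r => scalar_of_real s (c r)).
  have lo : 1 <= rnorm (\sum_(r <- A) scalar_of_real s (c r) *: basis Y (j (i r))).
    apply: le_trans (@basis_norm_ge (j \o i) _ _ _ _ AS) => [|x' y' /im/jm //].
    rewrite sum_of_nrm // -[leLHS]c1 /mass big_seq [leRHS]big_seq.
    by apply: ler_sum => r rA; rewrite (mem_img (j \o i)) // mulr1.
  have up : rnorm (\sum_(r <- A) scalar_of_real s (c r) *: x (i r)) <= 1 / (2 * C).
    rewrite (eq_bigr (fun r => scalar_of_real s (c r) *: lincomb (basis X) (a (i r)))); last first.
      by move=> r _; rewrite xa.
    apply: comb_norm_le => // [||E ES]; [exact: schreier_has0|exact: disjoint_blocks aW bm bW im|].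
    rewrite sum_of_nrm //; apply: le_trans (zE _ ES).
    by apply: ler_sum => r _; rewrite zQ.
  have : 1 <= C * (1 / (2 * C)).
    by apply: le_trans lo (le_trans h _); rewrite ler_pM2l.
  have -> : C * (1 / (2 * C)) = 1 / 2 by field; rewrite gt_eqF.
  lra.
Qed.

Lemma pairing_delta n (q : nat -> R) :
  pairing [fset n]%fset (fun k => nrm ((k == n)%:R : K)) q = q n.
Proof. by rewrite /pairing big_seq_fset1 eqxx nrm1 mul1r. Qed.

Lemma dual_basis_norm_le (m : nat -> nat) A (c : nat -> K) t : {homo m : x y / (x < y)%N} ->
  (forall q, (forall k, 0 <= q k) -> norm_le (S rho) q 1 ->
     \sum_(r <- A) nrm (c r) * q (m r) <= t) ->
  op_norm (\sum_(r <- A) c r *: (coord (m r) : Y -> K^o) : Y -> K^o) <= t.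
Proof.
move=> mm h.
rewrite (eq_bigr (fun r => c r *:
  lincomb (@coord _ _ _ Y : nat -> (Y -> K^o)) (fun k => (k == m r)%:R))); last first.
  by move=> r _; rewrite lincomb_delta.
apply: (@comb_dual_norm_le _ _ _ _ _ _ _ (fun r => [fset m r]%fset)) => [r k||q q0 q1].
- by rewrite inE; case: (k == m r) => //; rewrite eqxx.
- exact: disjoint_deltas.
- by under eq_bigr do rewrite pairing_delta; exact: h.
Qed.

Lemma dual_basis_norm_ge (m : nat -> nat) A (c : nat -> K) (q : nat -> R) t :
  {homo m : x y / (x < y)%N} -> (forall k, 0 <= q k) -> 0 < t -> norm_le (S rho) q t ->
  \sum_(r <- A) nrm (c r) * q (m r) <=
  t * op_norm (\sum_(r <- A) c r *: (coord (m r) : Y -> K^o) : Y -> K^o).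
Proof.
move=> mm q0 t0 qt.
rewrite (eq_bigr (fun r => c r *:
  lincomb (@coord _ _ _ Y : nat -> (Y -> K^o)) (fun k => (k == m r)%:R))); last first.
  by move=> r _; rewrite lincomb_delta.
apply: le_trans (@comb_dual_norm_ge _ _ _ (schreier_has0 _) (@schreier_has1 _) Y A c _
  (fun r => [fset m r]%fset) q t _ (disjoint_deltas mm) q0 t0 qt).
  by under [leRHS]eq_bigr do rewrite pairing_delta.
by move=> r k; rewrite inE; case: (k == m r) => //; rewrite eqxx.
Qed.

Lemma remainder_of_dual_blocks (xs : nat -> X -> K^o) (j : nat -> nat) :
  dual_normalized_block xs -> increasing j -> equiv_dual_subbasis Y xs j ->
  remainders xi rho.
Proof.
move=> [xb x1] jm /equivalent_comb[C C0 heq]; apply: contrapT => nrem.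
have [a [W [bd [xa aW bm bW]]]] := block_sequence_coords (@dual_coord_lincomb _ _ _ X) xb.
have ca i : c00 (a i) by apply/c00P; exists (W i); exact: aW.
pose b i k : R := nrm (a i k).
have b0 i k : 0 <= b i k by exact: nrm_ge0.
have disj (i : nat -> nat) := @disjoint_blocks _ _ a W bd i aW bm bW.
have xsE (i : nat -> nat) A (c : nat -> K) : \sum_(r <- A) c r *: xs (i r) =
    \sum_(r <- A) c r *: lincomb (@coord _ _ _ X : nat -> (X -> K^o)) (a (i r)).
  by apply: eq_bigr => r _; rewrite xa.
have bxi i q t : (forall k, 0 <= q k) -> norm_le (S xi) q t -> pairing (W i) (b i) q <= t.
  move=> q0 qt; have t0 : 0 <= t by have := qt _ (schreier_has0 _); rewrite mass0.
  (* Since t may be 0, the test vector is divided by t + e. *)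
  apply/ler_addgt0Pr => e e0.
  have te0 : 0 < t + e by rewrite ltr_wpDl.
  rewrite -[leRHS]mulr1 -(x1 i) xa -ler_pdivrMl // -pairingZ.
  apply: dual_norm_ge => //; [exact: schreier_has0|exact: schreier_has1|exact: aW| |].
    by move=> k; rewrite mulr_ge0 // invr_ge0 ltW.
  move=> E ES; rewrite massZ ler_pdivrMl // mulr1.
  by apply: le_trans (qt _ ES) _; rewrite lerDl ltW.
have hit i : exists q, [/\ forall k, 0 <= q k, norm_le (S xi) q 2 & 1 <= pairing (W i) (b i) q].
  apply: contrapT => nex; have : op_norm (xs i) <= 1 / 2.
    rewrite xa; apply: (@dual_norm_le _ _ _ X _ (W i)); first exact: aW.
    move=> q q0 q1; rewrite leNgt; apply/negP => lt; apply: nex.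
    exists (fun k => 2 * q k); split=> [k|E ES|]; first by rewrite mulr_ge0.
      by rewrite massZ; have := q1 _ ES; lra.
    by rewrite pairingZ; move: lt; rewrite -/(b i); lra.
  by rewrite x1; lra.
have dominated (i : nat -> nat) A q t : {homo i : x y / (x < y)%N} ->
    S rho (img (j \o i) A) -> (forall k, 0 <= q k) -> norm_le (S xi) q t ->
    \sum_(r <- A) pairing (W (i r)) (b (i r)) q <= C * t.
  move=> im AS q0 qt.
  have t0 : 0 <= t by have := qt _ (schreier_has0 _); rewrite mass0.
  have mm : {homo (j \o i) : x y / (x < y)%N} by move=> x' y' /im/jm.
  have [h _] := heq i A (fun=> 1).
  (* The sum of the coordinate functionals along a set of S_rho has norm at most 1, by the
     definition of the norm of X_rho. *)
  have up : op_norm (\sum_(r <- A) (1 : K) *: (coord (j (i r)) : Y -> K^o) : Y -> K^o) <= 1.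
    apply: (@dual_basis_norm_le (j \o i)) => // p p0 p1.
    apply: le_trans (p1 _ AS); rewrite /mass /img big_imfset /=.
      by apply: ler_sum => r _; rewrite nrm1 mul1r.
    by move=> r r' _ _ e; have [/mm|/mm|//] := ltngtP r r'; rewrite /= e ltnn.
  apply/ler_addgt0Pr => e e0.
  have te0 : 0 < t + e / C by rewrite ltr_wpDl // divr_gt0.
  have -> : C * t + e = (t + e / C) * C by field; rewrite gt_eqF.
  have qte : norm_le (S xi) q (t + e / C).
    by move=> E ES; apply: le_trans (qt _ ES) _; rewrite lerDl ltW // divr_gt0.
  have := @comb_dual_norm_ge _ _ _ (schreier_has0 _) (@schreier_has1 _) X A (fun=> 1) _
    (fun r => W (i r)) q _ (fun r => aW (i r)) (disj i im) q0 te0 qte.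
  rewrite -xsE; under eq_bigr do rewrite nrm1 mul1r.
  move=> /le_trans; apply; rewrite ler_pM2l //.
  by apply: le_trans h _; rewrite -[leRHS]mulr1 ler_pM2l.
(* The contradiction will be 1 <= eps * (C * 10) = 1 / 2. *)
pose eps : R := 1 / (20 * C).
have eps0 : 0 < eps by rewrite divr_gt0 // mulr_gt0.
have [i [A [c [im [c0 cA c1] cG c10]]]] := @dual_contrast R _ _ wf fs hfs xi rho j bd W b C
  (ltW C0) jm bm bW b0 bxi hit dominated nrem _ eps0.
have mm : {homo (j \o i) : x y / (x < y)%N} by move=> x' y' /im/jm.
have minj r r' : (j \o i) r = (j \o i) r' -> r = r'.
  by move=> /= e; have [/mm|/mm|//] := ltngtP r r'; rewrite /= e ltnn.
have [_ h] := heq i A (fun=> 1).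
have up : op_norm (\sum_(r <- A) (1 : K) *: xs (i r) : X -> K^o) <= 10.
  rewrite xsE; apply: (@comb_dual_norm_le _ _ _ _ _ _ _ (fun r => W (i r))) => [r||q q0 q1].
  - exact: aW.
  - exact: disj.
  - by under eq_bigr do rewrite nrm1 mul1r; exact: c10.
(* The average c, placed in X_rho at the positions j (i r): it has norm at most eps, and the sum of
   the functionals takes the value 1 at it. *)
pose q k : R := \sum_(r <- A) c r * (k == j (i r))%:R.
have q0 k : 0 <= q k by rewrite sumr_ge0 // => r _; rewrite mulr_ge0.
have qj r : r \in A -> q (j (i r)) = c r.
  move=> rA; rewrite /q (big_fsetD1 r) //= eqxx mulr1 big_seq big1 ?addr0 // => r'.
  rewrite !inE => /andP[ne _]; case: eqP => [e|_]; last by rewrite mulr0.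
  by move: ne; rewrite (minj _ _ e) eqxx.
have qeps : norm_le (S rho) q eps.
  move=> E ES; rewrite /mass /q exchange_big /=.
  rewrite (eq_bigr (fun r => c r * (j (i r) \in E)%:R)) => [|r _].
    rewrite sum_mem; apply: cG; apply: (schreier_sub wf hfs) ES; exact: img_sub.
  rewrite -mulr_sumr; congr (_ * _).
  rewrite -(mass_delta (j (i r)) E) /mass.
  by apply: eq_bigr => k _; rewrite nrm_delta.
have := @dual_basis_norm_ge (j \o i) A (fun=> 1) q eps mm q0 eps0 qeps.
have -> : \sum_(r <- A) nrm (1 : K) * q ((j \o i) r) = 1.
  by rewrite -[RHS]c1 /mass big_seq [RHS]big_seq; apply: eq_bigr => r rA; rewrite nrm1 mul1r qj.
move=> lo; have : 1 <= eps * (C * 10).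
  by apply: le_trans lo _; rewrite ler_pM2l //; apply: le_trans h _; rewrite ler_pM2l.
have -> : eps * (C * 10) = 1 / 2 by rewrite /eps; field; rewrite gt_eqF.
lra.
Qed.

End necessity.

(** * Construction of the Schreier pair *)

Section averaged_blocks.
Variable R : realType.
Variables (d : Order.disp_t) (Omega : orderType d).
Hypothesis wf : well_founded (fun eta xi : Omega => (eta < xi)%O).
Variable fs : Omega -> nat -> Omega.
Hypothesis hfs : schreier_sequences fs.
Variables (iota rho xi : Omega).
Hypothesis hx : ord_sum iota rho xi.
Local Notation S := (schreier fs).
Implicit Types (A E G H : {fset nat}) (t : R).

Lemma convex_mass_le1 (a : nat -> R) B E : convex_on a B -> mass a E <= 1.
Proof.
move=> [a0 aB a1]; rewrite -a1 (@mass_eq _ _ E (E `&` B)%fset).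
  by apply: mass_sub => //; exact: fsubsetIr.
move=> k ak; rewrite in_fsetI; case: (k \in E) => //=.
by symmetry; apply: contraNT ak => /aB ->.
Qed.

(* The fourth clause bounds (x_r) from below and the sums over the B_r from
   above, the fifth one (x_r) from above, all by the bases along the same m. *)
Lemma averaged_blocks : exists (m e : nat -> nat) (B : nat -> {fset nat}) (a : nat -> nat -> R),
  [/\ {homo m : x y / (x < y)%N} /\ {homo e : x y / (x < y)%N},
      forall r, convex_on (a r) (B r) /\ S xi (B r),
      forall r (k : nat), k \in B r -> (e r <= k < e r.+1)%N,
      forall G, S rho (img m G) -> S xi (\bigcup_(r <- G) B r)%fset &
      forall (c : nat -> R) A t, (forall r, 0 <= c r) ->
        (forall G, S rho (img m G) -> mass c [fset r in A | r \in G]%fset <= t) ->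
        forall E, S xi E -> \sum_(r <- A) c r * mass (a r) E <= 4 * t].
Proof.
have [l hl] := union_closed_schreier wf hfs hx.
have [u [um uge hu]] := block_estimate R wf hfs hx.
have [M hM] := schreier_le wf hfs (ord_sum_ge wf hx).
(* w consists of the number r of the block and of a lower bound for its support; the tail bounds
   2^-r are summable over the blocks. *)
have /choice[p hp] : forall w : nat * nat, exists p : {fset nat} * (nat -> R),
    [/\ forall k, k \in p.1 -> (w.2 <= k)%N, convex_on p.2 p.1, S iota p.1 &
    forall F v, S iota F -> v \in F -> (v < w.2)%N -> mass p.2 F <= scale R w.1].
  move=> [r N] /=; have [z|[eta [K [ei hK]]]] := schreier_tail wf hfs iota N.
    exists ([fset N]%fset, fun k => (k == N)%:R); split=> /=.
    - by move=> k; rewrite inE => /eqP ->.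
    - split=> [k|k|]; rewrite ?ler0n // ?mass1 ?eqxx //.
      by rewrite inE => /negbTE ->.
    - exact: schreier_single.
    - move=> F v FS vF vN; apply: le_trans (ltW (scale_gt0 R r)).
      rewrite /mass big_seq big1 // => k kF; case: eqVneq => // e.
      have := subsingleton_zero z FS vF kF; lia.
  have e0 : 0 < scale R r / K.+1%:R by rewrite divr_gt0 // scale_gt0.
  have [A [a [AN ac AS aG]]] := @averages R _ _ wf fs hfs eta iota id ei (fun _ _ h => h) N _ e0.
  have imgid G : img id G = G.
    by apply/fsetP => k; apply/imgP/idP => [[? ? ->//]|kG]; exists k.
  rewrite imgid in AS.
  have {}aG : norm_le (S eta) a (scale R r / K.+1%:R).
    by move=> G; rewrite -{1}(imgid G); exact: aG.
  exists (A, a); split=> //= F v FS vF vN.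
  apply: le_trans (mass_le_chain aG (hK _ _ FS vF vN)) _.
  rewrite mulrCA ler_piMr ?(ltW (scale_gt0 _ _)) //.
  by rewrite ler_pdivrMr // mul1r ler_nat.
(* [l (u v)] is the threshold of the label [m r = u (e r)], and M the one beyond which sets of
   S_iota are in S_xi. Labels of the form u (e r) let the lower and the upper estimates speak of the
   same m. *)
pose N v := (v + l (u v) + M)%N.
pose nxt r v := (v + \max_(k <- (p (r, N v)).1) k.+1)%N.
pose e := fix e r := if r is r'.+1 then nxt r' (e r') else 0%N.
pose B r := (p (r, N (e r))).1; pose a r := (p (r, N (e r))).2.
pose m r := u (e r).
have hp' r : [/\ forall k, k \in B r -> (N (e r) <= k)%N, convex_on (a r) (B r), S iota (B r) &
    forall F v, S iota F -> v \in F -> (v < N (e r))%N -> mass (a r) F <= scale R r].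
  exact: hp (r, N (e r)).
have BN r (k : nat) : k \in B r -> (N (e r) <= k < e r.+1)%N.
  move=> kB; have [h _ _ _] := hp' r; rewrite h //=.
  apply: (@leq_trans (\max_(k <- B r) k.+1)%N); last exact: leq_addl.
  exact: (@leq_bigmax_seq nat (enum_fset (B r)) xpredT (fun k => k.+1) k kB isT).
have Be r (k : nat) : k \in B r -> (e r <= k < e r.+1)%N.
  by move=> /BN /andP[h1 ->]; rewrite andbT (leq_trans _ h1) // /N; lia.
have em : {homo e : x y / (x < y)%N}.
  apply: homo_ltn => [? ? ?|r]; first exact: ltn_trans.
  have [_ [_ _ a1] _ _] := hp' r.
  have [e0|/fset0Pn[k /Be/andP[h1 h2]]] := eqVneq (B r) fset0.
    by move: a1; rewrite e0 mass0 => /eqP; rewrite eq_sym oner_eq0.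
  exact: leq_ltn_trans h1 h2.
have mm : {homo m : x y / (x < y)%N} by move=> x y xy; apply/um/em.
have bB r k : k \in B r -> blk e k = r by move=> /Be; exact: blkE.
exists m, e, B, a; split=> // [r|G GS|c A t c0 ct E ES].
- have [h1 h2 h3 _] := hp' r; split=> //; apply: hM h3 => k /h1; rewrite /N; lia.
- have UP x : reflect (exists2 r, r \in G & x \in B r) (x \in (\bigcup_(r <- G) B r)%fset).
    apply: (iffP (bigfcupP _ _ _ _)) => [[r /andP[rA _]]|[r rA]] xE; exists r => //.
    by rewrite rA.
  apply: (hl (m \o blk e)).
  + by move=> x y _ _ xy; apply: (ltnW_homo mm); exact: blk_mono.
  + apply: (schreier_sub wf hfs) GS; apply/fsubsetP => _ /imgP[k /UP[r rG kB] ->] /=.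
    by rewrite (bB _ _ kB) mem_img.
  + move=> v; set U := (\bigcup_(r <- G) B r)%fset.
    have [->|/fset0Pn[k]] := eqVneq (fiber (m \o blk e) U v) fset0; first exact: schreier0.
    rewrite in_fiber => /andP[/UP[r rG kB] /eqP ev].
    have [_ _ h _] := hp' r; apply: (schreier_sub wf hfs) h.
    apply/fsubsetP => k'; rewrite in_fiber => /andP[/UP[r' r'G k'B] /eqP].
    rewrite -ev /= (bB _ _ kB) (bB _ _ k'B) => e'.
    suff -> : r = r' by [].
    by have [/mm|/mm|//] := ltngtP r r'; rewrite e' ltnn.
  + move=> k /UP[r rG kB]; rewrite /= (bB _ _ kB).
    have /andP[h _] := BN _ _ kB; apply: leq_trans h; rewrite /N /m; lia.
- have [||||G [GS hG]] := hu e a (scale R) em _ _ _ _ E ES.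
  + by move=> r; have [_ [h _ _] _ _] := hp' r.
  + by move=> r; rewrite ltW // scale_gt0.
  + move=> r k; have [_ [_ h _] _ _] := hp' r => ak; apply: Be.
    by apply: contraNT ak => /h ->.
  + move=> r F v FS vF vr; have [_ _ _ h] := hp' r; apply: (h F v) => //.
    by apply: leq_trans vr _; rewrite /N; lia.
  pose cA := cutoff A c.
  have cA0 r : 0 <= cA r by exact: cutoff_ge0.
  have cAE G' : mass cA G' = mass c [fset r in A | r \in G']%fset.
    by rewrite mass_cutoff; congr mass; apply/fsetP => k; rewrite !inE andbC.
  have massG : mass cA G <= t *+ 2.
    by apply: (shift_mass wf hfs mm cA0 _ GS) => G' G'S; rewrite cAE; exact: ct.
  have ctr r : r \in A -> c r <= t.
    move=> rA; have <- : mass c [fset k in A | k \in [fset r]%fset]%fset = c r.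
      rewrite -cAE mass1 /cA /cutoff rA //.
    apply: ct; apply: subsingleton_schreier => // x y.
    by move=> /imgP[v + ->] /imgP[w + ->]; rewrite !inE => /eqP -> /eqP ->.
  have t0 : 0 <= t.
    have := ct fset0 (_ : S rho (img m fset0)); rewrite -cAE mass0; apply.
    by apply: subsingleton_schreier => // x y /imgP[].
  (* The constant 4: the blocks of G contribute at most 2 t by [shift_mass], and the errors at most
     t times the sum of the 2^-r, that is 2 t. *)
  apply: (@le_trans _ _ (\sum_(r <- A) (c r * (r \in G)%:R + t * scale R r))).
    rewrite big_seq [leRHS]big_seq; apply: ler_sum => r rA.
    have s0 := ltW (scale_gt0 R r).
    have [_ cv _ _] := hp' r; have [rG|/hG h] := boolP (r \in G).
      rewrite mulr1 -[leLHS]addr0 lerD ?mulr_ge0 // ler_piMr //.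
      exact: convex_mass_le1 cv.
    rewrite mulr0 add0r; apply: (@le_trans _ _ (c r * scale R r)).
      by rewrite ler_wpM2l.
    by rewrite ler_wpM2r // ctr.
  rewrite big_split /= -mulr_sumr sum_mem -cAE -/(mass (scale R) A).
  have : t * mass (scale R) A <= t * 2 by rewrite ler_wpM2l // mass_scale.
  by move: massG; rewrite mulr2n; lra.
Qed.

End averaged_blocks.

Section sufficiency.
Variables (R : realType) (s : scalars).
Variables (d : Order.disp_t) (Omega : orderType d).
Hypothesis wf : well_founded (fun eta xi : Omega => (eta < xi)%O).
Variable fs : Omega -> nat -> Omega.
Hypothesis hfs : schreier_sequences fs.
Variables (xi rho : Omega).
Variables (X : schreier_space R s (schreier fs xi)).
Variables (Y : schreier_space R s (schreier fs rho)).
Local Notation K := (scalar_field R s).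
Local Notation S := (schreier fs).
Local Notation coord := Defs.coord.
Local Notation basis := Defs.basis.
Implicit Types (A E G H : {fset nat}) (eps t : R).

Lemma remainder_schreier_pair : remainders xi rho ->
  exists (x : nat -> X) (xs : nat -> X -> K^o), [/\ schreier_pair Y x xs,
    forall i, convex_comb_basis (x i) & forall i, sum_dual_basis (xs i)].
Proof.
move=> [theta _ hx].
have [m [e [B [a [[mm em] hB Be lower upper]]]]] := averaged_blocks R wf hfs hx.
have F0 := schreier_has0 fs xi; have F1 := @schreier_has1 _ _ wf fs hfs xi.
have ac r : convex_on (a r) (B r) by have [] := hB r.
have a0 r k : 0 <= a r k by have [] := ac r.
have BS r : S xi (B r) by have [] := hB r.
pose al (r k : nat) : K := scalar_of_real s (a r k).
have alB r k : al r k != 0 -> k \in B r.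
  by apply: contraNT => kB; have [_ h _] := ac r; rewrite /al h // scalar_of0.
have nal r : (fun k => nrm (al r k)) = a r.
  by apply/funext => k; rewrite nrm_of.
pose ch (r k : nat) : K := (k \in B r)%:R.
have chB r k : ch r k != 0 -> k \in B r.
  by rewrite /ch; case: (k \in B r) => //; rewrite eqxx.
have cal r : c00 (al r) by apply/c00P; exists (B r); exact: alB.
have cch r : c00 (ch r) by apply/c00P; exists (B r); exact: chB.
have dal : disjoint_supports al by exact: (@disjoint_blocks _ _ al B e id alB em Be).
have dch : disjoint_supports ch by exact: (@disjoint_blocks _ _ ch B e id chB em Be).
have minj r r' : m r = m r' -> r = r'.
  by move=> h; have [/mm|/mm|//] := ltngtP r r'; rewrite h ltnn.
have mG r G : (m r \in img m G) = (r \in G).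
  by apply/imgP/idP => [[r' r'G /minj ->//]|rG]; exists r.
have Bdis r r' (k : nat) : k \in B r -> k \in B r' -> r = r'.
  by move=> /Be h /Be h'; rewrite -(blkE em h) -(blkE em h').
have pch r (q : nat -> R) : pairing (B r) (fun k => nrm (ch r k)) q = mass q (B r).
  rewrite /pairing /mass big_seq [RHS]big_seq; apply: eq_bigr => k kB.
  by rewrite /ch kB nrm1 mul1r.
have massG (q : nat -> R) G : norm_le (S xi) q 1 -> S rho (img m G) ->
    \sum_(r <- G) mass q (B r) <= 1.
  move=> q1 GS; have := q1 _ (lower _ GS).
  rewrite {1}/mass partition_disjoint_bigfcup // => r r' _ _ ne.
  by apply/fdisjointP => k kB; apply/negP => kB'; rewrite (Bdis _ _ _ kB kB') eqxx in ne.
have imgE A E : S rho E -> S rho (img m [fset r in A | m r \in E]%fset).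
  by move=> ES; apply: (schreier_sub wf hfs) ES; exact: img_sub.
pose coords := @Defs.coord _ _ _ X : nat -> (X -> K^o).
pose x r := lincomb (basis X) (al r); pose xs r := lincomb coords (ch r).
have I1 A (c : nat -> K) : rnorm (\sum_(r <- A) c r *: x r) <=
    4 * rnorm (\sum_(r <- A) c r *: basis Y (m r)).
  apply: comb_norm_le => // E ES; under eq_bigr do rewrite nal.
  apply: upper => // [r|G GS]; first exact: nrm_ge0.
  apply: le_trans (basis_norm_ge Y A c mm GS).
  by rewrite -sum_mem le_eqVlt; apply/orP; left; apply/eqP/eq_bigr => r _; rewrite mG.
have I2 A (c : nat -> K) : rnorm (\sum_(r <- A) c r *: basis Y (m r)) <=
    rnorm (\sum_(r <- A) c r *: x r).
  apply: basis_norm_le => // E ES; pose G := [fset r in A | m r \in E]%fset.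
  apply: le_trans (comb_norm_ge X A c cal dal (lower G (imgE A E ES))).
  rewrite big_seq [leRHS]big_seq; apply: ler_sum => r rA; rewrite nal.
  rewrite ler_wpM2l ?nrm_ge0 //; case: (boolP (m r \in E)) => [mE|_]; last exact: mass_ge0.
  have [_ _ <-] := ac r; apply: mass_sub => //; apply: (bigfcup_sup (P := xpredT)) => //.
  by rewrite !inE rA.
have I3 A (c : nat -> K) : op_norm (\sum_(r <- A) c r *: xs r : X -> K^o) <=
    op_norm (\sum_(r <- A) c r *: (coord (m r) : Y -> K^o) : Y -> K^o).
  apply: (@comb_dual_norm_le _ _ _ _ _ _ _ B) => // q q0 q1.
  (* p carries q over to X_rho by summing it on each B_r; its norm is at most 1 because the B_r
     unite to sets of S_xi along S_rho. *)
  pose p k : R := \sum_(r <- A) mass q (B r) * (k == m r)%:R.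
  have p0 k : 0 <= p k by rewrite sumr_ge0 // => r _; rewrite mulr_ge0 // mass_ge0.
  have p1 : norm_le (S rho) p 1.
    move=> E ES; apply: le_trans (massG q _ q1 (imgE A E ES)).
    rewrite /mass /p exchange_big /= -/(mass (fun r => mass q (B r)) _) -sum_mem.
    apply: ler_sum => r _; rewrite -mulr_sumr ler_wpM2l ?mass_ge0 //.
    rewrite -(mass_delta R s (m r) E) /mass.
    by apply: ler_sum => k _; rewrite nrm_delta.
  have := dual_basis_norm_ge wf hfs Y A c mm p0 ltr01 p1; rewrite mul1r; apply: le_trans.
  rewrite big_seq [leRHS]big_seq; apply: ler_sum => r rA.
  rewrite pch ler_wpM2l ?nrm_ge0 // /p (big_fsetD1 r) //= eqxx mulr1 lerDl.
  by apply: sumr_ge0 => r' _; rewrite mulr_ge0 // mass_ge0.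
have I4 A (c : nat -> K) : op_norm (\sum_(r <- A) c r *: (coord (m r) : Y -> K^o) : Y -> K^o) <=
    4 * op_norm (\sum_(r <- A) c r *: xs r : X -> K^o).
  apply: (@dual_basis_norm_le _ _ _ _ _ _ Y m) => // p p0 p1.
  (* Conversely, q carries p back along the averages, with norm at most 4 by [upper]. *)
  pose q k : R := \sum_(r <- A) p (m r) * a r k.
  have q0 k : 0 <= q k by rewrite sumr_ge0 // => r _; rewrite mulr_ge0.
  have q4 : norm_le (S xi) q 4.
    move=> E ES; rewrite /mass /q exchange_big /= -[leRHS]mulr1.
    rewrite (eq_bigr (fun r => p (m r) * mass (a r) E)); last by move=> r _; rewrite mulr_sumr.
    apply: (upper (p \o m)) => // [r|G GS]; first exact: p0.
    have GS' : S rho (img m [fset r in A | r \in G]%fset).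
      apply: (schreier_sub wf hfs) GS; apply/fsubsetP => _ /imgP[r + ->].
      by rewrite !inE mG => /andP[].
    by apply: le_trans (p1 _ GS'); rewrite /mass /img [leRHS]big_imfset //= => r r' _ _; exact: minj.
  have := @comb_dual_norm_ge _ _ _ F0 F1 X A c ch B q 4 chB dch q0 (ltr0n _ 4) q4.
  apply: le_trans; rewrite big_seq [leRHS]big_seq; apply: ler_sum => r rA.
  rewrite pch ler_wpM2l ?nrm_ge0 //.
  have [_ _ a1] := ac r; rewrite -[leLHS]mulr1 -a1 /mass mulr_sumr; apply: ler_sum => k _.
  rewrite /q (big_fsetD1 r) //= lerDl.
  by apply: sumr_ge0 => r' _; rewrite mulr_ge0.
have x1 i : rnorm (x i) = 1.
  apply: le_anti; apply/andP; split.
    apply: schreier_norm_lub => // E _; rewrite nal; exact: convex_mass_le1 (ac i).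
  have [_ _ <-] := ac i; rewrite -nal; exact: schreier_norm_ub.
have xs1 i : op_norm (xs i) = 1.
  apply: le_anti; apply/andP; split.
    apply: (@dual_norm_le _ _ _ X _ (B i)) => // [k|q q0 q1]; first exact: chB.
    by rewrite pch; exact: q1.
  have [_ _ a1] := ac i; rewrite -[leLHS]a1 -pch.
  apply: dual_norm_ge => // [k|E _]; [exact: chB|exact: convex_mass_le1 (ac i)].
have xsx i k : xs i (x k) = scalar_of_real s (i == k)%:R.
  rewrite /xs (lincomb_coordE _ (chB i)) /x.
  under eq_bigr do rewrite coord_lincomb //.
  rewrite (eq_big_seq (fun n => scalar_of_real s (a k n))); last first.
    by move=> n nB; rewrite /ch nB mul1r.
  rewrite -scalar_of_sum; congr (scalar_of_real _ _); rewrite -/(mass (a k) (B i)).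
  have [_ h a1] := ac k; case: eqVneq => [->//|ne].
  rewrite /mass big_seq big1 // => n nB; apply: h; apply/negP => nB'.
  by rewrite (Bdis _ _ _ nB nB') eqxx in ne.
exists x, xs; split; first split.
- split=> //; split=> [i xi0|i|i k l].
  + by have := x1 i; rewrite xi0 rnorm0 => /eqP; rewrite eq_sym oner_eq0.
  + by exists (al i).
  + rewrite !coord_lincomb // => /alB /Be /andP[_ h1] /alB /Be /andP[h2 _].
    exact: leq_trans h1 h2.
- split=> //; split=> [i xi0|i|i k l].
  + have := xs1 i; rewrite xi0 => h; have : op_norm (0 : X -> K^o) <= 0.
      by apply: op_norm_le => v _; rewrite rnorm0.
    by rewrite h ler10.
  + by exists (ch i).
  + rewrite !dual_coord_lincomb // => /chB /Be /andP[_ h1] /chB /Be /andP[h2 _].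
    exact: leq_trans h1 h2.
- exists m => //; split.
  + by move=> i k ne; rewrite xsx (negbTE ne) scalar_of0.
  + move=> i; have -> : modulus (basis X) (@Defs.coord _ _ _ X) (x i) = x i.
      rewrite /modulus /x; congr lincomb; apply/funext => k.
      by rewrite coord_lincomb // ger0_norm // scalar_of_ge0.
    have -> : modulus (@Defs.coord _ _ _ X) (@dual_coord _ _ _ X) (xs i) = xs i.
      rewrite /modulus /xs; congr lincomb; apply/funext => k.
      by rewrite dual_coord_lincomb // /ch ger0_norm // ler0n.
    by rewrite xsx scalar_re_of.
  + have -> : range (fun i => scalar_re (xs i (x i))) = [set 1].
      apply/seteqP; split=> [_ [i _ <-]|_ ->]; first by rewrite xsx scalar_re_of eqxx.
      by exists 0%N => //; rewrite xsx scalar_re_of eqxx.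
    by rewrite inf1.
  + split; exists 4 => // c /c00P[E hE]; rewrite !(lincombE _ hE).
      split; first exact: I1.
      apply: le_trans (I2 E c) _; rewrite ler_peMl ?rnorm_ge0 //; lra.
    split; last exact: I4.
    apply: le_trans (I3 E c) _; rewrite ler_peMl //; last lra.
    (* At the zero vector this says that the dual norm is nonnegative. *)
    have := @dual_basis_norm_ge _ _ _ _ wf _ hfs _ Y m E c (fun=> 0) 1 mm (fun=> lexx 0) ltr01.
    rewrite mul1r => h; apply: le_trans (h _); last by move=> G _; rewrite /mass big1.
    by apply: sumr_ge0 => r _; rewrite mulr0.
  (* The coefficient of x_r is xs_r v, of modulus at most the mass of v on B_r. Along S_rho these
     masses sum to at most 1, by [lower], and [upper] turns this into the bound 4. *)
  + exists 4 => _ [n _ <-]; apply: op_norm_le => v v1.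
    pose A := [fset i in iota 0%N n]%fset; pose c r := xs r v.
    have -> : (\sum_(i < n) tensor (x i) (xs i)) v = \sum_(r <- A) c r *: x r.
      rewrite fct_sumE -(big_mkord xpredT (fun i => tensor (x i) (xs i) v)).
      apply: perm_big; apply: uniq_perm; rewrite ?fset_uniq ?iota_uniq // => k.
      by rewrite /index_iota subn0 !inE.
    apply: comb_norm_le => // E ES; under eq_bigr do rewrite nal.
    rewrite -[leRHS]mulr1; apply: upper => // [r|G GS]; first exact: nrm_ge0.
    have GS' : S rho (img m [fset r in A | r \in G]%fset).
      apply: (schreier_sub wf hfs) GS; apply/fsubsetP => _ /imgP[r + ->].
      by rewrite !inE mG => /andP[].
    have v1' : norm_le (S xi) (fun k => nrm (coord k v)) 1.
      by move=> H HS; exact: le_trans (mass_coord_le _ HS) v1.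
    apply: le_trans (massG _ _ v1' GS'); apply: ler_sum => r _.
    rewrite -pch /c /xs (lincomb_coordE _ (chB r)).
    apply: le_trans (nrm_sum _ _ _) _.
    by apply: ler_sum => k _; rewrite nrmM.
- move=> i; have [_ _ a1] := ac i; exists (B i), (al i); split.
  + by move=> k _; rewrite scalar_of_ge0.
  + by rewrite -scalar_of_sum -/(mass (a i) (B i)) a1 scalar_of1.
  + by rewrite -(lincombE _ (alB i)).
- move=> i; exists (B i); rewrite /xs (lincombE _ (chB i)).
  by rewrite big_seq [RHS]big_seq; apply: eq_bigr => k kB; rewrite /ch kB scale1r.
Qed.

End sufficiency.

Theorem theorem1p2 (R : realType) (s : scalars)
    (d : Order.disp_t) (Omega : orderType d) (hOmega : is_omega1 Omega)
    (fs : Omega -> nat -> Omega) (hfs : schreier_sequences fs)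
    (xi rho : Omega)
    (X : schreier_space R s (schreier fs xi))
    (Y : schreier_space R s (schreier fs rho)) :
  let C1 := remainders xi rho in
  let C2 := exists x : nat -> X, normalized_block x /\
    exists2 j, increasing j & equiv_subbasis Y x j in
  let C3 := exists xs : nat -> X -> (scalar_field R s)^o,
    dual_normalized_block xs /\
    exists2 j, increasing j & equiv_dual_subbasis Y xs j in
  let C4 := exists x : nat -> X, exists xs : nat -> X -> (scalar_field R s)^o,
    schreier_pair Y x xs in
  [<-> C1; C2; C3; C4] /\
  (C1 \/ C2 \/ C3 \/ C4 ->
   exists x : nat -> X, exists xs : nat -> X -> (scalar_field R s)^o,
     [/\ schreier_pair Y x xs,
         forall i, convex_comb_basis (x i) &
         forall i, sum_dual_basis (xs i)]).
Proof.
move=> C1 C2 C3 C4; have [wf _ _] := hOmega.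
have C1strong := remainder_schreier_pair wf hfs X Y.
have C14 : C1 -> C4 by move=> /C1strong[x [xs [h _ _]]]; exists x, xs.
have C42 : C4 -> C2.
  by move=> [x [xs [hx _ [j jm [_ _ _ [h _] _]]]]]; exists x; split=> //; exists j.
have C43 : C4 -> C3.
  by move=> [x [xs [_ hxs [j jm [_ _ _ [_ h] _]]]]]; exists xs; split=> //; exists j.
have C21 : C2 -> C1.
  by move=> [x [hx [j jm h]]]; have := remainder_of_blocks wf hfs hx jm h.
have C31 : C3 -> C1.
  by move=> [xs [hxs [j jm h]]]; have := remainder_of_dual_blocks wf hfs hxs jm h.
split; first by tfae; [move=> /C14/C42|move=> /C21/C14/C43|move=> /C31/C14|move=> /C42/C21].
by move=> h; apply: C1strong; case: h => [//|[/C21//|[/C31//|/C42/C21//]]].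
Qed.
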